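(* Let $\mu<0$, let $z_0,w_0\in\mathbb{D}$, and let $f:\mathbb{D}\to\mathbb{D}$ be holomorphic. Then the set $$\mathcal{D}_\mu(f)=\mathcal{D}_\mu(f;z_0,w_0):=\big\{z\in\mathbb{D}\colon k_{\mathbb{D}}(z,z_0)-k_{\mathbb{D}}(f(z),w_0)<\mu\big\}$$ is either empty or a strictly hyperbolically convex domain.
   Context: $\mathbb{D}=\{z\in\mathbb{C}:|z|<1\}$ is the open unit disk, equipped with the Poincaré distance $$k_{\mathbb{D}}(z,w)=\log\frac{1+\rho(z,w)}{1-\rho(z,w)},\qquad \rho(z,w)=\left|\frac{z-w}{1-\overline{w}z}\right|.$$ Hyperbolic geodesics are the diameters of $\mathbb{D}$ and the arcs in $\mathbb{D}$ of circles orthogonal to $\partial\mathbb{D}$. For $z_1,z_2\in\mathbb{D}$, $[z_1,z_2]_h$ denotes the unique hyperbolic geodesic segment joining $z_1$ and $z_2$. A set $\Omega\subset\mathbb{D}$ is hyperbolically convex (h-convex) if $[z_1,z_2]_h\subset\Omega$ whenever $z_1,z_2\in\Omega$. It is strictly hyperbolically convex if, in addition, every hyperbolic geodesic intersects $\partial\Omega$ at two points at most. A domain is a nonempty connected open set. *)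

(* Defs.v *)
From Stdlib Require Import Reals.
From Coquelicot Require Import Coquelicot.
Open Scope R_scope.

Definition unit_disk (z : C) : Prop := Cmod z < 1.

(* Complex differentiability at every point of [U]; for functions given on all
   of C, only the values near points of [U] matter when [U] is open. *)
Definition holomorphic_on (U : C -> Prop) (f : C -> C) : Prop :=
  forall z : C, U z -> ex_derive (K := C_AbsRing) (V := C_NormedModule) f z.

Definition rho (z w : C) : R := Cmod ((z - w) / (1 - Cconj w * z))%C.

Definition k_disk (z w : C) : R := ln ((1 + rho z w) / (1 - rho z w)).

Definition connected (A : C -> Prop) : Prop :=
  ~ exists U V : C -> Prop,
      open (T := C_UniformSpace) U /\ open (T := C_UniformSpace) V /\
      (forall z, A z -> U z \/ V z) /\
      (exists z, A z /\ U z) /\ (exists z, A z /\ V z) /\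
      (forall z, A z -> ~ (U z /\ V z)).

Definition is_domain (A : C -> Prop) : Prop :=
  (exists z, A z) /\ connected A /\ open (T := C_UniformSpace) A.

Definition boundary (A : C -> Prop) (z : C) : Prop :=
  forall eps : R, 0 < eps ->
    (exists w, Cmod (w - z) < eps /\ A w) /\
    (exists w, Cmod (w - z) < eps /\ ~ A w).

Definition circle (c : C) (r : R) (z : C) : Prop := Cmod (z - c) = r.

(* Two circles are orthogonal if they meet, and the radii through each common
   point are perpendicular; Re (conj u * v) is the scalar product of u and v
   in the plane. *)
Definition orthogonal_circles (c1 : C) (r1 : R) (c2 : C) (r2 : R) : Prop :=
  (exists p, circle c1 r1 p /\ circle c2 r2 p) /\
  (forall p, circle c1 r1 p -> circle c2 r2 p ->
     Re (Cconj (p - c1) * (p - c2))%C = 0).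

Definition diameter (G : C -> Prop) : Prop :=
  exists u : C, Cmod u = 1 /\
    forall z, G z <-> exists t : R, -1 < t < 1 /\ z = (RtoC t * u)%C.

Definition orthogonal_arc (G : C -> Prop) : Prop :=
  exists (c : C) (r : R), 0 < r /\ orthogonal_circles 0 1 c r /\
    forall z, G z <-> unit_disk z /\ circle c r z.

Definition hgeodesic (G : C -> Prop) : Prop := diameter G \/ orthogonal_arc G.

(* The arc between z1 and z2 of the geodesic through them, as the smallest
   connected subset of a geodesic that contains z1 and z2 (it is {z1} when
   z1 = z2). *)
Definition hsegment (z1 z2 : C) (z : C) : Prop :=
  forall A : C -> Prop,
    connected A -> (exists G, hgeodesic G /\ forall w, A w -> G w) ->
    A z1 -> A z2 -> A z.

Definition hconvex (Omega : C -> Prop) : Prop :=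
  (forall z, Omega z -> unit_disk z) /\
  (forall z1 z2, Omega z1 -> Omega z2 ->
     forall z, hsegment z1 z2 z -> Omega z).

Definition strictly_hconvex (Omega : C -> Prop) : Prop :=
  hconvex Omega /\
  (forall G, hgeodesic G ->
     exists a b : C, forall z, G z -> boundary Omega z -> z = a \/ z = b).

Definition D_mu (mu : R) (f : C -> C) (z0 w0 : C) (z : C) : Prop :=
  unit_disk z /\ k_disk z z0 - k_disk (f z) w0 < mu.

(* Main.v *)
Require Import Defs.
From Stdlib Require Import Reals.
From Coquelicot Require Import Coquelicot.
From Stdlib Require Import Lra Classical ClassicalEpsilon.
Open Scope R_scope.

(** Write [phi z = k z z0 - k (f z) w0], so that the set in question is
    [phi < mu]; as [mu < 0], on it [f z] is farther from [w0] than [z] is from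
    [z0].

    The set is star-shaped with respect to [z0]: along a geodesic ray from [z0],
    the distance to [z0] grows at unit speed, while by the Schwarz-Pick lemma
    the distance of [f z] to [w0] grows at most at unit speed; so [phi] does not
    decrease ([defect_seg_le]). Hence the set is connected, and contains [z0]
    unless it is empty. It is open because [phi] is continuous.

    The heart of the proof is a local fact ([no_local_max_at_0]): if
    [phi z0 < mu < 0], then [phi] has no local maximum with value [mu] along a
    geodesic. After Moebius changes of variable the point is 0, [f 0 = 0] and the
    geodesic is the real diameter. Write [f z = z g z], where [|g| <= 1]. Moving
    [z0] outwards along its ray from 0 by the distance [- mu], to [p'], the
    triangle inequality turns the assumption into
    [k t p' <= k t z0 - mu <= k (f t) w0] for small real [t], with equality at 0.
    When the outer inequality is added up for [t] and [- t], the decisive term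
    contains [g t - g (- t)], which the Schwarz-Pick lemma for [g] bounds by
    [2 t (1 - |g 0|^2)] to first order; there results
    [(1 - |g 0|^2) (1 - |w0|)^2 <= 0], for the transformed [w0]. So [|g 0| = 1],
    [f] is a rotation, and the case of equality in the triangle inequality leads
    to [phi z0 = mu].

    Convexity follows by continuity ([sublevel_seg]): let two end points run from
    [z0] along the segments to two given points of the set. They stay in the set,
    and if the segment between them ever left it, it would first touch the level
    [mu] from below at an interior point, which is a local maximum of [phi] along
    it. Strictness is similar: of three boundary points on a geodesic one lies
    between the two others; all three have [phi = mu], and [phi <= mu] between the
    outer ones, since these are limits of points of the convex set
    ([no_boundary_between]).

    The Schwarz-Pick lemma is needed for [g], which is differentiable off 0 but
    only known to be continuous at 0, and for [f], whose derivative need not be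
    continuous a priori. So the maximum principle is derived from Goursat's
    theorem, applied to rectangles in polar coordinates: this shows that the mean
    of a holomorphic function over a circle is its value at the centre. *)

(** * Bisection of rectangles *)

Definition in_rect (x y a b px py : R) : Prop :=
  x <= px <= x + a /\ y <= py <= y + b.

Definition subrect (x y a b x0 y0 a0 b0 : R) : Prop :=
  x0 <= x /\ x + a <= x0 + a0 /\ y0 <= y /\ y + b <= y0 + b0.

Lemma nested_limit (u : nat -> R) (a : R) :
  (forall n, u n <= u (S n)) ->
  (forall n, u (S n) + a / 2 ^ (S n) <= u n + a / 2 ^ n) -> 0 < a ->
  exists l, forall n, u n <= l <= u n + a / 2 ^ n.
Proof.
  intros Hu Hd Ha.
  assert (Hmono : forall n p, u n <= u (n + p)%nat).
  { intros n p; induction p as [|p IH]; [rewrite Nat.add_0_r; lra|].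
    rewrite Nat.add_succ_r. specialize (Hu (n + p)%nat). lra. }
  assert (Hanti : forall n p, u (n + p)%nat + a / 2 ^ (n + p) <= u n + a / 2 ^ n).
  { intros n p; induction p as [|p IH]; [rewrite Nat.add_0_r; lra|].
    rewrite Nat.add_succ_r. specialize (Hd (n + p)%nat). lra. }
  assert (Hpos : forall n, 0 < a / 2 ^ n).
  { intros n. apply Rdiv_lt_0_compat; [lra|apply pow_lt; lra]. }
  assert (Hcross : forall m n, u m <= u n + a / 2 ^ n).
  { intros m n. specialize (Hmono m n). specialize (Hanti n m).
    rewrite (Nat.add_comm n m) in Hanti. specialize (Hpos (m + n)%nat). lra. }
  destruct (completeness (fun r => exists n, r = u n)) as [l [Hl1 Hl2]].
  - exists (u 0%nat + a / 2 ^ 0). intros r [n ->]. apply Hcross.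
  - exists (u 0%nat); exists 0%nat; reflexivity.
  - exists l. intros n; split.
    + apply Hl1; exists n; reflexivity.
    + apply Hl2. intros r [m ->]. apply Hcross.
Qed.

Lemma small_dyadic (a d : R) : 0 < d -> exists n, a / 2 ^ n < d.
Proof.
  intros Hd.
  destruct (pow_lt_1_zero (/ 2)) with (y := d / (1 + Rabs a)) as [N HN].
  - rewrite Rabs_pos_eq; lra.
  - apply Rdiv_lt_0_compat; [lra|]. pose proof (Rabs_pos a); lra.
  - exists N. specialize (HN N (Nat.le_refl _)).
    assert (H1 : 0 < 1 + Rabs a) by (pose proof (Rabs_pos a); lra).
    assert (H2 : 0 < (/ 2) ^ N) by (apply pow_lt; lra).
    rewrite Rabs_pos_eq in HN by lra.
    apply (Rmult_lt_compat_r (1 + Rabs a)) in HN; [|lra].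
    unfold Rdiv in HN at 1. rewrite Rmult_assoc, Rinv_l, Rmult_1_r in HN by lra.
    unfold Rdiv. rewrite <- pow_inv.
    pose proof (Rle_abs a). nra.
Qed.

(** If [P] failed for the whole rectangle, it would fail for nested quarters that
    shrink to a point, contrary to its validity for all small rectangles around
    that point. *)
Lemma bisection (P : R -> R -> R -> R -> Prop) (x0 y0 a0 b0 : R) :
  0 < a0 -> 0 < b0 ->
  (forall x y a b, 0 < a -> 0 < b -> subrect x y a b x0 y0 a0 b0 ->
     P x y (a / 2) (b / 2) -> P (x + a / 2) y (a / 2) (b / 2) ->
     P x (y + b / 2) (a / 2) (b / 2) ->
     P (x + a / 2) (y + b / 2) (a / 2) (b / 2) -> P x y a b) ->
  (forall px py, in_rect x0 y0 a0 b0 px py ->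
     exists d, 0 < d /\ forall x y a b, 0 < a < d -> 0 < b < d ->
       subrect x y a b x0 y0 a0 b0 -> in_rect x y a b px py -> P x y a b) ->
  P x0 y0 a0 b0.
Proof.
  intros Ha Hb Hstep Hloc.
  destruct (classic (P x0 y0 a0 b0)) as [H|Hno]; [exact H|exfalso].
  set (next := fun (n : nat) (c : R * R) =>
    let a := a0 / 2 ^ n / 2 in let b := b0 / 2 ^ n / 2 in
    let (x, y) := c in
    if excluded_middle_informative (~ P x y a b) then (x, y) else
    if excluded_middle_informative (~ P (x + a) y a b) then (x + a, y) else
    if excluded_middle_informative (~ P x (y + b) a b) then (x, y + b) else
    (x + a, y + b)).
  set (c := fix c (n : nat) : R * R :=
    match n with O => (x0, y0) | S n => next n (c n) end).
  assert (Hsz : forall t n, t / 2 ^ (S n) = t / 2 ^ n / 2).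
  { intros t n. simpl. field. apply pow_nonzero; lra. }
  assert (Hpa : forall t n, 0 < t -> 0 < t / 2 ^ n).
  { intros t n Ht. apply Rdiv_lt_0_compat; [lra|apply pow_lt; lra]. }
  assert (Hinv : forall n, subrect (fst (c n)) (snd (c n)) (a0 / 2 ^ n) (b0 / 2 ^ n) x0 y0 a0 b0
     /\ ~ P (fst (c n)) (snd (c n)) (a0 / 2 ^ n) (b0 / 2 ^ n)).
  { intros n; induction n as [|n [IH1 IH2]].
    - simpl. replace (a0 / 1) with a0 by field. replace (b0 / 1) with b0 by field.
      split; [unfold subrect; lra|exact Hno].
    - rewrite !Hsz. change (c (S n)) with (next n (c n)).
      destruct (c n) as [x y]. simpl fst in *; simpl snd in *. unfold next.
      pose proof (Hpa a0 n Ha) as Ha'. pose proof (Hpa b0 n Hb) as Hb'.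
      specialize (Hstep x y _ _ Ha' Hb' IH1). unfold subrect in *.
      repeat (destruct excluded_middle_informative); simpl;
        (split; [lra|try assumption]).
      intros H4. apply IH2. apply Hstep; try (apply NNPP; assumption). exact H4. }
  assert (Hmon : forall n, fst (c n) <= fst (c (S n)) /\ snd (c n) <= snd (c (S n)) /\
     fst (c (S n)) + a0 / 2 ^ (S n) <= fst (c n) + a0 / 2 ^ n /\
     snd (c (S n)) + b0 / 2 ^ (S n) <= snd (c n) + b0 / 2 ^ n).
  { intros n. rewrite !Hsz. change (c (S n)) with (next n (c n)).
    destruct (c n) as [x y]. unfold next.
    pose proof (Hpa a0 n Ha) as Ha'. pose proof (Hpa b0 n Hb) as Hb'.
    repeat (destruct excluded_middle_informative); simpl; lra. }
  destruct (nested_limit (fun n => fst (c n)) a0) as [px Hpx]; try (intros; apply Hmon); try lra.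
  destruct (nested_limit (fun n => snd (c n)) b0) as [py Hpy]; try (intros; apply Hmon); try lra.
  assert (Hin : in_rect x0 y0 a0 b0 px py).
  { specialize (Hpx 0%nat); specialize (Hpy 0%nat); simpl in Hpx, Hpy.
    unfold in_rect. lra. }
  destruct (Hloc px py Hin) as [d [Hd HP]].
  destruct (small_dyadic a0 d Hd) as [n1 Hn1].
  destruct (small_dyadic b0 d Hd) as [n2 Hn2].
  set (n := Nat.max n1 n2).
  assert (Hle : forall t p, 0 < t -> (p <= n)%nat -> t / 2 ^ n <= t / 2 ^ p).
  { intros t p Ht Hp. unfold Rdiv. apply Rmult_le_compat_l; [lra|].
    apply Rinv_le_contravar; [apply pow_lt; lra|]. apply Rle_pow; [lra|exact Hp]. }
  pose proof (Hle a0 n1 Ha (Nat.le_max_l _ _)). pose proof (Hle b0 n2 Hb (Nat.le_max_r _ _)).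
  destruct (Hinv n) as [Hs HnP]. apply HnP. apply HP; auto.
  - split; [auto|lra].
  - split; [auto|lra].
  - split; auto.
Qed.

(** Only upper semicontinuity is assumed, so that the lemma also finds extremal
    points of a closed subset, as the maximum of a function that is lowered
    outside of it. *)
Lemma rect_max (g : R -> R -> R) (x0 y0 a0 b0 : R) :
  0 < a0 -> 0 < b0 ->
  (forall px py, in_rect x0 y0 a0 b0 px py -> forall c, g px py < c ->
     exists d, 0 < d /\ forall x y, in_rect x0 y0 a0 b0 x y ->
       Rabs (x - px) < d -> Rabs (y - py) < d -> g x y < c) ->
  exists mx my, in_rect x0 y0 a0 b0 mx my /\
    forall x y, in_rect x0 y0 a0 b0 x y -> g x y <= g mx my.
Proof.
  intros Ha Hb Hg.
  apply (bisection (fun x y a b => exists mx my, in_rect x0 y0 a0 b0 mx my /\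
    forall x' y', in_rect x y a b x' y' -> g x' y' <= g mx my) x0 y0 a0 b0); auto.
  - intros x y a b Hpa Hpb _ [m1 [n1 [I1 H1]]] [m2 [n2 [I2 H2]]] [m3 [n3 [I3 H3]]] [m4 [n4 [I4 H4]]].
    assert (exists mx my, in_rect x0 y0 a0 b0 mx my /\ g m1 n1 <= g mx my /\ g m2 n2 <= g mx my
       /\ g m3 n3 <= g mx my /\ g m4 n4 <= g mx my) as [mx [my [I H]]].
    { destruct (Rle_dec (g m1 n1) (g m2 n2)), (Rle_dec (g m3 n3) (g m4 n4)).
      - destruct (Rle_dec (g m2 n2) (g m4 n4)); [exists m4, n4|exists m2, n2]; split; auto; lra.
      - destruct (Rle_dec (g m2 n2) (g m3 n3)); [exists m3, n3|exists m2, n2]; split; auto; lra.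
      - destruct (Rle_dec (g m1 n1) (g m4 n4)); [exists m4, n4|exists m1, n1]; split; auto; lra.
      - destruct (Rle_dec (g m1 n1) (g m3 n3)); [exists m3, n3|exists m1, n1]; split; auto; lra. }
    exists mx, my; split; [exact I|]. intros x' y' [Hx' Hy'].
    destruct (Rle_dec x' (x + a / 2)), (Rle_dec y' (y + b / 2)).
    + assert (g x' y' <= g m1 n1) by (apply H1; unfold in_rect; lra). lra.
    + assert (g x' y' <= g m3 n3) by (apply H3; unfold in_rect; lra). lra.
    + assert (g x' y' <= g m2 n2) by (apply H2; unfold in_rect; lra). lra.
    + assert (g x' y' <= g m4 n4) by (apply H4; unfold in_rect; lra). lra.
  - intros px py Hp.
    assert (Hin : forall x y a b x' y', subrect x y a b x0 y0 a0 b0 -> in_rect x y a b x' y' ->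
      in_rect x0 y0 a0 b0 x' y') by (unfold subrect, in_rect; intros; lra).
    destruct (classic (exists mx my, in_rect x0 y0 a0 b0 mx my /\ g px py < g mx my))
      as [[mx [my [I H]]]|Hno].
    + destruct (Hg px py Hp _ H) as [d [Hd Hgd]]. exists d; split; [exact Hd|].
      intros x y a b Hda Hdb Hs Hi. exists mx, my; split; [exact I|]. intros x' y' Hi'.
      left. apply Hgd; [eapply Hin; eauto| |]; unfold in_rect in *; apply Rabs_def1; lra.
    + exists 1; split; [lra|]. intros x y a b _ _ Hs _. exists px, py; split; [exact Hp|].
      intros x' y' Hi'. apply Rnot_lt_le. intros Hlt. apply Hno. exists x', y'.
      split; [eapply Hin; eauto|exact Hlt].
Qed.

(** * Continuity of complex-valued maps *)

Notation ctsC f x := (continuous (U := C_UniformSpace) f x).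

Lemma continuous_Re_Im {U : UniformSpace} (f : U -> C) (x : U) :
  continuous (fun u => Re (f u)) x -> continuous (fun u => Im (f u)) x -> ctsC f x.
Proof.
  intros H1 H2. apply filterlim_locally. intros eps.
  pose proof (proj1 (filterlim_locally _ _) H1 eps) as L1.
  pose proof (proj1 (filterlim_locally _ _) H2 eps) as L2.
  generalize (filter_and _ _ L1 L2). apply filter_imp. intros u [A B]. split; assumption.
Qed.

Lemma continuous_Re {U : UniformSpace} (f : U -> C) (x : U) :
  ctsC f x -> continuous (fun u => Re (f u)) x.
Proof.
  intros H. apply filterlim_locally. intros eps.
  generalize (proj1 (filterlim_locally _ _) H eps). apply filter_imp.
  intros u [A B]; exact A.
Qed.

Lemma continuous_Im {U : UniformSpace} (f : U -> C) (x : U) :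
  ctsC f x -> continuous (fun u => Im (f u)) x.
Proof.
  intros H. apply filterlim_locally. intros eps.
  generalize (proj1 (filterlim_locally _ _) H eps). apply filter_imp.
  intros u [A B]; exact B.
Qed.

Lemma continuous_Rplus {U : UniformSpace} (f g : U -> R) x :
  continuous f x -> continuous g x -> continuous (fun u => f u + g u) x.
Proof. intros; apply (continuous_plus (V := R_NormedModule)); assumption. Qed.
Lemma continuous_Ropp {U : UniformSpace} (f : U -> R) x :
  continuous f x -> continuous (fun u => - f u) x.
Proof. intros; apply (continuous_opp (V := R_NormedModule)); assumption. Qed.
Lemma continuous_Rminus {U : UniformSpace} (f g : U -> R) x :
  continuous f x -> continuous g x -> continuous (fun u => f u - g u) x.
Proof. intros; apply (continuous_minus (V := R_NormedModule)); assumption. Qed.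
Lemma continuous_Rmult {U : UniformSpace} (f g : U -> R) x :
  continuous f x -> continuous g x -> continuous (fun u => f u * g u) x.
Proof. intros; apply (continuous_mult (K := R_AbsRing)); assumption. Qed.
Lemma continuous_Rdiv {U : UniformSpace} (f g : U -> R) x :
  continuous f x -> continuous g x -> g x <> 0 -> continuous (fun u => f u / g u) x.
Proof.
  intros. apply continuous_Rmult; [assumption|].
  apply (continuous_comp g Rinv); [assumption|]. now apply continuous_Rinv.
Qed.

Lemma continuous_Cplus {U : UniformSpace} (f g : U -> C) x :
  ctsC f x -> ctsC g x -> ctsC (fun u => f u + g u)%C x.
Proof.
  intros Hf Hg; apply continuous_Re_Im.
  - apply (continuous_Rplus (fun u => Re (f u)) (fun u => Re (g u))); now apply continuous_Re.
  - apply (continuous_Rplus (fun u => Im (f u)) (fun u => Im (g u))); now apply continuous_Im.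
Qed.

Lemma continuous_Copp {U : UniformSpace} (f : U -> C) x :
  ctsC f x -> ctsC (fun u => - f u)%C x.
Proof.
  intros Hf; apply continuous_Re_Im.
  - apply (continuous_Ropp (fun u => Re (f u))); now apply continuous_Re.
  - apply (continuous_Ropp (fun u => Im (f u))); now apply continuous_Im.
Qed.

Lemma continuous_Cminus {U : UniformSpace} (f g : U -> C) x :
  ctsC f x -> ctsC g x -> ctsC (fun u => f u - g u)%C x.
Proof. intros; apply continuous_Cplus; [|apply continuous_Copp]; assumption. Qed.

Lemma continuous_Cconj {U : UniformSpace} (f : U -> C) x :
  ctsC f x -> ctsC (fun u => Cconj (f u)) x.
Proof.
  intros Hf; apply continuous_Re_Im.
  - now apply (continuous_Re f).
  - apply (continuous_Ropp (fun u => Im (f u))); now apply continuous_Im.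
Qed.

Lemma continuous_RtoC {U : UniformSpace} (f : U -> R) x :
  continuous f x -> ctsC (fun u => RtoC (f u)) x.
Proof. intros; apply continuous_Re_Im; [assumption|apply continuous_const]. Qed.

Lemma continuous_Cmult {U : UniformSpace} (f g : U -> C) x :
  ctsC f x -> ctsC g x -> ctsC (fun u => f u * g u)%C x.
Proof.
  intros Hf Hg.
  pose proof (continuous_Re f x Hf). pose proof (continuous_Im f x Hf).
  pose proof (continuous_Re g x Hg). pose proof (continuous_Im g x Hg).
  apply continuous_Re_Im.
  - apply (continuous_Rminus (fun u => Re (f u) * Re (g u)) (fun u => Im (f u) * Im (g u)));
      apply continuous_Rmult; assumption.
  - apply (continuous_Rplus (fun u => Re (f u) * Im (g u)) (fun u => Im (f u) * Re (g u)));
      apply continuous_Rmult; assumption.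
Qed.

Lemma continuous_Cmod_sqr {U : UniformSpace} (f : U -> C) x :
  ctsC f x -> continuous (fun u => fst (f u) ^ 2 + snd (f u) ^ 2) x.
Proof.
  intros Hf. pose proof (continuous_Re f x Hf). pose proof (continuous_Im f x Hf).
  apply (continuous_Rplus (fun u => Re (f u) * (Re (f u) * 1)) (fun u => Im (f u) * (Im (f u) * 1)));
    repeat apply continuous_Rmult; try apply continuous_const; assumption.
Qed.

Lemma Re_Im_sqr_pos (z : C) : z <> 0%C -> 0 < Re z ^ 2 + Im z ^ 2.
Proof. intros Hz. rewrite <- Cmod2_alt. apply Cmod_gt_0 in Hz. nra. Qed.

Lemma continuous_Cinv {U : UniformSpace} (f : U -> C) x :
  ctsC f x -> f x <> 0%C -> ctsC (fun u => / f u)%C x.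
Proof.
  intros Hf Hn. apply Re_Im_sqr_pos, Rgt_not_eq in Hn.
  pose proof (continuous_Cmod_sqr f x Hf) as Hs.
  apply continuous_Re_Im.
  - apply (continuous_Rdiv (fun u => Re (f u)) (fun u => fst (f u) ^ 2 + snd (f u) ^ 2));
      try assumption. now apply continuous_Re.
  - apply (continuous_Rdiv (fun u => - Im (f u)) (fun u => fst (f u) ^ 2 + snd (f u) ^ 2));
      try assumption. apply continuous_Ropp. now apply continuous_Im.
Qed.

Lemma continuous_Cdiv {U : UniformSpace} (f g : U -> C) x :
  ctsC f x -> ctsC g x -> g x <> 0%C -> ctsC (fun u => f u / g u)%C x.
Proof. intros; apply continuous_Cmult; [|apply continuous_Cinv]; assumption. Qed.

Lemma continuous_Cmod {U : UniformSpace} (f : U -> C) x :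
  ctsC f x -> continuous (fun u => Cmod (f u)) x.
Proof.
  intros Hf. apply (continuous_comp (fun u => fst (f u) ^ 2 + snd (f u) ^ 2) sqrt).
  - apply continuous_Cmod_sqr, Hf.
  - apply continuous_sqrt.
Qed.

(** Proves continuity along the syntax of the map, and leaves the nonvanishing of
    denominators. The match is syntactic because unification would unfold the
    complex operations. *)
Ltac cts := try assumption; lazymatch goal with
  | |- continuous (fun _ => ?c) _ => apply continuous_const
  | |- continuous (fun u => u) _ => apply continuous_id
  | |- continuous Cmod _ => apply (continuous_Cmod (fun z => z)), continuous_id
  | |- continuous Cconj _ => apply (continuous_Cconj (fun z => z)), continuous_id
  | |- continuous RtoC _ => apply (continuous_RtoC (fun z => z)), continuous_id
  | |- continuous fst _ => apply continuous_fst
  | |- continuous snd _ => apply continuous_snd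
  | |- continuous (fun u => fst u) _ => apply continuous_fst
  | |- continuous (fun u => snd u) _ => apply continuous_snd
  | |- continuous (fun u => Cplus _ _) _ => apply continuous_Cplus; cts
  | |- continuous (fun u => Cminus _ _) _ => apply continuous_Cminus; cts
  | |- continuous (fun u => Copp _) _ => apply continuous_Copp; cts
  | |- continuous (fun u => Cmult _ _) _ => apply continuous_Cmult; cts
  | |- continuous (fun u => Cdiv _ _) _ => apply continuous_Cdiv; cts
  | |- continuous (fun u => Cinv _) _ => apply continuous_Cinv; cts
  | |- continuous (fun u => Cconj _) _ => apply continuous_Cconj; cts
  | |- continuous (fun u => RtoC _) _ => apply continuous_RtoC; cts
  | |- continuous (fun u => Cmod _) _ => apply continuous_Cmod; cts
  | |- continuous (fun u => Re _) _ => apply continuous_Re; cts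
  | |- continuous (fun u => Im _) _ => apply continuous_Im; cts
  | |- continuous (fun u => Rplus _ _) _ => apply continuous_Rplus; cts
  | |- continuous (fun u => Rminus _ _) _ => apply continuous_Rminus; cts
  | |- continuous (fun u => Ropp _) _ => apply continuous_Ropp; cts
  | |- continuous (fun u => Rmult _ _) _ => apply continuous_Rmult; cts
  | |- continuous (fun u => Rdiv _ _) _ => apply continuous_Rdiv; cts
  | |- _ => idtac
  end.

Lemma Cmod_lt_of_coords (z : C) (d : R) :
  Rabs (Re z) < d / 2 -> Rabs (Im z) < d / 2 -> Cmod z < d.
Proof.
  intros H1 H2. eapply Rle_lt_trans; [apply Cmod_2Rmax|].
  change (Rabs (fst z) < d / 2) in H1. change (Rabs (snd z) < d / 2) in H2.
  assert (H3 : Rmax (Rabs (fst z)) (Rabs (snd z)) < d / 2) by (apply Rmax_lub_lt; assumption).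
  assert (H4 : sqrt 2 < 2) by (rewrite <- (sqrt_pow2 2) at 2 by lra; apply sqrt_lt_1; lra).
  pose proof (Rabs_pos (fst z)). pose proof (Rmax_l (Rabs (fst z)) (Rabs (snd z))).
  pose proof (sqrt_pos 2). nra.
Qed.

Lemma locally_Cmod (z : C) (P : C -> Prop) :
  locally (T := C_UniformSpace) z P <->
  exists d, 0 < d /\ forall w, Cmod (w - z) < d -> P w.
Proof.
  split.
  - intros [d Hd]. exists d; split; [apply cond_pos|]. intros w Hw. apply Hd.
    pose proof (Rmax_Cmod (w - z)%C) as Hm.
    split; [change (Rabs (Re w - Re z) < d)|change (Rabs (Im w - Im z) < d)];
      eapply Rle_lt_trans; [|exact Hw| |exact Hw]; (eapply Rle_trans; [|exact Hm]);
      [apply Rmax_l|apply Rmax_r].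
  - intros [d [Hd H]].
    assert (Hd2 : 0 < d / 2) by lra.
    exists (mkposreal _ Hd2). intros w [H1 H2].
    change (Rabs (Re w - Re z) < d / 2) in H1. change (Rabs (Im w - Im z) < d / 2) in H2.
    apply H, Cmod_lt_of_coords; assumption.
Qed.

Lemma continuous_C_eps (f : C -> C) (z : C) :
  continuous (T := C_UniformSpace) (U := C_UniformSpace) f z <->
  forall e, 0 < e -> exists d, 0 < d /\ forall w, Cmod (w - z) < d -> Cmod (f w - f z) < e.
Proof.
  split.
  - intros H e He.
    apply (locally_Cmod z (fun w => Cmod (f w - f z) < e)).
    apply (H (fun w => Cmod (w - f z) < e)). apply locally_Cmod. exists e; auto.
  - intros H P HP. apply locally_Cmod in HP. destruct HP as [e [He HP]].
    destruct (H e He) as [d [Hd H']].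
    apply locally_Cmod. exists d; split; auto.
Qed.

Lemma continuous_R_eps (f : C -> R) (z : C) :
  continuous (T := C_UniformSpace) f z ->
  forall e, 0 < e -> exists d, 0 < d /\ forall w, Cmod (w - z) < d -> Rabs (f w - f z) < e.
Proof.
  intros H e He. apply (locally_Cmod z (fun w => Rabs (f w - f z) < e)).
  apply (proj1 (filterlim_locally _ _) H (mkposreal e He)).
Qed.

Lemma continuous_R2_eps (f : R * R -> R) (p : R * R) :
  continuous f p ->
  forall e, 0 < e -> exists d, 0 < d /\ forall x y,
    Rabs (x - fst p) < d -> Rabs (y - snd p) < d -> Rabs (f (x, y) - f p) < e.
Proof.
  intros H e He. destruct (proj1 (filterlim_locally _ _) H (mkposreal e He)) as [d Hd].
  exists d; split; [apply cond_pos|]. intros x y Hx Hy. apply (Hd (x, y)). split; assumption.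
Qed.

(** * Connectedness *)

(** A path is subdivided until each piece lies in one of the two open sets; the
    second coordinate of the rectangle is a dummy. *)
Lemma path_not_split (g : R -> C) (A U V : C -> Prop) :
  (forall t, 0 <= t <= 1 -> A (g t) /\ ctsC g t) ->
  open (T := C_UniformSpace) U -> open (T := C_UniformSpace) V ->
  (forall z, A z -> U z \/ V z) -> (forall z, A z -> ~ (U z /\ V z)) ->
  U (g 0) -> V (g 1) -> False.
Proof.
  intros Hg HU HV Hcov Hdis H0 H1.
  assert (H : (forall t, 0 <= t <= 0 + 1 -> U (g t)) \/ (forall t, 0 <= t <= 0 + 1 -> V (g t))).
  { apply (bisection (fun x _ a _ => (forall t, x <= t <= x + a -> U (g t)) \/
      (forall t, x <= t <= x + a -> V (g t))) 0 0 1 1); try lra.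
    - intros x y a b Ha Hb Hs P1 P2 _ _. unfold subrect in Hs.
      destruct (Hg (x + a / 2)) as [HA _]; [lra|].
      assert (forall Q : C -> Prop, (forall t, x <= t <= x + a / 2 -> Q (g t)) ->
        (forall t, x + a / 2 <= t <= x + a / 2 + a / 2 -> Q (g t)) ->
        forall t, x <= t <= x + a -> Q (g t)) as Hglue.
      { intros Q Q1 Q2 t Ht. destruct (Rle_dec t (x + a / 2)); [apply Q1|apply Q2]; lra. }
      destruct P1 as [P1|P1], P2 as [P2|P2].
      + left; apply Hglue; assumption.
      + exfalso; apply (Hdis _ HA); split; [apply P1|apply P2]; lra.
      + exfalso; apply (Hdis _ HA); split; [apply P2|apply P1]; lra.
      + right; apply Hglue; assumption.
    - intros px py [Hpx _]. destruct (Hg px) as [HA Hc]; [lra|].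
      assert (forall Q : C -> Prop, open (T := C_UniformSpace) Q -> Q (g px) ->
        exists d, 0 < d /\ forall t, Rabs (t - px) < d -> Q (g t)) as Hq.
      { intros Q HQ Hp. destruct (Hc Q (HQ _ Hp)) as [d Hd]. exists d; split; [apply cond_pos|].
        exact Hd. }
      destruct (Hcov _ HA) as [Hp|Hp];
        [destruct (Hq U HU Hp) as [d [Hd Hd']]|destruct (Hq V HV Hp) as [d [Hd Hd']]];
        exists d; (split; [exact Hd|]); intros x y a b Hda Hdb Hs [Hi _];
        [left|right]; intros t Ht; apply Hd'; apply Rabs_def1; lra. }
  destruct H as [H|H].
  - destruct (Hg 1) as [HA _]; [lra|]. apply (Hdis _ HA). split; [apply H; lra|exact H1].
  - destruct (Hg 0) as [HA _]; [lra|]. apply (Hdis _ HA). split; [exact H0|apply H; lra].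
Qed.

Lemma path_connected (A : C -> Prop) (z0 : C) :
  (forall z, A z -> exists g : R -> C, g 0 = z0 /\ g 1 = z /\
     forall t, 0 <= t <= 1 -> A (g t) /\ ctsC g t) ->
  connected A.
Proof.
  intros HA [U [V [HU [HV [Hcov [[u [Au Uu]] [[v [Av Vv]] Hdis]]]]]]].
  destruct (HA u Au) as [g [g0 [g1 Hg]]]. destruct (HA v Av) as [h [h0 [h1 Hh]]].
  assert (A0 : A z0) by (rewrite <- g0; apply Hg; lra).
  destruct (Hcov z0 A0) as [H|H].
  - apply (path_not_split h A U V); auto; congruence.
  - apply (path_not_split g A V U); auto; try congruence.
    + intros z Az. destruct (Hcov z Az); auto.
    + intros z Az [X Y]; apply (Hdis z Az); auto.
Qed.

(** * Complex differentiability *)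

(** Complex differentiability in the form of Caratheodory: the rules of
    differentiation reduce to those for continuity. *)
Definition holo_at (f : C -> C) (z : C) : Prop :=
  exists q : C -> C, ctsC q z /\
    locally (T := C_UniformSpace) z (fun w => f w = (f z + q w * (w - z))%C).

Lemma locally_all (z : C) (P : C -> Prop) :
  (forall w, P w) -> locally (T := C_UniformSpace) z P.
Proof. intros H. apply filter_forall. exact H. Qed.

Lemma holo_at_ext (f g : C -> C) (z : C) :
  locally (T := C_UniformSpace) z (fun w => f w = g w) -> holo_at f z -> holo_at g z.
Proof.
  intros He [q [Hq Hf]]. exists q; split; [exact Hq|].
  pose proof (locally_singleton _ _ He) as Hz. simpl in Hz. rewrite <- Hz.
  generalize (filter_and _ _ He Hf). apply filter_imp. intros w [<- H]; exact H.
Qed.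

Lemma holo_at_const (c z : C) : holo_at (fun _ => c) z.
Proof.
  exists (fun _ => 0%C); split; [cts|]. apply locally_all; intros w; ring.
Qed.

Lemma holo_at_id (z : C) : holo_at (fun w => w) z.
Proof.
  exists (fun _ => 1%C); split; [cts|]. apply locally_all; intros w; ring.
Qed.

Lemma holo_at_continuous (f : C -> C) (z : C) :
  holo_at f z -> continuous (T := C_UniformSpace) (U := C_UniformSpace) f z.
Proof.
  intros [q [Hq Hf]].
  apply (continuous_ext_loc _ (fun w => (f z + q w * (w - z))%C)).
  - generalize Hf; apply filter_imp. intros w H; symmetry; exact H.
  - cts.
Qed.

Lemma holo_at_plus (f g : C -> C) (z : C) :
  holo_at f z -> holo_at g z -> holo_at (fun w => f w + g w)%C z.
Proof.
  intros [p [Hp Hf]] [q [Hq Hg]]. exists (fun w => p w + q w)%C; split; [cts|].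
  generalize (filter_and _ _ Hf Hg). apply filter_imp. intros w [-> ->]. ring.
Qed.

Lemma holo_at_mult (f g : C -> C) (z : C) :
  holo_at f z -> holo_at g z -> holo_at (fun w => f w * g w)%C z.
Proof.
  intros Hf0 Hg0. pose proof (holo_at_continuous g z Hg0) as Hc.
  destruct Hf0 as [p [Hp Hf]], Hg0 as [q [Hq Hg]].
  exists (fun w => p w * g w + f z * q w)%C; split; [cts|].
  generalize (filter_and _ _ Hf Hg). apply filter_imp. intros w [Ef Eg].
  rewrite Ef. rewrite Eg at 1. rewrite Eg at 1. ring.
Qed.

Lemma holo_at_minus (f g : C -> C) (z : C) :
  holo_at f z -> holo_at g z -> holo_at (fun w => f w - g w)%C z.
Proof.
  intros Hf Hg.
  apply (holo_at_ext (fun w => f w + (- (1)) * g w)%C).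
  - apply locally_all; intros w; ring.
  - apply holo_at_plus; [exact Hf|]. apply holo_at_mult; [apply holo_at_const|exact Hg].
Qed.

Lemma locally_neq0 (g : C -> C) (z : C) :
  ctsC g z -> g z <> 0%C -> locally (T := C_UniformSpace) z (fun w => g w <> 0%C).
Proof.
  intros Hc Hz. apply Cmod_gt_0 in Hz.
  destruct (proj1 (continuous_C_eps g z) Hc _ Hz) as [d [Hd H]].
  apply locally_Cmod. exists d; split; [exact Hd|]. intros w Hw E.
  specialize (H w Hw). rewrite E in H. replace (0 - g z)%C with (- g z)%C in H by ring.
  rewrite Cmod_opp in H. lra.
Qed.

Lemma holo_at_inv (g : C -> C) (z : C) :
  holo_at g z -> g z <> 0%C -> holo_at (fun w => / g w)%C z.
Proof.
  intros Hg0 Hz. pose proof (holo_at_continuous g z Hg0) as Hc.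
  destruct Hg0 as [q [Hq Hg]].
  exists (fun w => - (q w / (g w * g z)))%C; split.
  - cts. apply Cmult_neq_0; assumption.
  - generalize (filter_and _ _ Hg (locally_neq0 g z Hc Hz)). apply filter_imp.
    intros w [Eg Hw]. assert (E : (q w * (w - z))%C = (g w - g z)%C) by (rewrite Eg; ring).
    transitivity (/ g z - (q w * (w - z)) / (g w * g z))%C; [rewrite E|]; field; split; assumption.
Qed.

Lemma holo_at_div (f g : C -> C) (z : C) :
  holo_at f z -> holo_at g z -> g z <> 0%C -> holo_at (fun w => f w / g w)%C z.
Proof.
  intros. apply holo_at_mult; [assumption|]. apply holo_at_inv; assumption.
Qed.

Lemma holo_at_comp (f g : C -> C) (z : C) :
  holo_at f (g z) -> holo_at g z -> holo_at (fun w => f (g w)) z.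
Proof.
  intros [p [Hp Hf]] Hg0. pose proof (holo_at_continuous g z Hg0) as Hc.
  destruct Hg0 as [q [Hq Hg]].
  exists (fun w => p (g w) * q w)%C; split.
  - apply continuous_Cmult; [|exact Hq]. apply (continuous_comp g p); assumption.
  - pose proof (Hc _ Hf : locally (T := C_UniformSpace) z
      (fun w => f (g w) = (f (g z) + p (g w) * (g w - g z))%C)) as Hfg.
    generalize (filter_and _ _ Hfg Hg). apply filter_imp. intros w [E1 E2].
    rewrite E1. replace (g w - g z)%C with (q w * (w - z))%C by (rewrite E2; ring). ring.
Qed.

Lemma ex_derive_holo_at (f : C -> C) (z : C) :
  ex_derive (K := C_AbsRing) (V := C_NormedModule) f z -> holo_at f z.
Proof.
  intros [l0 [_ Hl]]. revert Hl. generalize (l0 : C). clear l0. intros l Hl. specialize (Hl z (fun P HP => HP)).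
  exists (fun w => if excluded_middle_informative (w = z) then l else ((f w - f z) / (w - z))%C).
  split.
  - apply continuous_C_eps. intros e He.
    assert (He2 : 0 < e / 2) by lra.
    specialize (Hl (mkposreal _ He2)). apply locally_C in Hl. apply locally_Cmod in Hl.
    destruct Hl as [d [Hd Hl]]. exists d; split; [exact Hd|]. intros w Hw.
    destruct (excluded_middle_informative (z = z)) as [_|n]; [|congruence].
    destruct (excluded_middle_informative (w = z)) as [E|n].
    + rewrite (Cplus_opp_r l : (l - l)%C = 0%C), Cmod_0. exact He.
    + assert (Hl' : Cmod ((f w - f z) - (w - z) * l)%C <= e / 2 * Cmod (w - z)%C) by exact (Hl w Hw).
      assert (Hn : (w - z)%C <> 0%C).
      { intros E; apply n. replace w with (w - z + z)%C by ring. rewrite E; ring. }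
      replace ((f w - f z) / (w - z) - l)%C with (((f w - f z) - (w - z) * l) / (w - z))%C
        by (field; exact Hn).
      rewrite Cmod_div by exact Hn. apply Cmod_gt_0 in Hn.
      apply Rle_lt_trans with (e / 2); [|lra].
      apply (Rmult_le_reg_r (Cmod (w - z)%C)); [exact Hn|].
      unfold Rdiv at 1. rewrite Rmult_assoc, Rinv_l, Rmult_1_r by lra. exact Hl'.
  - apply locally_all. intros w. destruct (excluded_middle_informative (w = z)) as [->|n].
    + ring.
    + field. intros E; apply n. replace w with (w - z + z)%C by ring. rewrite E; ring.
Qed.

(** * Goursat's theorem on rectangles *)

(** The outward flux of the plane field [(P, - Q)] through the boundary of the
    rectangle with corner [(x, y)] and sides [a], [b]. *)
Definition flux (P Q : R -> R -> R) (x y a b : R) : R :=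
  (RInt (P (x + a)) y (y + b) - RInt (P x) y (y + b))
  - (RInt (fun t => Q t (y + b)) x (x + a) - RInt (fun t => Q t y) x (x + a)).

(** [P] and [Q] are differentiable, in the form of Caratheodory, and the
    divergence of [(P, - Q)] vanishes: [A] and [D] play the parts of [dP/dx] and
    [dQ/dy]. *)
Definition div_free_at (P Q : R -> R -> R) (x y : R) : Prop :=
  exists A B G D : R * R -> R,
    continuous A (x, y) /\ continuous B (x, y) /\ continuous G (x, y) /\ continuous D (x, y) /\
    A (x, y) = D (x, y) /\
    exists d, 0 < d /\ forall x' y', Rabs (x' - x) < d -> Rabs (y' - y) < d ->
      P x' y' = P x y + A (x', y') * (x' - x) + B (x', y') * (y' - y) /\
      Q x' y' = Q x y + G (x', y') * (x' - x) + D (x', y') * (y' - y).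

Lemma div_free_slices (P Q : R -> R -> R) (x y : R) :
  div_free_at P Q x y -> continuous (P x) y /\ continuous (fun t => Q t y) x.
Proof.
  intros (A & B & G & D & HA & HB & HG & HD & _ & d & Hd & H).
  assert (C1 : continuous (fun t : R => (x, t)) y).
  { apply filterlim_locally. intros e. exists e. intros t Ht; split; [apply ball_center|exact Ht]. }
  assert (C2 : continuous (fun t : R => (t, y)) x).
  { apply filterlim_locally. intros e. exists e. intros t Ht; split; [exact Ht|apply ball_center]. }
  assert (Z : forall u : R, Rabs (u - u) < d) by (intros u; rewrite Rminus_diag, Rabs_R0; exact Hd).
  split.
  - apply (continuous_ext_loc _ (fun t => P x y + B (x, t) * (t - y))).
    + exists (mkposreal d Hd). intros t Ht. destruct (H x t (Z x) Ht) as [E _].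
      change (P x y + B (x, t) * (t - y) = P x t). rewrite E, Rminus_diag, Rmult_0_r, Rplus_0_r. reflexivity.
    + cts. apply (continuous_comp (fun t : R => (x, t)) B); assumption.
  - apply (continuous_ext_loc _ (fun t => Q x y + G (t, y) * (t - x))).
    + exists (mkposreal d Hd). intros t Ht. destruct (H t y Ht (Z y)) as [_ E].
      change (Q x y + G (t, y) * (t - x) = Q t y). rewrite E, Rminus_diag, Rmult_0_r, Rplus_0_r. reflexivity.
    + cts. apply (continuous_comp (fun t : R => (t, y)) G); assumption.
Qed.

Lemma RInt_Rminus (f g : R -> R) (a b : R) :
  ex_RInt f a b -> ex_RInt g a b -> RInt (fun t => f t - g t) a b = RInt f a b - RInt g a b :> R.
Proof. exact (RInt_minus (V := R_CompleteNormedModule) f g a b). Qed.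

Lemma RInt_Rconst (a b c : R) : RInt (fun _ => c) a b = (b - a) * c :> R.
Proof. exact (RInt_const (V := R_CompleteNormedModule) a b c). Qed.

Lemma ex_RInt_Rminus (f g : R -> R) (a b : R) :
  ex_RInt f a b -> ex_RInt g a b -> ex_RInt (fun t => f t - g t) a b.
Proof. exact (ex_RInt_minus (V := R_NormedModule) f g a b). Qed.

Lemma RInt_near_const (h : R -> R) (u b c M : R) :
  0 < b -> ex_RInt h u (u + b) ->
  (forall t, u <= t <= u + b -> Rabs (h t - c) <= M) ->
  Rabs (RInt h u (u + b) - c * b) <= b * M.
Proof.
  intros Hb Hex H.
  assert (E : RInt (fun t => h t - c) u (u + b) = RInt h u (u + b) - c * b :> R).
  { rewrite RInt_Rminus; [|exact Hex|apply ex_RInt_const]. rewrite RInt_Rconst. ring. }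
  rewrite <- E. replace (b * M) with ((u + b - u) * M) by ring.
  apply abs_RInt_le_const; [lra| |exact H].
  apply ex_RInt_Rminus; [exact Hex|apply ex_RInt_const].
Qed.

(** Over a small rectangle [P (x + a) t - P x t] is [A a] and
    [Q t (y + b) - Q t y] is [A b], up to a small multiple of [a + b]; the main
    terms [A a b] of the two integrals cancel. *)
Lemma flux_local (P Q : R -> R -> R) (px py e : R) :
  0 < e -> div_free_at P Q px py ->
  exists d, 0 < d /\ forall x y a b, 0 < a < d -> 0 < b < d -> in_rect x y a b px py ->
    (forall x' y', in_rect x y a b x' y' -> div_free_at P Q x' y') ->
    Rabs (flux P Q x y a b) <= e * (a + b) ^ 2.
Proof.
  intros He (A & B & G & D & HA & HB & HG & HD & HAD & d & Hd & H).
  assert (He4 : 0 < e / 4) by lra.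
  destruct (continuous_R2_eps _ _ HA _ He4) as [d1 [Hd1 H1]].
  destruct (continuous_R2_eps _ _ HB _ He4) as [d2 [Hd2 H2]].
  destruct (continuous_R2_eps _ _ HG _ He4) as [d3 [Hd3 H3]].
  destruct (continuous_R2_eps _ _ HD _ He4) as [d4 [Hd4 H4]].
  simpl in H1, H2, H3, H4.
  set (m := Rmin d (Rmin (Rmin d1 d2) (Rmin d3 d4))).
  assert (Hm : 0 < m /\ m <= d /\ m <= d1 /\ m <= d2 /\ m <= d3 /\ m <= d4).
  { split; [unfold m; repeat apply Rmin_glb_lt; assumption|]. unfold m.
    pose proof (Rmin_l d (Rmin (Rmin d1 d2) (Rmin d3 d4))).
    pose proof (Rmin_r d (Rmin (Rmin d1 d2) (Rmin d3 d4))).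
    pose proof (Rmin_l (Rmin d1 d2) (Rmin d3 d4)). pose proof (Rmin_r (Rmin d1 d2) (Rmin d3 d4)).
    pose proof (Rmin_l d1 d2). pose proof (Rmin_r d1 d2).
    pose proof (Rmin_l d3 d4). pose proof (Rmin_r d3 d4). lra. }
  clearbody m. exists m; split; [lra|].
  intros x y a b Ha Hb [Hx Hy] Hin.
  set (al := A (px, py)) in *.
  assert (HP : forall t, y <= t <= y + b -> Rabs (P (x + a) t - P x t - al * a) <= e / 2 * (a + b)).
  { intros t Ht.
    assert (R1 : Rabs (x + a - px) < m) by (apply Rabs_def1; lra).
    assert (R2 : Rabs (x - px) < m) by (apply Rabs_def1; lra).
    assert (R3 : Rabs (t - py) < m) by (apply Rabs_def1; lra).
    destruct (H (x + a) t) as [-> _]; try lra. destruct (H x t) as [-> _]; try lra.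
    specialize (H1 (x + a) t ltac:(lra) ltac:(lra)) as K1.
    specialize (H1 x t ltac:(lra) ltac:(lra)) as K2.
    specialize (H2 (x + a) t ltac:(lra) ltac:(lra)) as K3.
    specialize (H2 x t ltac:(lra) ltac:(lra)) as K4.
    apply Rabs_def2 in K1, K2, K3, K4. fold al in K1, K2.
    set (A1 := A (x + a, t)) in *. set (A2 := A (x, t)) in *.
    set (B1 := B (x + a, t)) in *. set (B2 := B (x, t)) in *. set (be := B (px, py)) in *.
    replace (P px py + A1 * (x + a - px) + B1 * (t - py) - (P px py + A2 * (x - px) + B2 * (t - py)) - al * a)
      with ((A1 - al) * (x + a - px) + (A2 - al) * (px - x) + (B1 - B2) * (t - py)) by ring.
    eapply Rle_trans; [apply Rabs_triang|]. 
    assert (Rabs ((A1 - al) * (x + a - px) + (A2 - al) * (px - x)) <= e / 4 * a).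
    { apply Rabs_le; split; nra. }
    assert (Rabs ((B1 - B2) * (t - py)) <= e / 2 * b).
    { rewrite Rabs_mult. apply Rmult_le_compat; try apply Rabs_pos; apply Rabs_le; lra. }
    nra. }
  assert (HQ : forall t, x <= t <= x + a -> Rabs (Q t (y + b) - Q t y - al * b) <= e / 2 * (a + b)).
  { intros t Ht.
    assert (R1 : Rabs (y + b - py) < m) by (apply Rabs_def1; lra).
    assert (R2 : Rabs (y - py) < m) by (apply Rabs_def1; lra).
    assert (R3 : Rabs (t - px) < m) by (apply Rabs_def1; lra).
    destruct (H t (y + b)) as [_ ->]; try lra. destruct (H t y) as [_ ->]; try lra.
    specialize (H4 t (y + b) ltac:(lra) ltac:(lra)) as K1.
    specialize (H4 t y ltac:(lra) ltac:(lra)) as K2.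
    specialize (H3 t (y + b) ltac:(lra) ltac:(lra)) as K3.
    specialize (H3 t y ltac:(lra) ltac:(lra)) as K4.
    apply Rabs_def2 in K1, K2, K3, K4. rewrite <- HAD in K1, K2.
    set (A1 := D (t, y + b)) in *. set (A2 := D (t, y)) in *.
    set (B1 := G (t, y + b)) in *. set (B2 := G (t, y)) in *. set (be := G (px, py)) in *.
    replace (Q px py + B1 * (t - px) + A1 * (y + b - py) - (Q px py + B2 * (t - px) + A2 * (y - py)) - al * b)
      with ((A1 - al) * (y + b - py) + (A2 - al) * (py - y) + (B1 - B2) * (t - px)) by ring.
    eapply Rle_trans; [apply Rabs_triang|]. 
    assert (Rabs ((A1 - al) * (y + b - py) + (A2 - al) * (py - y)) <= e / 4 * b).
    { apply Rabs_le; split; nra. }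
    assert (Rabs ((B1 - B2) * (t - px)) <= e / 2 * a).
    { rewrite Rabs_mult. apply Rmult_le_compat; try apply Rabs_pos; apply Rabs_le; lra. }
    nra. }
  assert (X1 : forall s, (s = x \/ s = x + a) -> ex_RInt (P s) y (y + b)).
  { intros s Hs. apply (ex_RInt_continuous (V := R_CompleteNormedModule)). intros t Ht.
    rewrite Rmin_left, Rmax_right in Ht by lra.
    apply (div_free_slices P Q). apply Hin. unfold in_rect. destruct Hs; subst; lra. }
  assert (X2 : forall s, (s = y \/ s = y + b) -> ex_RInt (fun t => Q t s) x (x + a)).
  { intros s Hs. apply (ex_RInt_continuous (V := R_CompleteNormedModule)). intros t Ht.
    rewrite Rmin_left, Rmax_right in Ht by lra.
    apply (div_free_slices P Q). apply Hin. unfold in_rect. destruct Hs; subst; lra. }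
  unfold flux.
  pose proof (X1 x (or_introl eq_refl)) as E1. pose proof (X1 (x + a) (or_intror eq_refl)) as E2.
  pose proof (X2 y (or_introl eq_refl)) as E3. pose proof (X2 (y + b) (or_intror eq_refl)) as E4.
  pose proof (RInt_near_const (fun t => P (x + a) t - P x t) y b (al * a) (e / 2 * (a + b))
     ltac:(lra) (ex_RInt_Rminus _ _ _ _ E2 E1) HP) as I1.
  pose proof (RInt_near_const (fun t => Q t (y + b) - Q t y) x a (al * b) (e / 2 * (a + b))
     ltac:(lra) (ex_RInt_Rminus _ _ _ _ E4 E3) HQ) as I2.
  rewrite (RInt_Rminus _ _ _ _ E2 E1) in I1. rewrite (RInt_Rminus _ _ _ _ E4 E3) in I2.
  apply Rabs_le_between in I1. apply Rabs_le_between in I2. apply Rabs_le. nra.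
Qed.

(** The bound [e (a + b)^2] of [flux_local] is preserved by subdivision, as the
    four quarters have a quarter of it each, while their fluxes add up. *)
Lemma flux_zero (P Q : R -> R -> R) (x0 y0 a0 b0 : R) :
  0 < a0 -> 0 < b0 ->
  (forall x y, in_rect x0 y0 a0 b0 x y -> div_free_at P Q x y) ->
  flux P Q x0 y0 a0 b0 = 0.
Proof.
  intros Ha0 Hb0 Hin.
  assert (Hall : forall e, 0 < e -> Rabs (flux P Q x0 y0 a0 b0) <= e * (a0 + b0) ^ 2).
  { intros e He.
    apply (bisection (fun x y a b => Rabs (flux P Q x y a b) <= e * (a + b) ^ 2) x0 y0 a0 b0);
      try assumption.
    - intros x y a b Ha Hb Hs Q1 Q2 Q3 Q4. unfold subrect in Hs.
      assert (X1 : forall s u v, x <= s <= x + a -> y <= u <= v -> v <= y + b -> ex_RInt (P s) u v).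
      { intros s u v Hs' Hu Hv. apply (ex_RInt_continuous (V := R_CompleteNormedModule)). intros t Ht.
        rewrite Rmin_left, Rmax_right in Ht by lra.
        apply (div_free_slices P Q). apply Hin. unfold in_rect. lra. }
      assert (X2 : forall s u v, y <= s <= y + b -> x <= u <= v -> v <= x + a ->
        ex_RInt (fun t => Q t s) u v).
      { intros s u v Hs' Hu Hv. apply (ex_RInt_continuous (V := R_CompleteNormedModule)). intros t Ht.
        rewrite Rmin_left, Rmax_right in Ht by lra.
        apply (div_free_slices P Q). apply Hin. unfold in_rect. lra. }
      assert (E : flux P Q x y a b = flux P Q x y (a / 2) (b / 2) + flux P Q (x + a / 2) y (a / 2) (b / 2)
        + flux P Q x (y + b / 2) (a / 2) (b / 2) + flux P Q (x + a / 2) (y + b / 2) (a / 2) (b / 2)).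
      { unfold flux.
        replace (x + a / 2 + a / 2) with (x + a) by field.
        replace (y + b / 2 + b / 2) with (y + b) by field.
        assert (C1 : forall s, x <= s <= x + a -> RInt (P s) y (y + b) =
          RInt (P s) y (y + b / 2) + RInt (P s) (y + b / 2) (y + b) :> R).
        { intros s Hs'. symmetry. apply (RInt_Chasles (V := R_CompleteNormedModule)); apply X1; lra. }
        assert (C2 : forall s, y <= s <= y + b -> RInt (fun t => Q t s) x (x + a) =
          RInt (fun t => Q t s) x (x + a / 2) + RInt (fun t => Q t s) (x + a / 2) (x + a) :> R).
        { intros s Hs'. symmetry. apply (RInt_Chasles (V := R_CompleteNormedModule)); apply X2; lra. }
        rewrite !C1, !C2 by lra. ring. }
      rewrite E. clear E.
      apply Rabs_le_between in Q1, Q2, Q3, Q4. apply Rabs_le.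
      replace (e * (a + b) ^ 2) with (4 * (e * (a / 2 + b / 2) ^ 2)) by field. lra.
    - intros px py Hp. destruct (flux_local P Q px py e He (Hin _ _ Hp)) as [d [Hd H]].
      exists d; split; [exact Hd|]. intros x y a b Ha Hb Hs Hi. apply H; try assumption.
      intros x' y' Hi'. apply Hin. unfold subrect, in_rect in *. lra. }
  destruct (Req_dec (flux P Q x0 y0 a0 b0) 0) as [E|N]; [exact E|exfalso].
  apply Rabs_pos_lt in N. set (v := Rabs (flux P Q x0 y0 a0 b0)) in *.
  assert (Hs : 0 < (a0 + b0) ^ 2) by nra.
  specialize (Hall (v / 2 / (a0 + b0) ^ 2)).
  unfold Rdiv in Hall. rewrite !Rmult_assoc, Rinv_l, Rmult_1_r in Hall by lra.
  assert (0 < v * (/ 2 * / (a0 + b0) ^ 2)).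
  { repeat apply Rmult_lt_0_compat; try apply Rinv_0_lt_compat; lra. }
  specialize (Hall H). lra.
Qed.

(** * Circle means and the maximum principle *)

Lemma real_increment (h : R -> R) (x l : R) :
  derivable_pt_lim h x l ->
  exists E : R -> R, continuous E x /\ E x = l /\ forall t, h t = h x + E t * (t - x).
Proof.
  intros H.
  exists (fun t => if Req_dec_T t x then l else (h t - h x) / (t - x)). split; [|split].
  - apply filterlim_locally. intros e. destruct (H e (cond_pos e)) as [d Hd].
    exists d. intros t Ht. change (Rabs (t - x) < d) in Ht.
    destruct (Req_dec_T x x) as [_|n]; [|congruence].
    destruct (Req_dec_T t x) as [->|n].
    + apply ball_center.
    + specialize (Hd (t - x)). assert (K : x + (t - x) = t :> R) by ring. rewrite K in Hd.
      apply Hd; [lra|exact Ht].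
  - destruct (Req_dec_T x x); congruence.
  - intros t. destruct (Req_dec_T t x) as [->|n]; field. lra.
Qed.

Definition cis (t : R) : C := (cos t, sin t).

Lemma Cmod_cis (t : R) : Cmod (cis t) = 1.
Proof.
  unfold Cmod, cis; simpl fst; simpl snd. rewrite <- sqrt_1. f_equal.
  pose proof (sin2_cos2 t). unfold Rsqr in *. lra.
Qed.

(** These are the Cauchy-Riemann equations in polar coordinates,
    [s d(Re F)/ds = d(Im F)/dt]. *)
Lemma polar_div_free (F : C -> C) (c : C) (s t : R) :
  0 < s -> holo_at F (c + s * cis t)%C ->
  div_free_at (fun s t => Re (F (c + s * cis t)%C)) (fun s t => Im (F (c + s * cis t)%C) / s) s t.
Proof.
  intros Hs [q [Hq Hloc]].
  destruct (real_increment cos t (- sin t) (derivable_pt_lim_cos t)) as [Ec [Cc [Vc Ic]]].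
  destruct (real_increment sin t (cos t) (derivable_pt_lim_sin t)) as [Es [Cs [Vs Is]]].
  set (z := fun p : R * R => (c + fst p * cis (snd p))%C).
  set (cs := fun p : R * R => cis (snd p)).
  set (E := fun p : R * R => (Ec (snd p), Es (snd p)) : C).
  assert (HE : ctsC E (s, t)).
  { apply continuous_Re_Im; apply (continuous_comp snd); try apply continuous_snd; assumption. }
  assert (Hcs : ctsC cs (s, t)).
  { apply continuous_Re_Im; apply (continuous_comp snd); try apply continuous_snd;
    [apply continuous_cos|apply continuous_sin]. }
  assert (Hz : ctsC z (s, t)).
  { apply continuous_Cplus; [cts|]. apply continuous_Cmult; [cts|exact Hcs]. }
  assert (Hqz : ctsC (fun p => q (z p)) (s, t)).
  { apply (continuous_comp z q); [exact Hz|exact Hq]. }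
  set (k := Im (F (c + s * cis t)%C)).
  exists (fun p => Re (q (z p) * cs p)%C), (fun p => Re (q (z p) * (s * E p))%C),
    (fun p => Im (q (z p) * cs p)%C / fst p - k / (s * fst p)),
    (fun p => Im (q (z p) * (s * E p))%C / fst p).
  assert (Hs0 : s <> 0) by lra.
  assert (Hss : s * s <> 0) by nra.
  split; [cts|]. split; [cts|]. split; [cts; assumption|]. split; [cts; assumption|]. split.
  - unfold E, cs, z, cis, Re, Im; simpl. rewrite Vc, Vs. field. exact Hs0.
  - destruct (Hz _ Hloc) as [d Hd].
    assert (Hm : 0 < Rmin d s) by (apply Rmin_glb_lt; [apply cond_pos|exact Hs]).
    exists (Rmin d s); split; [exact Hm|]. intros s' t' H1 H2.
    pose proof (Rmin_l d s). pose proof (Rmin_r d s).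
    assert (Hball : ball (s, t) d (s', t')) by (split; [change (Rabs (s' - s) < d)|change (Rabs (t' - t) < d)]; lra).
    specialize (Hd _ Hball). simpl in Hd. fold (z (s', t')) in *.
    assert (Hs' : 0 < s') by (apply Rabs_def2 in H1; lra).
    assert (Hzz : (z (s', t') - (c + s * cis t))%C = ((s' - s)%R * cs (s', t') + (t' - t)%R * (s * E (s', t')))%C).
    { unfold z, cs, E, cis; simpl. apply injective_projections; simpl; rewrite (Ic t'), (Is t'); ring. }
    change (z (s', t')) with (c + s' * cis t')%C in Hd at 1.
    change (F (c + s' * cis t')%C = (F (c + s * cis t) + q (z (s', t')) * (z (s', t') - (c + s * cis t)))%C) in Hd.
    rewrite Hzz in Hd. rewrite Hd.
    unfold k. generalize (F (c + s * cis t)%C) as w, (q (z (s', t'))) as u, (cs (s', t')) as v, (E (s', t')) as e.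
    intros w u v e. destruct w, u, v, e; unfold Re, Im; simpl. split; [ring|field; lra].
Qed.

Lemma continuous_cis (t : R) : ctsC cis t.
Proof. apply continuous_Re_Im; [apply continuous_cos|apply continuous_sin]. Qed.

Lemma Cmod_R_cis (s t : R) : 0 <= s -> Cmod (s * cis t)%C = s.
Proof. intros Hs. rewrite Cmod_mult, Cmod_R, Cmod_cis, Rabs_pos_eq by exact Hs. ring. Qed.

Lemma circle_point_sub (c : C) (s t : R) : (c + s * cis t - c)%C = (s * cis t)%C.
Proof. ring. Qed.

(** The flux of [(Re F, Im F / s)] through the polar rectangle between two
    circles vanishes, and by periodicity its radial sides cancel: so the mean
    over a circle does not depend on the radius, which can then shrink to 0. *)
Lemma circle_mean (F : C -> C) (c : C) (r : R) :
  0 < r -> (forall z, Cmod (z - c) <= r -> holo_at F z) ->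
  RInt (fun t => Re (F (c + r * cis t)%C)) 0 (2 * PI) = 2 * PI * Re (F c) :> R.
Proof.
  intros Hr HF. pose proof PI_RGT_0 as Hpi.
  assert (Hh : forall s t, 0 < s <= r -> holo_at F (c + s * cis t)%C).
  { intros s t Hs. apply HF. rewrite circle_point_sub, Cmod_R_cis; lra. }
  set (M := fun s => RInt (fun t => Re (F (c + s * cis t)%C)) 0 (2 * PI)).
  assert (Hex : forall s, 0 < s <= r -> ex_RInt (fun t => Re (F (c + s * cis t)%C)) 0 (2 * PI)).
  { intros s Hs. apply (ex_RInt_continuous (V := R_CompleteNormedModule)). intros t _.
    apply continuous_Re. apply (continuous_comp (fun t => (c + s * cis t)%C) F).
    - cts. apply continuous_cis.
    - apply holo_at_continuous. apply Hh; exact Hs. }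
  assert (Hconst : forall s, 0 < s < r -> M r = M s).
  { intros s Hs.
    pose proof (flux_zero (fun s t => Re (F (c + s * cis t)%C)) (fun s t => Im (F (c + s * cis t)%C) / s)
      s 0 (r - s) (2 * PI) ltac:(lra) ltac:(lra)) as Hf.
    unfold flux in Hf. replace (s + (r - s)) with r in Hf by ring. rewrite Rplus_0_l in Hf.
    rewrite (RInt_ext (fun t => Im (F (c + t * cis (2 * PI))%C) / t) (fun t => Im (F (c + t * cis 0)%C) / t)) in Hf.
    - fold (M r) (M s) in Hf. lapply Hf; [lra|].
      intros x y Hxy. unfold in_rect in Hxy. apply polar_div_free; [lra|]. apply Hh; lra.
    - intros x _. unfold cis. rewrite cos_2PI, sin_2PI, cos_0, sin_0. reflexivity. }
  change (M r = 2 * PI * Re (F c)).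
  apply Rminus_diag_uniq. apply NNPP. intros Hne. apply Rabs_pos_lt in Hne.
  set (v := Rabs (M r - 2 * PI * Re (F c))) in *.
  assert (Hc : continuous (T := C_UniformSpace) (fun z => Re (F z)) c).
  { apply continuous_Re. apply holo_at_continuous. apply HF.
    replace (c - c)%C with (RtoC 0) by ring. rewrite Cmod_0; lra. }
  destruct (continuous_R_eps _ _ Hc (v / (4 * PI))) as [d [Hd Hcd]].
  { apply Rdiv_lt_0_compat; lra. }
  set (s := Rmin d r / 2).
  assert (Hs : 0 < s /\ s < d /\ s < r).
  { unfold s. pose proof (Rmin_l d r). pose proof (Rmin_r d r).
    assert (0 < Rmin d r) by (apply Rmin_glb_lt; lra). lra. }
  pose proof (RInt_near_const (fun t => Re (F (c + s * cis t)%C)) 0 (2 * PI) (Re (F c)) (v / (4 * PI))) as HI.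
  rewrite Rplus_0_l in HI.
  assert (HI' : Rabs (M s - Re (F c) * (2 * PI)) <= 2 * PI * (v / (4 * PI))).
  { apply HI; [lra|apply Hex; lra|]. intros t _. left. apply Hcd. rewrite circle_point_sub, Cmod_R_cis; lra. }
  rewrite <- Hconst in HI' by lra.
  replace (2 * PI * (v / (4 * PI))) with (v / 2) in HI' by (field; lra).
  rewrite (Rmult_comm (Re (F c))) in HI'. fold v in HI'. lra.
Qed.

Lemma circle_not_below (F : C -> C) (c : C) (r e : R) :
  0 < r -> 0 < e -> (forall z, Cmod (z - c) <= r -> holo_at F z) ->
  (forall z, Cmod (z - c) = r -> Re (F z) <= Re (F c) - e) -> False.
Proof.
  intros Hr He HF H. pose proof PI_RGT_0 as Hpi.
  pose proof (circle_mean F c r Hr HF) as Hm.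
  assert (Hle : RInt (fun t => Re (F (c + r * cis t)%C)) 0 (2 * PI) <= RInt (fun _ => Re (F c) - e) 0 (2 * PI)).
  { apply RInt_le; [lra| |apply ex_RInt_const|].
    - apply (ex_RInt_continuous (V := R_CompleteNormedModule)). intros t _.
      apply continuous_Re. apply (continuous_comp (fun t => (c + r * cis t)%C) F).
      + cts. apply continuous_cis.
      + apply holo_at_continuous. apply HF. rewrite circle_point_sub, Cmod_R_cis; lra.
    - intros t _. apply H. rewrite circle_point_sub, Cmod_R_cis; lra. }
  rewrite RInt_Rconst, Hm in Hle. nra.
Qed.

(** The square around the disk is a rectangle, on which [u] is extended by -1:
    this keeps it upper semicontinuous, as [u >= 0] on the closed disk. *)
Lemma disk_max (u : C -> R) (r : R) :
  0 < r -> (forall z, Cmod z <= r -> 0 <= u z) ->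
  (forall z, Cmod z <= r -> continuous (T := C_UniformSpace) u z) ->
  exists c, Cmod c <= r /\ forall z, Cmod z <= r -> u z <= u c.
Proof.
  intros Hr Hu0 Hu.
  set (g := fun x y : R => if Rle_dec (Cmod (x, y)) r then u (x, y) else -1).
  destruct (rect_max g (- r) (- r) (2 * r) (2 * r)) as [mx [my [_ Hm]]]; try lra.
  - intros px py _ e He. unfold g in He.
    assert (Hdiff : forall x y d, Rabs (x - px) < d / 2 -> Rabs (y - py) < d / 2 ->
       Cmod ((x, y) - (px, py))%C < d).
    { intros x y d H1 H2. apply Cmod_lt_of_coords; assumption. }
    destruct (Rle_dec (Cmod (px, py)) r) as [Hp|Hp].
    + destruct (continuous_R_eps u (px, py) (Hu _ Hp) (e - u (px, py))) as [d [Hd H]]; [lra|].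
      exists (d / 2); split; [lra|]. intros x y _ Hx Hy. unfold g.
      destruct (Rle_dec (Cmod (x, y)) r) as [Hxy|Hxy].
      * specialize (H (x, y) (Hdiff _ _ _ Hx Hy)). apply Rabs_def2 in H. lra.
      * specialize (Hu0 _ Hp). lra.
    + exists ((Cmod (px, py) - r) / 2); split; [lra|]. intros x y _ Hx Hy. unfold g.
      destruct (Rle_dec (Cmod (x, y)) r) as [Hxy|Hxy]; [exfalso|exact He].
      pose proof (Hdiff _ _ _ Hx Hy) as H.
      assert (Htri : forall p q : C, Cmod p <= Cmod q + Cmod (q - p)).
      { intros p q. pose proof (Cmod_triangle q (- (q - p))) as Ht. rewrite Cmod_opp in Ht.
        replace (q + - (q - p))%C with p in Ht by ring. exact Ht. }
      specialize (Htri (px, py) (x, y)). lra.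
  - assert (Hg : forall z : C, Cmod z <= r -> u z <= g mx my).
    { intros z Hz. pose proof (Rmax_Cmod z) as Hz'.
      pose proof (Rmax_l (Rabs (fst z)) (Rabs (snd z))) as H1.
      pose proof (Rmax_r (Rabs (fst z)) (Rabs (snd z))) as H2.
      assert (H3 : Rabs (fst z) <= r) by lra. assert (H4 : Rabs (snd z) <= r) by lra.
      apply Rabs_le_between in H3. apply Rabs_le_between in H4.
      replace (u z) with (g (fst z) (snd z)).
      - apply Hm. unfold in_rect. lra.
      - unfold g. rewrite <- surjective_pairing. destruct (Rle_dec (Cmod z) r); [reflexivity|lra]. }
    assert (H0 : 0 <= g mx my).
    { specialize (Hg 0%C). specialize (Hu0 0%C). rewrite Cmod_0 in Hg, Hu0. lra. }
    exists (mx, my). revert Hg H0. unfold g.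
    destruct (Rle_dec (Cmod (mx, my)) r) as [Hm'|Hm']; intros; [split; assumption|lra].
Qed.

Lemma Cmod_sqr (z : C) : Cmod z ^ 2 = Re z * Re z + Im z * Im z.
Proof. rewrite Cmod2_alt. ring. Qed.

(** Maximize [|F|^2 + e |z|^2]. At an interior maximum [c], the real part of
    [2 conj(F c) F + 2 e conj(c) z] would be smaller by at least [e s^2] on the
    circle of radius [s] than at its centre [c], contrary to the mean value
    property. Such a [c] is not a zero of [F], so [F] is holomorphic around it. *)
Lemma max_principle (F : C -> C) (r M : R) :
  0 < r -> 0 <= M ->
  (forall z, Cmod z <= r -> continuous (T := C_UniformSpace) (U := C_UniformSpace) F z) ->
  (forall z, Cmod z < r -> F z <> 0%C -> holo_at F z) ->
  (forall z, Cmod z = r -> Cmod (F z) <= M) ->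
  forall z, Cmod z <= r -> Cmod (F z) <= M.
Proof.
  intros Hr HM Hc Hh Hb z1 Hz1. apply Rnot_lt_le. intros Hlt.
  set (e := (Cmod (F z1) ^ 2 - M ^ 2) / (2 * r ^ 2)).
  assert (Hr2 : 0 < r ^ 2) by nra.
  assert (He : 0 < e) by (apply Rdiv_lt_0_compat; nra).
  assert (Her : e * r ^ 2 = (Cmod (F z1) ^ 2 - M ^ 2) / 2) by (unfold e; field; lra).
  clearbody e.
  set (u := fun z => Cmod (F z) ^ 2 + e * Cmod z ^ 2).
  destruct (disk_max u r Hr) as [c [Hcr Hmax]].
  - intros z Hz. unfold u. nra.
  - intros z Hz. unfold u. specialize (Hc z Hz). simpl. cts.
  - pose proof (Hmax z1 Hz1) as H1. unfold u in H1 at 1.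
    assert (Hu1 : M ^ 2 + e * r ^ 2 < u c) by nra.
    pose proof (Cmod_ge_0 c). pose proof (Cmod_ge_0 z1). pose proof (Cmod_ge_0 (F c)).
    assert (Hc2 : e * Cmod c ^ 2 <= e * r ^ 2) by (apply Rmult_le_compat_l; nra).
    assert (Hcr' : Cmod c < r).
    { destruct Hcr as [L|E]; [exact L|exfalso]. specialize (Hb c E). unfold u in Hu1. nra. }
    assert (HFc : F c <> 0%C).
    { intros E. unfold u in Hu1. rewrite E, Cmod_0 in Hu1. nra. }
    pose proof (locally_neq0 F c (Hc c Hcr) HFc) as Hn. apply locally_Cmod in Hn.
    destruct Hn as [d [Hd Hn]].
    set (s := Rmin d (r - Cmod c) / 2).
    assert (Hs : 0 < s /\ s < d /\ s < r - Cmod c).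
    { unfold s. pose proof (Rmin_l d (r - Cmod c)). pose proof (Rmin_r d (r - Cmod c)).
      assert (0 < Rmin d (r - Cmod c)) by (apply Rmin_glb_lt; lra). lra. }
    clearbody s.
    assert (Hin : forall z, Cmod (z - c) <= s -> Cmod z < r).
    { intros z Hz. pose proof (Cmod_triangle c (z - c)) as Ht.
      replace (c + (z - c))%C with z in Ht by ring. lra. }
    apply (circle_not_below (fun z => 2 * Cconj (F c) * F z + 2 * e * Cconj c * z)%C c s (e * s ^ 2)).
    + lra.
    + apply Rmult_lt_0_compat; [exact He|apply pow_lt; lra].
    + intros z Hz. apply holo_at_plus; apply holo_at_mult; try apply holo_at_const; try apply holo_at_id.
      apply Hh; [apply Hin; exact Hz|]. apply Hn. lra.
    + intros z Hz. pose proof (Hin z ltac:(lra)) as Hzr.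
      pose proof (Hmax z ltac:(lra)) as Hmz. unfold u in Hmz. clear Hmax.
      assert (Hz2 : Cmod (z - c) ^ 2 = s ^ 2) by (rewrite Hz; reflexivity).
      rewrite !Cmod_sqr in Hmz. rewrite Cmod_sqr in Hz2.
      revert Hmz. generalize (F z), (F c). intros [a1 a2] [b1 b2].
      destruct z as [x y], c as [p q]. unfold Re, Im in *; simpl in *.
      intros Hmz. pose proof (Rle_0_sqr (a1 - b1)). pose proof (Rle_0_sqr (a2 - b2)). unfold Rsqr in *.
      pose proof (f_equal (Rmult e) Hz2). lra.
Qed.

(** * Moebius automorphisms of the disk *)

Definition mob (a z : C) : C := ((z + a) / (1 + Cconj a * z))%C.

Lemma Csub_neq (z w : C) : z <> w -> (z - w)%C <> RtoC 0.
Proof. intros H E; apply H. replace z with (z - w + w)%C by ring. rewrite E; ring. Qed.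

Lemma one_plus_neq0 (u : C) : Cmod u < 1 -> (1 + u)%C <> RtoC 0.
Proof.
  intros H E. assert (E2 : u = (- (1))%C) by (replace u with (1 + u - 1)%C by ring; rewrite E; ring).
  rewrite E2, Cmod_m1 in H. lra.
Qed.

Lemma Cmod_mult_lt1 (z w : C) : Cmod z <= 1 -> Cmod w < 1 -> Cmod (z * w)%C < 1.
Proof. intros Hz Hw. rewrite Cmod_mult. pose proof (Cmod_ge_0 z). pose proof (Cmod_ge_0 w). nra. Qed.

Lemma mob_den (a z : C) : unit_disk a -> Cmod z <= 1 -> (1 + Cconj a * z)%C <> RtoC 0.
Proof.
  intros Ha Hz. apply one_plus_neq0. rewrite Cmult_comm. apply Cmod_mult_lt1; [exact Hz|].
  rewrite Cmod_conj. exact Ha.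
Qed.

Lemma disk_opp (a : C) : unit_disk a -> unit_disk (- a)%C.
Proof. unfold unit_disk. rewrite Cmod_opp. auto. Qed.

Lemma mob_sq_identity (a z : C) :
  Cmod (1 + Cconj a * z)%C ^ 2 - Cmod (z + a)%C ^ 2 = (1 - Cmod a ^ 2) * (1 - Cmod z ^ 2).
Proof. rewrite !Cmod_sqr. destruct a, z. unfold Re, Im; simpl. ring. Qed.

Lemma mob_one_minus_sq (a z : C) : unit_disk a -> Cmod z <= 1 ->
  1 - Cmod (mob a z) ^ 2 = (1 - Cmod a ^ 2) * (1 - Cmod z ^ 2) / Cmod (1 + Cconj a * z)%C ^ 2.
Proof.
  intros Ha Hz. pose proof (mob_den a z Ha Hz) as Hd. unfold mob.
  rewrite Cmod_div by exact Hd. rewrite <- mob_sq_identity. apply Cmod_gt_0 in Hd. field. lra.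
Qed.

Lemma mob_disk (a z : C) : unit_disk a -> unit_disk z -> unit_disk (mob a z).
Proof.
  unfold unit_disk. intros Ha Hz. pose proof (mob_one_minus_sq a z Ha (Rlt_le _ _ Hz)) as H.
  pose proof (mob_den a z Ha (Rlt_le _ _ Hz)) as Hd. apply Cmod_gt_0 in Hd.
  assert (0 < (1 - Cmod a ^ 2) * (1 - Cmod z ^ 2) / Cmod (1 + Cconj a * z)%C ^ 2).
  { pose proof (Cmod_ge_0 a). pose proof (Cmod_ge_0 z).
    apply Rmult_lt_0_compat; [apply Rmult_lt_0_compat; nra|]. apply Rinv_0_lt_compat. nra. }
  pose proof (Cmod_ge_0 (mob a z)). nra.
Qed.

Lemma mob_opp_disk (a z : C) : unit_disk a -> unit_disk z -> unit_disk (mob (- a) z).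
Proof. intros Ha Hz. apply mob_disk; [apply disk_opp|]; assumption. Qed.

Lemma mob_cancel (a z : C) : unit_disk a -> unit_disk z -> mob (- a) (mob a z) = z.
Proof.
  intros Ha Hz. unfold mob. rewrite Copp_conj.
  pose proof (mob_den a z Ha (Rlt_le _ _ Hz)) as H1.
  pose proof (mob_den a (- a) Ha) as H2. rewrite Cmod_opp in H2. specialize (H2 (Rlt_le _ _ Ha)).
  assert (E : (1 + Cconj a * z + - Cconj a * (z + a))%C = (1 + Cconj a * - a)%C) by ring.
  field. split; [exact H1|]. rewrite E. exact H2.
Qed.

Lemma mob_cancel' (a z : C) : unit_disk a -> unit_disk z -> mob a (mob (- a) z) = z.
Proof.
  intros Ha Hz. pose proof (mob_cancel (- a) z (disk_opp a Ha) Hz) as H.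
  replace (- - a)%C with a in H by ring. exact H.
Qed.

Lemma mob_0 (a : C) : mob a 0 = a.
Proof. unfold mob. replace (1 + Cconj a * 0)%C with (RtoC 1) by ring. field. Qed.

Lemma mob_opp_self (a : C) : mob (- a) a = 0%C.
Proof. unfold mob. replace (a + - a)%C with (RtoC 0) by ring. unfold Cdiv. ring. Qed.

(** Both [mob (- w0)] and [mob (- mob b w0)] after [mob b] are automorphisms that
    send [w0] to 0, so they differ by a rotation. *)
Lemma mob_transition (b w0 : C) : unit_disk b -> unit_disk w0 ->
  exists e, Cmod e = 1 /\
    forall w, unit_disk w -> mob (- mob b w0) (mob b w) = (e * mob (- w0) w)%C.
Proof.
  intros Hb Hw0. exists ((1 + b * Cconj w0) / (1 + Cconj b * w0))%C.
  pose proof (mob_den b w0 Hb (Rlt_le _ _ Hw0)) as D0.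
  assert (Ec : (1 + b * Cconj w0)%C = Cconj (1 + Cconj b * w0)%C).
  { rewrite Cplus_conj, Cmult_conj, Cconj_conj. f_equal. apply injective_projections; simpl; ring. }
  split.
  - rewrite Cmod_div by exact D0. rewrite Ec, Cmod_conj. field.
    apply Cmod_gt_0 in D0. lra.
  - intros w Hw. pose proof (mob_den b w Hb (Rlt_le _ _ Hw)) as D1.
    assert (D0' : (1 + b * Cconj w0)%C <> RtoC 0).
    { rewrite Ec. intros E. apply D0. rewrite <- (Cconj_conj (1 + Cconj b * w0)), E.
      apply injective_projections; simpl; ring. }
    pose proof (mob_den (- w0) w (disk_opp _ Hw0) (Rlt_le _ _ Hw)) as D2.
    pose proof (mob_den (- mob b w0) (mob b w) (disk_opp _ (mob_disk _ _ Hb Hw0))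
      (Rlt_le _ _ (mob_disk _ _ Hb Hw))) as D3.
    assert (D4 : (1 - Cconj b * b)%C <> RtoC 0).
    { pose proof (mob_den b (- b) Hb) as H. rewrite Cmod_opp in H. specialize (H (Rlt_le _ _ Hb)).
      replace (1 - Cconj b * b)%C with (1 + Cconj b * - b)%C by ring. exact H. }
    unfold mob in *. rewrite !Copp_conj in *. rewrite Cdiv_conj in * by exact D0.
    rewrite <- Ec in *. rewrite Cplus_conj in *.
    assert (E3 : (1 + - ((Cconj w0 + Cconj b) / (1 + b * Cconj w0)) * ((w + b) / (1 + Cconj b * w)))%C
      = ((1 - Cconj b * b) * (1 + - Cconj w0 * w) / ((1 + b * Cconj w0) * (1 + Cconj b * w)))%C).
    { field. split; assumption. }
    rewrite E3. field. repeat split; assumption.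
Qed.

Lemma holo_at_mob (a z : C) : unit_disk a -> Cmod z <= 1 -> holo_at (mob a) z.
Proof.
  intros Ha Hz. apply (holo_at_div (fun z => z + a)%C (fun z => 1 + Cconj a * z)%C).
  - apply holo_at_plus; [apply holo_at_id|apply holo_at_const].
  - apply holo_at_plus; [apply holo_at_const|].
    apply holo_at_mult; [apply holo_at_const|apply holo_at_id].
  - apply mob_den; assumption.
Qed.

(** * The Schwarz-Pick lemma with an exceptional point *)

(** If [h 0 = 0], the quotient [h z / z] is continuous at 0 by the
    differentiability of [h], but its differentiability there is not immediate.
    To apply the lemma again to this quotient, one point [e] of mere continuity
    is allowed throughout. *)

Lemma holo_at_pow (f : C -> C) (n : nat) (z : C) : holo_at f z -> holo_at (fun w => f w ^ n)%C z.
Proof.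
  intros Hf. induction n as [|n IH]; simpl; [apply holo_at_const|].
  apply holo_at_mult; assumption.
Qed.

Lemma continuous_Cpow (f : C -> C) (n : nat) (z : C) : ctsC f z -> ctsC (fun w => f w ^ n)%C z.
Proof.
  intros Hf. induction n as [|n IH]; simpl; [apply continuous_const|].
  apply continuous_Cmult; assumption.
Qed.

(** Taking roots of order [n] makes the constants [A] and [B] irrelevant. *)
Lemma pow_domination (A B x y : R) :
  0 < A -> 0 < y -> (forall n, A * x ^ n <= B * y ^ n) -> x <= y.
Proof.
  intros HA Hy H. apply Rnot_lt_le. intros Hlt.
  assert (H1 : forall n, A * (x / y) ^ n <= B).
  { intros n. specialize (H n). pose proof (pow_lt y n Hy) as Hp.
    replace (x / y) with (x * / y) by reflexivity. rewrite Rpow_mult_distr, pow_inv.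
    apply (Rmult_le_reg_r (y ^ n)); [exact Hp|].
    rewrite Rmult_assoc, (Rmult_assoc (x ^ n)), Rinv_l, Rmult_1_r by lra. exact H. }
  assert (Hr : 1 < Rabs (x / y)).
  { rewrite Rabs_pos_eq; [apply (Rmult_lt_reg_r y)|apply Rlt_le, Rdiv_lt_0_compat]; try lra.
    unfold Rdiv. rewrite Rmult_assoc, Rinv_l; lra. }
  destruct (Pow_x_infinity _ Hr (B / A + 1)) as [N HN].
  specialize (HN N (Nat.le_refl _)). specialize (H1 N).
  rewrite Rabs_pos_eq in HN by (apply pow_le, Rlt_le, Rdiv_lt_0_compat; lra).
  apply Rge_le in HN. apply (Rmult_le_compat_l A) in HN; [|lra].
  replace (A * (B / A + 1)) with (B + A) in HN by (field; lra). lra.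
Qed.

Lemma avoid_two (z p q : C) (d : R) : 0 < d ->
  exists w, Cmod (w - z) < d /\ w <> p /\ w <> q.
Proof.
  intros Hd.
  assert (Hp : forall p : C, exists m, 0 < m /\ forall t, 0 < t < m -> (z + RtoC t)%C <> p).
  { clear. intros p. destruct (classic (z = p)) as [<-|n].
    - exists 1; split; [lra|]. intros t Ht E.
      apply (f_equal (fun u => Cmod (u - z))) in E.
      replace (z + RtoC t - z)%C with (RtoC t) in E by ring.
      replace (z - z)%C with (RtoC 0) in E by ring.
      rewrite Cmod_0, Cmod_R, Rabs_pos_eq in E; lra.
    - apply Csub_neq in n. exists (Cmod (z - p)); split; [apply Cmod_gt_0; exact n|].
      intros t Ht E. rewrite <- E in Ht. replace (z - (z + RtoC t))%C with (- RtoC t)%C in Ht by ring.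
      rewrite Cmod_opp, Cmod_R, Rabs_pos_eq in Ht; lra. }
  destruct (Hp p) as [m1 [Hm1 H1]], (Hp q) as [m2 [Hm2 H2]].
  assert (Hm : 0 < Rmin d (Rmin m1 m2)) by (repeat apply Rmin_glb_lt; assumption).
  pose proof (Rmin_l d (Rmin m1 m2)). pose proof (Rmin_r d (Rmin m1 m2)).
  pose proof (Rmin_l m1 m2). pose proof (Rmin_r m1 m2).
  set (t := Rmin d (Rmin m1 m2) / 2). assert (Ht : 0 < t < Rmin d (Rmin m1 m2)) by (unfold t; lra).
  exists (z + RtoC t)%C. split; [|split; [apply H1|apply H2]; lra].
  replace (z + RtoC t - z)%C with (RtoC t) by ring. rewrite Cmod_R, Rabs_pos_eq; lra.
Qed.

(** The function [z (z - e) Q^n] vanishes at the exceptional points, so that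
    [max_principle] applies to it; for large [n] the factor in front is
    irrelevant. *)
Lemma max_principle_exceptional (Q : C -> C) (e : C) :
  unit_disk e ->
  (forall z, unit_disk z -> ctsC Q z) ->
  (forall z, unit_disk z -> z <> 0%C -> z <> e -> holo_at Q z) ->
  (forall y, 1 < y -> exists r, r < 1 /\ forall z, r <= Cmod z < 1 -> Cmod (Q z) <= y) ->
  forall z, unit_disk z -> Cmod (Q z) <= 1.
Proof.
  intros He Hc Hh Hb.
  assert (H1 : forall z, unit_disk z -> z <> 0%C -> z <> e -> Cmod (Q z) <= 1).
  { intros z Hz Hz0 Hze. apply le_epsilon. intros x Hx.
    destruct (Hb (1 + x)) as [r0 [Hr0 Hr]]; [lra|].
    set (r := (1 + Rmax r0 (Cmod z)) / 2).
    assert (Hr' : r0 < r /\ Cmod z < r /\ r < 1).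
    { unfold r. pose proof (Rmax_l r0 (Cmod z)). pose proof (Rmax_r r0 (Cmod z)).
      assert (Rmax r0 (Cmod z) < 1) by (apply Rmax_lub_lt; assumption). lra. }
    clearbody r. pose proof (Cmod_ge_0 z).
    apply (pow_domination (Cmod z * Cmod (z - e)) 2); [|lra|].
    - apply Rmult_lt_0_compat; [apply Cmod_gt_0; exact Hz0|].
      apply Cmod_gt_0, Csub_neq; exact Hze.
    - intros n. rewrite <- Cmod_pow, <- !Cmod_mult.
      apply (max_principle (fun w => w * (w - e) * Q w ^ n)%C r); try lra.
      + apply Rmult_le_pos; [lra|apply pow_le; lra].
      + intros w Hw. assert (Hcw : ctsC (fun w => Q w ^ n)%C w) by
          (apply continuous_Cpow, Hc; unfold unit_disk; lra).
        cts.
      + intros w Hw Hne. apply holo_at_mult.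
        * apply holo_at_mult; [apply holo_at_id|].
          apply holo_at_minus; [apply holo_at_id|apply holo_at_const].
        * apply holo_at_pow. apply Hh; [unfold unit_disk; lra| |];
            intros E; apply Hne; rewrite E; ring.
      + intros w Hw. rewrite !Cmod_mult, Cmod_pow.
        assert (Cmod (w - e) <= 2).
        { pose proof (Cmod_triangle w (- e)) as Ht. rewrite Cmod_opp in Ht. unfold unit_disk in He.
          unfold Cminus. lra. }
        assert (Cmod (Q w) ^ n <= (1 + x) ^ n).
        { apply pow_incr. split; [apply Cmod_ge_0|apply Hr; lra]. }
        pose proof (Cmod_ge_0 (w - e)). pose proof (pow_le _ n (Cmod_ge_0 (Q w))).
        rewrite Hw. apply Rmult_le_compat; try assumption; nra. }
  intros z Hz. apply Rnot_lt_le. intros Hlt.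
  pose proof (continuous_R_eps (fun z => Cmod (Q z)) z (continuous_Cmod Q z (Hc z Hz)) (Cmod (Q z) - 1)) as H2.
  destruct H2 as [d [Hd H2]]; [lra|].
  unfold unit_disk in Hz.
  destruct (avoid_two z 0%C e (Rmin d (1 - Cmod z))) as [w [Hw [Hw0 Hwe]]]; [apply Rmin_glb_lt; lra|].
  pose proof (Rmin_l d (1 - Cmod z)). pose proof (Rmin_r d (1 - Cmod z)).
  specialize (H2 w ltac:(lra)). apply Rabs_def2 in H2.
  pose proof (Cmod_triangle z (w - z)) as Ht. replace (z + (w - z))%C with w in Ht by ring.
  specialize (H1 w). unfold unit_disk in H1. specialize (H1 ltac:(lra) Hw0 Hwe). lra.
Qed.

(** The classical argument: near the unit circle [|h z / z|] is at most
    [1 / |z|], which is close to 1. *)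
Lemma schwarz_quotient (h : C -> C) (e : C) :
  unit_disk e -> h 0%C = 0%C ->
  (forall z, unit_disk z -> Cmod (h z) <= 1) ->
  (forall z, unit_disk z -> ctsC h z) -> holo_at h 0%C ->
  (forall z, unit_disk z -> z <> e -> holo_at h z) ->
  exists g : C -> C, (forall z, unit_disk z -> h z = (z * g z)%C) /\
    (forall z, unit_disk z -> Cmod (g z) <= 1) /\ (forall z, unit_disk z -> ctsC g z) /\
    (forall z, unit_disk z -> z <> 0%C -> z <> e -> holo_at g z).
Proof.
  intros He H0 Hb Hc [q [Hq Hloc]] Hh.
  set (g := fun z : C => if excluded_middle_informative (z = 0%C) then q 0%C else (h z / z)%C).
  assert (Hg : forall z : C, z <> 0%C -> locally (T := C_UniformSpace) z (fun w => (h w / w)%C = g w)).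
  { intros z Hz. generalize (locally_neq0 (fun w => w) z (continuous_id z) Hz). apply filter_imp.
    intros w Hw. unfold g. destruct (excluded_middle_informative (@eq C w 0%C)); [contradiction|reflexivity]. }
  assert (Hgh : forall z, unit_disk z -> z <> 0%C -> z <> e -> holo_at g z).
  { intros z Hz Hz0 Hze. apply (holo_at_ext (fun w => h w / w)%C); [apply Hg; exact Hz0|].
    apply holo_at_div; [apply Hh; assumption|apply holo_at_id|exact Hz0]. }
  assert (Hgc : forall z, unit_disk z -> ctsC g z).
  { intros z Hz. destruct (classic (z = 0%C)) as [->|Hz0].
    - apply (continuous_ext_loc _ q); [|exact Hq].
      generalize Hloc. apply filter_imp. intros w Hw. rewrite H0 in Hw. unfold g.
      destruct (excluded_middle_informative (@eq C w 0%C)) as [->|n]; [reflexivity|].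
      rewrite Hw. assert (E : q w = ((0 + q w * (w - 0)) / w)%C) by (field; exact n). exact E.
    - apply (continuous_ext_loc _ (fun w => h w / w)%C); [apply Hg; exact Hz0|].
      specialize (Hc z Hz). cts. }
  exists g. split; [|split; [|split]]; try assumption.
  - intros z _. unfold g. destruct (excluded_middle_informative (@eq C z 0%C)) as [->|n].
    + rewrite H0. ring.
    + field. exact n.
  - apply (max_principle_exceptional g e); try assumption.
    intros y Hy. assert (Hy' : 0 < / y < 1).
    { split; [apply Rinv_0_lt_compat; lra|]. rewrite <- Rinv_1. apply Rinv_lt_contravar; lra. }
    exists (/ y); split; [lra|]. intros z Hz. unfold g.
    destruct (excluded_middle_informative (@eq C z 0%C)) as [E|n].
    + rewrite E, Cmod_0 in Hz. lra.
    + rewrite Cmod_div by exact n. specialize (Hb z ltac:(unfold unit_disk; lra)).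
      apply (Rmult_le_reg_r (Cmod z)); [lra|]. unfold Rdiv.
      rewrite Rmult_assoc, Rinv_l, Rmult_1_r by lra.
      assert (y * / y = 1) by (apply Rinv_r; lra). nra.
Qed.

(** Precomposing with [mob w] and composing with [mob (- g w)] moves [w] and [g w]
    to 0, where [schwarz_quotient] applies. That requires differentiability at
    [w], hence [w <> e]. *)
Lemma schwarz_pick_strict (g : C -> C) (e : C) :
  unit_disk e -> (exists l, l < 1 /\ forall z, unit_disk z -> Cmod (g z) <= l) ->
  (forall z, unit_disk z -> ctsC g z) ->
  (forall z, unit_disk z -> z <> e -> holo_at g z) ->
  forall w z, unit_disk w -> unit_disk z -> w <> e ->
  Cmod (mob (- g w) (g z)) <= Cmod (mob (- w) z).
Proof.
  intros He [l [Hl Hb]] Hc Hh w z Hw Hz Hwe.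
  assert (Hgd : forall z, unit_disk z -> unit_disk (g z)).
  { intros u Hu. specialize (Hb u Hu). unfold unit_disk. lra. }
  assert (Hmw : forall u, unit_disk u -> unit_disk (mob w u)) by (intros; apply mob_disk; assumption).
  assert (Hng : unit_disk (- g w)%C) by (apply disk_opp, Hgd, Hw).
  assert (H0 : unit_disk 0%C) by (unfold unit_disk; rewrite Cmod_0; lra).
  assert (Hhol : forall u, unit_disk u -> mob w u <> e -> holo_at (fun u => mob (- g w) (g (mob w u))) u).
  { intros u Hu Hue. apply (holo_at_comp (mob (- g w)) (fun u => g (mob w u))).
    - apply holo_at_mob; [exact Hng|]. apply Rlt_le, Hgd, Hmw, Hu.
    - apply (holo_at_comp g (mob w)); [apply Hh; [apply Hmw; exact Hu|exact Hue]|].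
      apply holo_at_mob; [exact Hw|apply Rlt_le; exact Hu]. }
  destruct (schwarz_quotient (fun u => mob (- g w) (g (mob w u))) (mob (- w) e)) as [k [Hk1 [Hk2 _]]].
  - apply mob_opp_disk; assumption.
  - rewrite mob_0. apply mob_opp_self.
  - intros u Hu. apply Rlt_le. apply mob_disk; [exact Hng|apply Hgd, Hmw, Hu].
  - intros u Hu. apply (continuous_comp (fun u => g (mob w u)) (mob (- g w))).
    + apply (continuous_comp (mob w) g); [|apply Hc, Hmw, Hu].
      apply holo_at_continuous, holo_at_mob; [exact Hw|apply Rlt_le, Hu].
    + apply holo_at_continuous, holo_at_mob; [exact Hng|apply Rlt_le, Hgd, Hmw, Hu].
  - apply Hhol; [exact H0|]. rewrite mob_0. exact Hwe.
  - intros u Hu Hue. apply Hhol; [exact Hu|]. intros E. apply Hue. rewrite <- E.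
    symmetry. apply mob_cancel; assumption.
  - assert (Hv : unit_disk (mob (- w) z)) by (apply mob_opp_disk; assumption).
    specialize (Hk1 _ Hv). specialize (Hk2 _ Hv). rewrite mob_cancel' in Hk1 by assumption.
    rewrite Hk1, Cmod_mult. pose proof (Cmod_ge_0 (mob (- w) z)). nra.
Qed.

(** Multiplicative form, which also makes sense where [|g| = 1]; it follows from
    the strict case applied to [l g] as [l] tends to 1. *)
Lemma schwarz_pick (g : C -> C) (e : C) :
  unit_disk e -> (forall z, unit_disk z -> Cmod (g z) <= 1) ->
  (forall z, unit_disk z -> ctsC g z) ->
  (forall z, unit_disk z -> z <> e -> holo_at g z) ->
  forall w z, unit_disk w -> unit_disk z -> w <> e ->
  Cmod (g z - g w) * Cmod (1 - Cconj w * z) <= Cmod (z - w) * Cmod (1 - Cconj (g w) * g z).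
Proof.
  intros He Hb Hc Hh w z Hw Hz Hwe.
  set (A := Cmod (g z - g w) * Cmod (1 - Cconj w * z)).
  set (K := Cmod (1 - Cconj (g w) * g z)). set (B := Cmod (z - w)).
  assert (Hl : forall l, 0 < l < 1 -> l * A <= B * (K + 2 * (1 - l))).
  { intros l Hl.
    pose proof (schwarz_pick_strict (fun z => l * g z)%C e He) as H.
    assert (Hlg : forall u, unit_disk u -> Cmod (l * g u)%C <= l).
    { intros u Hu. specialize (Hb u Hu). rewrite Cmod_mult, Cmod_R, Rabs_pos_eq by lra. nra. }
    specialize (H (ex_intro _ l (conj (proj2 Hl) Hlg))).
    specialize (H ltac:(intros u Hu; specialize (Hc u Hu); cts)).
    specialize (H ltac:(intros u Hu Hue; apply holo_at_mult; [apply holo_at_const|apply Hh; assumption])).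
    specialize (H w z Hw Hz Hwe). unfold mob in H.
    assert (D1 : (1 + Cconj (- w) * z)%C <> RtoC 0) by (apply mob_den; [apply disk_opp, Hw|apply Rlt_le, Hz]).
    assert (D2 : (1 + Cconj (- (l * g w)) * (l * g z))%C <> RtoC 0).
    { apply mob_den; [apply disk_opp|]; unfold unit_disk.
      - eapply Rle_lt_trans; [apply Hlg, Hw|lra].
      - eapply Rle_trans; [apply Hlg, Hz|lra]. }
    rewrite !Cmod_div in H by assumption.
    assert (E2 : (1 + Cconj (- (l * g w)) * (l * g z))%C
      = ((1 - Cconj (g w) * g z) + RtoC (1 - l ^ 2) * (Cconj (g w) * g z))%C).
    { destruct (g w), (g z). apply injective_projections; simpl; ring. }
    assert (E1 : (1 + Cconj (- w) * z)%C = (1 - Cconj w * z)%C) by (rewrite Copp_conj; ring).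
    rewrite E1 in *. apply Cmod_gt_0 in D1. apply Cmod_gt_0 in D2.
    replace (l * g z + - (l * g w))%C with (l * (g z - g w))%C in H by ring.
    replace (z + - w)%C with (z - w)%C in H by ring.
    rewrite (Cmod_mult l), Cmod_R, Rabs_pos_eq in H by lra.
    assert (D3 : Cmod (1 + Cconj (- (l * g w)) * (l * g z)) <= K + 2 * (1 - l)).
    { rewrite E2. eapply Rle_trans; [apply Cmod_triangle|]. unfold K. apply Rplus_le_compat_l.
      rewrite !Cmod_mult, Cmod_conj, Cmod_R, Rabs_pos_eq by nra.
      pose proof (Hb w Hw). pose proof (Hb z Hz). pose proof (Cmod_ge_0 (g w)). pose proof (Cmod_ge_0 (g z)).
      assert (P1 : Cmod (g w) * Cmod (g z) <= 1 * 1) by (apply Rmult_le_compat; assumption).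
      assert (P2 : 0 <= 1 - l ^ 2 <= 2 * (1 - l)) by nra.
      apply (Rmult_le_compat_l (1 - l ^ 2)) in P1; lra. }
    set (d1 := Cmod (1 - Cconj w * z)) in *.
    set (d2 := Cmod (1 + Cconj (- (l * g w)) * (l * g z))) in *.
    apply (Rmult_le_compat_r (d1 * d2)) in H; [|nra].
    replace (l * Cmod (g z - g w) / d2 * (d1 * d2)) with (l * A) in H by (unfold A; fold d1; field; lra).
    fold B in H. replace (B / d1 * (d1 * d2)) with (B * d2) in H by (field; lra).
    assert (0 <= B) by apply Cmod_ge_0. nra. }
  assert (HA : 0 <= A) by (apply Rmult_le_pos; apply Cmod_ge_0).
  assert (HB : 0 <= B) by apply Cmod_ge_0.
  apply Rnot_lt_le. intros Hlt.
  set (d := Rmin (1 / 2) ((A - B * K) / (2 * (A + 2 * B)))).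
  assert (HBK : 0 <= B * K) by (apply Rmult_le_pos; [exact HB|apply Cmod_ge_0]).
  assert (Hp : 0 < A + 2 * B) by lra.
  assert (Hd : 0 < d) by (apply Rmin_glb_lt; [lra|apply Rdiv_lt_0_compat; lra]).
  pose proof (Rmin_l (1 / 2) ((A - B * K) / (2 * (A + 2 * B)))) as Hd1. fold d in Hd1.
  pose proof (Rmin_r (1 / 2) ((A - B * K) / (2 * (A + 2 * B)))) as Hd2. fold d in Hd2.
  apply (Rmult_le_compat_r (2 * (A + 2 * B))) in Hd2; [|lra].
  unfold Rdiv in Hd2. rewrite Rmult_assoc, Rinv_l, Rmult_1_r in Hd2 by lra.
  specialize (Hl (1 - d) ltac:(lra)). lra.
Qed.

(** * The hyperbolic distance *)

Definition twice_artanh (x : R) : R := ln ((1 + x) / (1 - x)).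

Lemma twice_artanh_0 : twice_artanh 0 = 0.
Proof. unfold twice_artanh. replace ((1 + 0) / (1 - 0)) with 1 by field. apply ln_1. Qed.

Lemma twice_artanh_lt (x y : R) : 0 <= x -> x < y -> y < 1 -> twice_artanh x < twice_artanh y.
Proof.
  intros Hx Hxy Hy. unfold twice_artanh. apply ln_increasing.
  - apply Rdiv_lt_0_compat; lra.
  - apply Rlt_0_minus. replace ((1 + y) / (1 - y) - (1 + x) / (1 - x))
      with (2 * (y - x) / ((1 - y) * (1 - x))) by (field; lra).
    apply Rdiv_lt_0_compat; [lra|]. apply Rmult_lt_0_compat; lra.
Qed.

Lemma twice_artanh_le (x y : R) : 0 <= x -> x <= y -> y < 1 -> twice_artanh x <= twice_artanh y.
Proof.
  intros Hx [Hxy| ->] Hy; [|lra]. left. apply twice_artanh_lt; assumption.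
Qed.

Lemma twice_artanh_le_inv (x y : R) : 0 <= x < 1 -> 0 <= y < 1 -> twice_artanh x <= twice_artanh y -> x <= y.
Proof.
  intros Hx Hy H. apply Rnot_lt_le. intros Hlt.
  pose proof (twice_artanh_lt y x ltac:(lra) Hlt ltac:(lra)). lra.
Qed.

(** The addition theorem of the hyperbolic tangent. *)
Lemma twice_artanh_add (x y : R) : 0 <= x < 1 -> 0 <= y < 1 ->
  twice_artanh ((x + y) / (1 + x * y)) = twice_artanh x + twice_artanh y.
Proof.
  intros Hx Hy. unfold twice_artanh. rewrite <- ln_mult; try (apply Rdiv_lt_0_compat; lra).
  f_equal. assert (0 <= x * y) by nra. assert (0 < (1 - x) * (1 - y)) by nra.
  field. repeat split; try lra; nra.
Qed.

Lemma rho_mob_eq (z w : C) : rho z w = Cmod (mob (- w) z).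
Proof.
  unfold rho, mob. rewrite Copp_conj.
  replace (1 + - Cconj w * z)%C with (1 - Cconj w * z)%C by ring. reflexivity.
Qed.

Lemma k_disk_eq (z w : C) : k_disk z w = twice_artanh (rho z w).
Proof. reflexivity. Qed.

Lemma rho_bounds (z w : C) : unit_disk z -> unit_disk w -> 0 <= rho z w < 1.
Proof.
  intros Hz Hw. rewrite rho_mob_eq. split; [apply Cmod_ge_0|].
  apply mob_opp_disk; assumption.
Qed.

Lemma one_minus_rho_sq (z w : C) : unit_disk z -> unit_disk w ->
  1 - rho z w ^ 2 = (1 - Cmod w ^ 2) * (1 - Cmod z ^ 2) / Cmod (1 - Cconj w * z)%C ^ 2.
Proof.
  intros Hz Hw. rewrite rho_mob_eq, mob_one_minus_sq;
    [|apply disk_opp, Hw|apply Rlt_le, Hz].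
  rewrite Cmod_opp, Copp_conj.
  replace (1 + - Cconj w * z)%C with (1 - Cconj w * z)%C by ring. reflexivity.
Qed.

Lemma den_neq0 (z w : C) : unit_disk z -> unit_disk w -> (1 - Cconj w * z)%C <> RtoC 0.
Proof.
  intros Hz Hw. pose proof (mob_den (- w) z (disk_opp _ Hw) (Rlt_le _ _ Hz)) as H.
  rewrite Copp_conj in H. replace (1 - Cconj w * z)%C with (1 + - Cconj w * z)%C by ring. exact H.
Qed.

Lemma disk_0 : unit_disk 0.
Proof. unfold unit_disk. rewrite Cmod_0. lra. Qed.

Lemma rho_sym (z w : C) : rho z w = rho w z.
Proof.
  unfold rho. destruct (classic ((1 - Cconj w * z)%C = RtoC 0)) as [E|N].
  - assert (E' : (1 - Cconj z * w)%C = Cconj (1 - Cconj w * z)%C).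
    { destruct z, w; apply injective_projections; simpl; ring. }
    rewrite E', E. replace (Cconj 0) with (RtoC 0) by (apply injective_projections; simpl; ring).
    unfold Cdiv. rewrite !Cmod_mult. f_equal. rewrite <- Cmod_opp. f_equal. ring.
  - assert (E' : (1 - Cconj z * w)%C = Cconj (1 - Cconj w * z)%C).
    { destruct z, w; apply injective_projections; simpl; ring. }
    assert (N' : (1 - Cconj z * w)%C <> RtoC 0).
    { rewrite E'. intros E. apply N. rewrite <- (Cconj_conj (1 - Cconj w * z)), E.
      apply injective_projections; simpl; ring. }
    rewrite !Cmod_div by assumption. f_equal.
    + rewrite <- Cmod_opp. f_equal. ring.
    + rewrite E', Cmod_conj. reflexivity.
Qed.

Lemma k_sym (z w : C) : k_disk z w = k_disk w z.
Proof. rewrite !k_disk_eq, rho_sym. reflexivity. Qed.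

Lemma rho_0_r (z : C) : rho z 0 = Cmod z.
Proof.
  rewrite rho_mob_eq. f_equal. unfold mob. rewrite Copp_conj.
  replace (Cconj 0) with (RtoC 0) by (apply injective_projections; simpl; ring).
  replace (1 + - 0 * z)%C with (RtoC 1) by ring. field.
Qed.

Lemma k_0_r (z : C) : k_disk z 0 = twice_artanh (Cmod z).
Proof. rewrite k_disk_eq, rho_0_r. reflexivity. Qed.

Lemma k_self (z : C) : k_disk z z = 0.
Proof. rewrite k_disk_eq, rho_mob_eq, mob_opp_self, Cmod_0. apply twice_artanh_0. Qed.

Lemma k_mob (a z w : C) : unit_disk a -> unit_disk z -> unit_disk w ->
  k_disk (mob a z) (mob a w) = k_disk z w.
Proof.
  intros Ha Hz Hw. rewrite !k_disk_eq, !rho_mob_eq.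
  destruct (mob_transition a w Ha Hw) as [e [He H]]. rewrite (H z Hz), Cmod_mult, He, Rmult_1_l.
  reflexivity.
Qed.

Lemma Re_Cconj_mult_ge (z w : C) : - (Cmod z * Cmod w) <= Re (Cconj w * z)%C.
Proof.
  pose proof (re_le_Cmod (Cconj w * z)%C) as H. rewrite Cmod_mult, Cmod_conj in H.
  apply Rabs_le_between in H. lra.
Qed.

Lemma den_sq (z w : C) :
  Cmod (1 - Cconj w * z)%C ^ 2 = 1 - 2 * Re (Cconj w * z)%C + (Cmod z * Cmod w) ^ 2.
Proof.
  rewrite Rpow_mult_distr, !Cmod_sqr. destruct z, w; unfold Re, Im; simpl. ring.
Qed.

Lemma rho_sum_sq (x y : R) : 0 <= x < 1 -> 0 <= y < 1 ->
  1 - ((x + y) / (1 + x * y)) ^ 2 = (1 - y ^ 2) * (1 - x ^ 2) / (1 + x * y) ^ 2.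
Proof. intros Hx Hy. assert (0 <= x * y) by nra. field. nra. Qed.

Lemma sum_bounds (x y : R) : 0 <= x < 1 -> 0 <= y < 1 -> 0 <= (x + y) / (1 + x * y) < 1.
Proof.
  intros Hx Hy. assert (0 <= x * y) by nra. split.
  - apply Rmult_le_pos; [lra|]. left; apply Rinv_0_lt_compat; lra.
  - apply (Rmult_lt_reg_r (1 + x * y)); [lra|]. unfold Rdiv.
    rewrite Rmult_assoc, Rinv_l by lra. nra.
Qed.

(** Both statements compare [1 - rho^2], where only [|1 - conj(w) z|] depends on
    the angle between [z] and [w]. *)
Lemma k_le_via_0 (z w : C) : unit_disk z -> unit_disk w ->
  k_disk z w <= k_disk z 0 + k_disk w 0 /\
  (k_disk z w = k_disk z 0 + k_disk w 0 -> Re (Cconj w * z)%C = - (Cmod z * Cmod w)).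
Proof.
  intros Hz Hw. rewrite !k_0_r, k_disk_eq.
  assert (Bz : 0 <= Cmod z < 1) by (split; [apply Cmod_ge_0|exact Hz]).
  assert (Bw : 0 <= Cmod w < 1) by (split; [apply Cmod_ge_0|exact Hw]).
  rewrite <- twice_artanh_add by assumption.
  pose proof (one_minus_rho_sq z w Hz Hw) as H1.
  pose proof (rho_sum_sq _ _ Bz Bw) as H2.
  pose proof (sum_bounds _ _ Bz Bw) as H3. pose proof (rho_bounds z w Hz Hw) as H4.
  pose proof (den_sq z w) as Hd. pose proof (Re_Cconj_mult_ge z w) as Hr.
  pose proof (den_neq0 z w Hz Hw) as Hn. apply Cmod_gt_0 in Hn.
  set (N := (1 - Cmod w ^ 2) * (1 - Cmod z ^ 2)) in *.
  assert (HN : 0 < N) by (unfold N; apply Rmult_lt_0_compat; nra).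
  assert (HP : 0 <= Cmod z * Cmod w) by nra.
  set (S := (Cmod z + Cmod w) / (1 + Cmod z * Cmod w)) in *.
  set (D := Cmod (1 - Cconj w * z)%C ^ 2) in *.
  assert (HD : 0 < D) by (unfold D; nra).
  assert (HE : 0 < (1 + Cmod z * Cmod w) ^ 2) by nra.
  assert (K1 : (1 - rho z w ^ 2) * D = N) by (rewrite H1; field; lra).
  assert (K2 : (1 - S ^ 2) * (1 + Cmod z * Cmod w) ^ 2 = N) by (rewrite H2; field; lra).
  assert (HDE : D <= (1 + Cmod z * Cmod w) ^ 2) by nra.
  split.
  - apply twice_artanh_le; [lra| |lra]. apply Rnot_lt_le. intros Hlt.
    assert (1 - rho z w ^ 2 < 1 - S ^ 2) by nra.
    assert (0 < 1 - rho z w ^ 2) by nra. nra.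
  - intros E. assert (Er : rho z w = S).
    { apply Rle_antisym; apply twice_artanh_le_inv; lra. }
    rewrite Er in K1. assert (0 < 1 - S ^ 2) by nra.
    assert (D = (1 + Cmod z * Cmod w) ^ 2).
    { apply (Rmult_eq_reg_l (1 - S ^ 2)); lra. }
    nra.
Qed.

Lemma k_recentre (x y z : C) : unit_disk x -> unit_disk y -> unit_disk z ->
  k_disk x z = k_disk (mob (- z) x) 0 /\
  k_disk x y = k_disk (mob (- z) x) (mob (- z) y).
Proof.
  intros Hx Hy Hz. split.
  - rewrite <- (mob_opp_self z). symmetry. apply k_mob; try apply disk_opp; assumption.
  - symmetry. apply k_mob; try apply disk_opp; assumption.
Qed.

Lemma k_triangle (x y z : C) : unit_disk x -> unit_disk y -> unit_disk z ->
  k_disk x y <= k_disk x z + k_disk y z.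
Proof.
  intros Hx Hy Hz. destruct (k_recentre x y z) as [-> ->]; try assumption.
  destruct (k_recentre y x z) as [-> _]; try assumption.
  apply k_le_via_0; (apply mob_opp_disk; assumption).
Qed.

(** Equality means that [x] and [y] are seen from [z] in opposite directions. *)
Lemma k_triangle_eq (x y z : C) : unit_disk x -> unit_disk y -> unit_disk z ->
  k_disk x y = k_disk x z + k_disk y z ->
  Re (Cconj (mob (- z) y) * mob (- z) x)%C = - (Cmod (mob (- z) x) * Cmod (mob (- z) y)).
Proof.
  intros Hx Hy Hz. destruct (k_recentre x y z) as [-> ->]; try assumption.
  destruct (k_recentre y x z) as [-> _]; try assumption.
  apply k_le_via_0; (apply mob_opp_disk; assumption).
Qed.

Lemma scaled_disk (t : R) (w : C) : 0 <= t <= 1 -> unit_disk w -> unit_disk (t * w)%C.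
Proof.
  unfold unit_disk. intros Ht Hw. rewrite Cmod_mult, Cmod_R, Rabs_pos_eq by lra.
  pose proof (Cmod_ge_0 w). nra.
Qed.

Lemma k_radial (t : R) (w : C) : 0 <= t <= 1 -> unit_disk w ->
  k_disk w (t * w) = k_disk w 0 - k_disk (t * w)%C 0.
Proof.
  intros Ht Hw. rewrite !k_0_r, k_disk_eq.
  pose proof (scaled_disk t w Ht Hw) as Htw.
  assert (Em : Cmod (t * w)%C = t * Cmod w) by (rewrite Cmod_mult, Cmod_R, Rabs_pos_eq by lra; ring).
  assert (Bw : 0 <= Cmod w < 1) by (split; [apply Cmod_ge_0|exact Hw]).
  set (x := Cmod w) in *.
  assert (Hden : 0 < 1 - t * x ^ 2) by nra.
  assert (Er : rho w (t * w) = (1 - t) * x / (1 - t * x ^ 2)).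
  { unfold rho. assert (E1 : (1 - Cconj (t * w) * w)%C = RtoC (1 - t * x ^ 2)).
    { unfold x. rewrite Cmod_sqr. destruct w; apply injective_projections; unfold Re, Im; simpl; ring. }
    rewrite E1, Cmod_div.
    - replace (w - t * w)%C with (RtoC (1 - t) * w)%C by (rewrite RtoC_minus; ring).
      rewrite Cmod_mult, !Cmod_R, !Rabs_pos_eq by lra. reflexivity.
    - intros E. apply RtoC_inj in E. lra. }
  rewrite Er, Em.
  assert (B1 : 0 <= t * x < 1) by nra.
  assert (B2 : 0 <= (1 - t) * x / (1 - t * x ^ 2) < 1).
  { rewrite <- Er. apply rho_bounds; assumption. }
  apply (Rplus_eq_reg_r (twice_artanh (t * x))). rewrite <- twice_artanh_add by assumption.
  replace (((1 - t) * x / (1 - t * x ^ 2) + t * x) / (1 + (1 - t) * x / (1 - t * x ^ 2) * (t * x)))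
    with x; [ring|]. field. split; nra.
Qed.

Lemma continuous_k {U : UniformSpace} (f g : U -> C) (u : U) :
  ctsC f u -> ctsC g u -> unit_disk (f u) -> unit_disk (g u) ->
  continuous (fun v => k_disk (f v) (g v)) u.
Proof.
  intros Hf Hg Df Dg. pose proof (rho_bounds _ _ Df Dg) as Hb. unfold k_disk.
  pose proof (den_neq0 _ _ Df Dg) as Hn.
  assert (Hr : continuous (fun v => rho (f v) (g v)) u) by (unfold rho; cts).
  apply (continuous_comp (fun v => (1 + rho (f v) (g v)) / (1 - rho (f v) (g v))) ln).
  - cts. lra.
  - apply continuous_ln. apply Rdiv_lt_0_compat; lra.
Qed.

Lemma k_schwarz_pick (f : C -> C) :
  (forall z, unit_disk z -> unit_disk (f z)) -> (forall z, unit_disk z -> holo_at f z) ->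
  forall z w, unit_disk z -> unit_disk w -> k_disk (f z) (f w) <= k_disk z w.
Proof.
  intros Hd Hh z w Hz Hw. rewrite !k_disk_eq.
  destruct (avoid_two 0%C w w 1 ltac:(lra)) as [e [He [Hwe _]]].
  replace (e - 0)%C with e in He by ring.
  pose proof (schwarz_pick f e He) as H.
  specialize (H ltac:(intros; apply Rlt_le, Hd; assumption)).
  specialize (H ltac:(intros; apply holo_at_continuous, Hh; assumption)).
  specialize (H ltac:(intros; apply Hh; assumption) w z Hw Hz (not_eq_sym Hwe)).
  apply twice_artanh_le; try (apply rho_bounds; auto).
  pose proof (den_neq0 _ _ Hz Hw) as N1. pose proof (den_neq0 _ _ (Hd _ Hz) (Hd _ Hw)) as N2.
  unfold rho. rewrite !Cmod_div by assumption.
  apply Cmod_gt_0 in N1. apply Cmod_gt_0 in N2.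
  apply (Rmult_le_reg_r (Cmod (1 - Cconj w * z) * Cmod (1 - Cconj (f w) * f z))); [nra|].
  unfold Rdiv.
  replace (Cmod (f z - f w) * / Cmod (1 - Cconj (f w) * f z) * (Cmod (1 - Cconj w * z) * Cmod (1 - Cconj (f w) * f z)))
    with (Cmod (f z - f w) * Cmod (1 - Cconj w * z)) by (field; lra).
  replace (Cmod (z - w) * / Cmod (1 - Cconj w * z) * (Cmod (1 - Cconj w * z) * Cmod (1 - Cconj (f w) * f z)))
    with (Cmod (z - w) * Cmod (1 - Cconj (f w) * f z)) by (field; lra).
  exact H.
Qed.

(** * Local maxima along a geodesic *)

(** For [|y| = |v|] the factors that depend on [|y|] and [|v|] cancel in the
    comparison of [1 - rho^2]. *)
Lemma k_le_cross (x y u v : C) :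
  unit_disk x -> unit_disk y -> unit_disk u -> unit_disk v -> Cmod y = Cmod v ->
  k_disk x y <= k_disk u v ->
  (1 - Cmod u ^ 2) * (1 - 2 * Re (Cconj y * x)%C + (Cmod x * Cmod v) ^ 2) <=
  (1 - Cmod x ^ 2) * (1 - 2 * Re (Cconj v * u)%C + (Cmod u * Cmod v) ^ 2).
Proof.
  intros Hx Hy Hu Hv E Hk.
  rewrite !k_disk_eq in Hk. apply twice_artanh_le_inv in Hk; try (apply rho_bounds; assumption).
  pose proof (one_minus_rho_sq x y Hx Hy) as H1. pose proof (one_minus_rho_sq u v Hu Hv) as H2.
  pose proof (den_neq0 x y Hx Hy) as N1. pose proof (den_neq0 u v Hu Hv) as N2.
  apply Cmod_gt_0 in N1. apply Cmod_gt_0 in N2.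
  rewrite <- E at 1. rewrite <- !den_sq.
  set (D1 := Cmod (1 - Cconj y * x)) in *. set (D2 := Cmod (1 - Cconj v * u)) in *.
  assert (Hd1 : 0 < D1 ^ 2) by nra. assert (Hd2 : 0 < D2 ^ 2) by nra.
  assert (Hr : 1 - rho u v ^ 2 <= 1 - rho x y ^ 2).
  { pose proof (rho_bounds x y Hx Hy). nra. }
  rewrite H1, H2, E in Hr.
  apply (Rmult_le_compat_r (D1 ^ 2 * D2 ^ 2)) in Hr; [|nra].
  replace ((1 - Cmod v ^ 2) * (1 - Cmod u ^ 2) / D2 ^ 2 * (D1 ^ 2 * D2 ^ 2))
    with ((1 - Cmod v ^ 2) * ((1 - Cmod u ^ 2) * D1 ^ 2)) in Hr by (field; lra).
  replace ((1 - Cmod v ^ 2) * (1 - Cmod x ^ 2) / D1 ^ 2 * (D1 ^ 2 * D2 ^ 2))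
    with ((1 - Cmod v ^ 2) * ((1 - Cmod x ^ 2) * D2 ^ 2)) in Hr by (field; lra).
  apply Rmult_le_reg_l in Hr; [exact Hr|].
  unfold unit_disk in Hv. pose proof (Cmod_ge_0 v). nra.
Qed.

Lemma Re_scal_l (t : R) (z w : C) : Re (Cconj z * (t * w))%C = t * Re (Cconj z * w)%C.
Proof. destruct z, w; unfold Re; simpl; ring. Qed.

Lemma abs_lt1_disk (t : R) : Rabs t < 1 -> unit_disk t.
Proof. unfold unit_disk. rewrite Cmod_R. auto. Qed.

(** The assumption is the inequality [k t p' <= k (t g(t)) q], cleared of
    denominators, where [|p'| = |q|] and [P = Re p']. Adding it for [t] and [- t]
    cancels the terms of first order except [Re (conj(q) (g t - g (- t)))], which
    the Schwarz-Pick lemma bounds by [2 t |q| (1 - |a|^2)] up to [o(t)], where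
    [a = g 0]. In the limit, [(1 - |a|^2) (1 - |q|)^2 <= 0]. *)
Lemma second_difference_rigid (g : C -> C) (q : C) (P d : R) :
  unit_disk q -> 0 < d -> Rabs P <= 1 ->
  (forall z, unit_disk z -> Cmod (g z) <= 1) -> (forall z, unit_disk z -> ctsC g z) ->
  (forall z, unit_disk z -> z <> 0%C -> holo_at g z) ->
  (forall t : R, Rabs t < d -> Rabs t < 1 ->
     (1 - t ^ 2 * Cmod (g t) ^ 2) * (1 - 2 * t * P + t ^ 2 * Cmod q ^ 2) <=
     (1 - t ^ 2) * (1 - 2 * t * Re (Cconj q * g t)%C + t ^ 2 * Cmod (g t) ^ 2 * Cmod q ^ 2)) ->
  Cmod (g 0) = 1.
Proof.
  intros Hq Hd HP Hg1 Hgc Hgh H.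
  set (a := g 0). pose proof (Hg1 0%C disk_0) as Ha. fold a in Ha.
  apply Rle_antisym; [exact Ha|]. apply Rnot_lt_le. intros Hlt.
  pose proof (Cmod_ge_0 a) as Ha0. pose proof (Cmod_ge_0 q) as Hq0. unfold unit_disk in Hq.
  set (A := 1 - Cmod a ^ 2). assert (HA : 0 < A) by (unfold A; nra).
  (* The errors made below add up to at most [22 e]: [12 e] from the moduli of
     [g t] and [g (- t)], [8 e] from the Schwarz-Pick bound, and [2 t <= 2 e]. *)
  set (e := Rmin 1 (A * (1 - Cmod q) ^ 2 / 22)).
  assert (HAq : 0 < A * (1 - Cmod q) ^ 2) by (apply Rmult_lt_0_compat; nra).
  assert (He : 0 < e) by (apply Rmin_glb_lt; lra).
  pose proof (Rmin_l 1 (A * (1 - Cmod q) ^ 2 / 22)) as He1. fold e in He1.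
  pose proof (Rmin_r 1 (A * (1 - Cmod q) ^ 2 / 22)) as He2. fold e in He2. clearbody e.
  destruct (proj1 (continuous_C_eps g 0%C) (Hgc 0%C disk_0) e He) as [d' [Hd' Hc]].
  set (t := Rmin (Rmin d d') e / 2).
  assert (Ht : 0 < t /\ t < d /\ t < d' /\ t < e).
  { assert (0 < Rmin (Rmin d d') e) by (repeat apply Rmin_glb_lt; assumption).
    pose proof (Rmin_l (Rmin d d') e). pose proof (Rmin_r (Rmin d d') e).
    pose proof (Rmin_l d d'). pose proof (Rmin_r d d'). unfold t. lra. }
  clearbody t. destruct Ht as (Ht0 & Htd & Htd' & Hte).
  assert (Dp : unit_disk t) by (apply abs_lt1_disk, Rabs_def1; lra).
  assert (Dm : unit_disk (- t)%R) by (apply abs_lt1_disk, Rabs_def1; lra).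
  pose proof (H t ltac:(apply Rabs_def1; lra) ltac:(apply Rabs_def1; lra)) as Hp.
  pose proof (H (- t) ltac:(apply Rabs_def1; lra) ltac:(apply Rabs_def1; lra)) as Hm.
  clear H.
  pose proof (Hc t) as Cp. pose proof (Hc (RtoC (- t))) as Cm. clear Hc.
  replace (t - 0)%C with (RtoC t) in Cp by ring. replace (RtoC (- t) - 0)%C with (RtoC (- t)) in Cm by ring.
  rewrite Cmod_R in Cp, Cm. specialize (Cp ltac:(apply Rabs_def1; lra)).
  specialize (Cm ltac:(apply Rabs_def1; lra)). fold a in Cp, Cm.
  pose proof (schwarz_pick g 0%C disk_0 Hg1 Hgc Hgh (RtoC (- t)) t Dm Dp) as SP.
  pose proof (Hg1 _ Dp) as Bp. pose proof (Hg1 _ Dm) as Bm.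
  set (gp := g t) in *. set (gm := g (RtoC (- t))) in *.
  assert (Hne : RtoC (- t) <> 0%C) by (intros E; apply RtoC_inj in E; lra).
  specialize (SP Hne). clear Hne.
  assert (E1 : (1 - Cconj (RtoC (- t)) * t)%C = RtoC (1 + t ^ 2)).
  { apply injective_projections; simpl; ring. }
  assert (E2 : (t - RtoC (- t))%C = RtoC (2 * t)) by (apply injective_projections; simpl; ring).
  rewrite E1, E2, !Cmod_R, !Rabs_pos_eq in SP by nra.
  assert (HK : Cmod (1 - Cconj gm * gp) <= A + 2 * e).
  { assert (E : (1 - Cconj gm * gp)%C = (RtoC A + (- (Cconj gm * (gp - a)) - a * Cconj (gm - a)))%C).
    { unfold A. rewrite Cmod_sqr. destruct gm, gp, a.
      apply injective_projections; unfold Re, Im; simpl; ring. }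
    rewrite E. eapply Rle_trans; [apply Cmod_triangle|]. rewrite Cmod_R, Rabs_pos_eq by lra.
    apply Rplus_le_compat_l. unfold Cminus. eapply Rle_trans; [apply Cmod_triangle|].
    rewrite !Cmod_opp, !Cmod_mult, !Cmod_conj. fold (gp - a)%C. fold (gm - a)%C.
    pose proof (Cmod_ge_0 (gp - a)). pose proof (Cmod_ge_0 (gm - a)). pose proof (Cmod_ge_0 gm). nra. }
  assert (Hsq : forall u, Cmod (u - a) < e -> Cmod u ^ 2 <= 1 - A + 3 * e).
  { intros u Hu. pose proof (Cmod_triangle a (u - a)) as T.
    replace (a + (u - a))%C with u in T by ring. pose proof (Cmod_ge_0 u).
    assert (Cmod u ^ 2 <= (Cmod a + e) ^ 2) by (apply pow_incr; lra).
    unfold A. nra. }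
  pose proof (Hsq gp Cp) as Sp. pose proof (Hsq gm Cm) as Sm.
  assert (Hb : - (Cmod q * Cmod (gp - gm)) <= Re (Cconj q * gp)%C - Re (Cconj q * gm)%C).
  { pose proof (Re_Cconj_mult_ge (gp - gm) q) as Hb. rewrite Rmult_comm in Hb.
    replace (Re (Cconj q * gp) - Re (Cconj q * gm)) with (Re (Cconj q * (gp - gm)))%C; [exact Hb|].
    destruct q, gp, gm; unfold Re; simpl; ring. }
  assert (Qp : 0 <= Cmod gp ^ 2 <= 1) by (pose proof (Cmod_ge_0 gp); nra).
  assert (Qm : 0 <= Cmod gm ^ 2 <= 1) by (pose proof (Cmod_ge_0 gm); nra).
  pose proof (Cmod_ge_0 (gp - gm)) as W0.
  revert Hp Hm SP HK Sp Sm Hb Qp Qm W0. generalize (Cmod gp ^ 2) as sp, (Cmod gm ^ 2) as sm,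
    (Re (Cconj q * gp)) as bp, (Re (Cconj q * gm)) as bm, (Cmod (gp - gm)) as W,
    (Cmod (1 - Cconj gm * gp)) as K.
  revert HP Hq Hq0 HA He1 He2 Ht0 Hte HAq. generalize (Cmod q) as r. generalize A as A'. clear.
  intros A r HP Hr Hr0 HA He1 He2 Ht0 Hte HAq sp sm bp bm W K Hp Hm SP HK Sp Sm Hb Qp Qm W0.
  apply Rabs_le_between in HP.
  assert (Sum : 2 * t * (1 - t ^ 2) * (bp - bm) + 2 * t ^ 3 * P * (sp - sm)
     <= (1 + r ^ 2) * t ^ 2 * (sp + sm - 2)).
  { nra. }
  assert (Wle : W <= 2 * t * (A + 2 * e)) by nra.
  assert (Hb' : - (r * (2 * t * (A + 2 * e))) <= bp - bm) by nra.
  assert (T2 : 0 <= 1 - t ^ 2 <= 1) by nra.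
  assert (X1 : - (4 * t ^ 2 * r * (A + 2 * e)) <= 2 * t * (1 - t ^ 2) * (bp - bm)).
  { assert (0 <= r * (2 * t * (A + 2 * e))).
    { apply Rmult_le_pos; [lra|]. apply Rmult_le_pos; lra. }
    assert (- (r * (2 * t * (A + 2 * e))) <= (1 - t ^ 2) * (bp - bm)) by nra.
    nra. }
  assert (X2 : - (2 * t ^ 3) <= 2 * t ^ 3 * P * (sp - sm)).
  { assert (0 < t ^ 3) by (apply pow_lt; lra). assert (-1 <= P * (sp - sm)) by nra. nra. }
  assert (X3 : (1 + r ^ 2) * (sp + sm - 2) <= (1 + r ^ 2) * (- 2 * A + 6 * e)).
  { apply Rmult_le_compat_l; nra. }
  assert (X4 : t ^ 2 * (- (4 * r * (A + 2 * e)) - 2 * t) <= t ^ 2 * ((1 + r ^ 2) * (- 2 * A + 6 * e))) by nra.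
  apply Rmult_le_reg_l in X4; [|nra].
  assert (e * r <= e) by nra. assert (e * r ^ 2 <= e) by nra. lra.
Qed.

Lemma unimodular_mult_conj (u : C) : Cmod u = 1 -> (u * Cconj u)%C = RtoC 1.
Proof. intros Hu. rewrite <- Cmod2_conj, Hu. simpl. rewrite !Rmult_1_l. reflexivity. Qed.

(** For [|g 0| = 1] the Schwarz-Pick inequality between 0 and [z] reads
    [|g 0 - g z| <= |z| |g 0 - g z|]. *)
Lemma rotation_of_unimodular (g : C -> C) :
  (forall z, unit_disk z -> Cmod (g z) <= 1) -> (forall z, unit_disk z -> ctsC g z) ->
  (forall z, unit_disk z -> z <> 0%C -> holo_at g z) -> Cmod (g 0) = 1 ->
  forall z, unit_disk z -> g z = g 0.
Proof.
  intros Hg1 Hgc Hgh Ha z Hz. destruct (classic (z = 0%C)) as [->|Hz0]; [reflexivity|].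
  pose proof (schwarz_pick g 0%C disk_0 Hg1 Hgc Hgh z 0%C Hz disk_0 Hz0) as H.
  replace (1 - Cconj z * 0)%C with (RtoC 1) in H by ring.
  replace (0 - z)%C with (- z)%C in H by ring. rewrite Cmod_1, Cmod_opp, Rmult_1_r in H.
  assert (E : Cmod (1 - Cconj (g z) * g 0) = Cmod (g 0 - g z)%C).
  { transitivity (Cmod (g 0 - g z) * Cmod (g 0)); [|rewrite Ha; ring].
    rewrite <- (Cmod_conj (g 0 - g z)), <- Cmod_mult. f_equal.
    assert (E1 : (g 0 * Cconj (g 0))%C = RtoC 1) by (apply unimodular_mult_conj, Ha).
    rewrite Cminus_conj, <- E1. ring. }
  rewrite E in H. pose proof (Cmod_ge_0 (g 0 - g z)) as H0. unfold unit_disk in Hz.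
  assert (H1 : Cmod (g 0 - g z) = 0) by nra. apply Cmod_eq_0 in H1.
  replace (g z) with (g 0 - (g 0 - g z))%C by ring. rewrite H1. ring.
Qed.

Lemma k_rotation (a z w : C) : Cmod a = 1 -> k_disk (a * z) (a * w) = k_disk z w.
Proof.
  intros Ha. rewrite !k_disk_eq. f_equal. unfold rho.
  assert (E1 : (Cconj a * a)%C = RtoC 1).
  { rewrite Cmult_comm. apply unimodular_mult_conj, Ha. }
  replace (1 - Cconj (a * w) * (a * z))%C with (1 - Cconj w * z)%C.
  - replace (a * z - a * w)%C with (a * (z - w))%C by ring. unfold Cdiv.
    rewrite !Cmod_mult, Ha. ring.
  - rewrite Cmult_conj. replace (Cconj a * Cconj w * (a * z))%C with ((Cconj a * a) * (Cconj w * z))%C by ring.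
    rewrite E1. ring.
Qed.

(** The point [s p'] lies between 0 and [p'] on a diameter. If it also lies
    between [t] and [p'] on a geodesic, both geodesics coincide; so the real
    point [t] is on that diameter, which is therefore real. *)
Lemma collinear_of_triangle_eq (p' : C) (s t : R) :
  unit_disk p' -> unit_disk t -> 0 < s < 1 -> t <> 0 ->
  k_disk t p' = k_disk t (s * p')%C + k_disk p' (s * p')%C -> Im p' = 0.
Proof.
  intros Hp Ht Hs Ht0 H.
  assert (Hsp : unit_disk (s * p')%C) by (apply scaled_disk; [lra|exact Hp]).
  apply k_triangle_eq in H; try assumption.
  set (X := mob (- (s * p')) t) in *.
  assert (EB : exists l : R, 0 < l /\ mob (- (s * p')) p' = (l * p')%C).
  { exists ((1 - s) / (1 - s * Cmod p' ^ 2)).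
    assert (Hd : 0 < 1 - s * Cmod p' ^ 2) by (unfold unit_disk in Hp; pose proof (Cmod_ge_0 p'); nra).
    split; [apply Rdiv_lt_0_compat; lra|]. unfold mob.
    assert (E1 : (1 + Cconj (- (s * p')) * p')%C = RtoC (1 - s * Cmod p' ^ 2)).
    { rewrite Cmod_sqr. destruct p'; apply injective_projections; unfold Re, Im; simpl; ring. }
    rewrite E1, RtoC_div by lra. assert (RtoC (1 - s * Cmod p' ^ 2) <> 0%C) by (intros E; apply RtoC_inj in E; lra).
    rewrite (RtoC_minus 1 s). field. assumption. }
  destruct EB as [l [Hl EB]]. rewrite EB in H.
  rewrite Cmod_mult, Cmod_R, Rabs_pos_eq in H by lra.
  assert (H1 : Re (Cconj p' * X)%C = - (Cmod X * Cmod p')).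
  { apply (Rmult_eq_reg_l l); [|lra]. 
    transitivity (Re (Cconj (l * p') * X)%C); [destruct p', X; unfold Re; simpl; ring|].
    rewrite H. ring. }
  assert (H2 : Im (Cconj p' * X)%C = 0).
  { pose proof (Cmod_sqr (Cconj p' * X)%C) as E. rewrite H1, Cmod_mult, Cmod_conj in E. nra. }
  pose proof (mob_den (- (s * p')) t (disk_opp _ Hsp) (Rlt_le _ _ Ht)) as Hn.
  assert (H3 : (Cconj p' * (t - s * p') * Cconj (1 - s * Cconj p' * t))%C =
    (Cconj p' * X * RtoC (Cmod (1 - s * Cconj p' * t) ^ 2))%C).
  { assert (En : (1 + Cconj (- (s * p')) * t)%C = (1 - s * Cconj p' * t)%C).
    { destruct p'; apply injective_projections; simpl; ring. }
    unfold X, mob. rewrite En in *. rewrite Cmod2_conj.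
    clear En. revert Hn. generalize (1 - s * Cconj p' * t)%C. intros u Hu.
    field. exact Hu. }
  apply (f_equal Im) in H3.
  assert (H4 : Im (Cconj p' * X * RtoC (Cmod (1 - s * Cconj p' * t) ^ 2))%C = 0).
  { transitivity (Im (Cconj p' * X)%C * Cmod (1 - s * Cconj p' * t) ^ 2).
    - generalize (Cconj p' * X)%C as u, (Cmod (1 - s * Cconj p' * t) ^ 2) as v.
      intros [u1 u2] v. unfold Im; simpl. ring.
    - rewrite H2. ring. }
  rewrite H4 in H3. clear -H3 Hp Hs Ht0.
  assert (E : Im (Cconj p' * (t - s * p') * Cconj (1 - s * Cconj p' * t))%C
     = t * Im p' * (s ^ 2 * Cmod p' ^ 2 - 1)).
  { rewrite Cmod_sqr. destruct p'; unfold Re, Im; simpl; ring. }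
  rewrite E in H3.
  assert (s ^ 2 * Cmod p' ^ 2 < 1).
  { unfold unit_disk in Hp. pose proof (Cmod_ge_0 p'). assert (Cmod p' ^ 2 < 1) by nra. nra. }
  apply Rmult_integral in H3. destruct H3 as [H3|H3]; [|lra].
  apply Rmult_integral in H3. destruct H3; [contradiction|assumption].
Qed.

(** Move [p] outwards by the distance [m], to [p']: then [k 0 p' = k 0 q], while
    [k t p' <= k t p + m <= k (F t) q]. The second difference of the outer terms
    at 0 forces [F] to be a rotation [z |-> a z]. Comparing at [t] and [- t], the
    points [p'] and [q / a] have the same real part, besides the same modulus;
    so the outer terms agree and the middle one is squeezed. Hence [p'] is real
    and equal to [q / a], and [k (F p) q = k p p' = m]. *)
Lemma no_local_max_at_0 (F : C -> C) (p q : C) (m d : R) :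
  (forall z, unit_disk z -> holo_at F z) -> (forall z, unit_disk z -> unit_disk (F z)) ->
  F 0 = 0%C -> unit_disk p -> unit_disk q -> 0 < m -> 0 < d ->
  k_disk 0 q = k_disk 0 p + m ->
  (forall t : R, Rabs t < d -> Rabs t < 1 -> k_disk t p + m <= k_disk (F t) q) ->
  m < k_disk (F p) q -> False.
Proof.
  intros Hh Hd F0 Dp Dq Hm Hdp E0 H HFp.
  destruct (classic (p = 0%C)) as [->|Hp0].
  { rewrite F0, E0, k_self in HFp. lra. }
  rewrite (k_sym 0 q), (k_sym 0 p), !k_0_r in E0.
  assert (Hpq : 0 < Cmod p < Cmod q).
  { split; [apply Cmod_gt_0; exact Hp0|]. apply Rnot_le_lt. intros Hle.
    pose proof (twice_artanh_le _ _ (Cmod_ge_0 q) Hle Dp). lra. }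
  (* The point [p'] on the ray through [p] with [|p'| = |q|], and [p = s p']. *)
  set (s := Cmod p / Cmod q).
  assert (Hs : 0 < s < 1).
  { unfold s. split; [apply Rdiv_lt_0_compat; lra|].
    apply (Rmult_lt_reg_r (Cmod q)); [lra|]. unfold Rdiv. rewrite Rmult_assoc, Rinv_l; lra. }
  set (p' := ((/ s)%R * p)%C).
  assert (Ep : p = (s * p')%C).
  { unfold p'. rewrite RtoC_inv by lra. field. intros E. apply RtoC_inj in E. lra. }
  assert (Ep' : Cmod p' = Cmod q).
  { unfold p'. rewrite Cmod_mult, Cmod_R, Rabs_pos_eq by (left; apply Rinv_0_lt_compat; lra).
    unfold s. field. lra. }
  assert (Dp' : unit_disk p') by (unfold unit_disk; rewrite Ep'; exact Dq).
  assert (Ek : k_disk p' p = m).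
  { rewrite Ep, k_radial, <- Ep, !k_0_r, Ep' by (try exact Dp'; lra). lra. }
  clearbody p'. clearbody s.
  destruct (schwarz_quotient F 0%C disk_0 F0) as [g [Hg0 [Hg1 [Hgc Hgh]]]].
  { intros; apply Rlt_le, Hd; assumption. }
  { intros; apply holo_at_continuous, Hh; assumption. }
  { apply Hh, disk_0. }
  { intros; apply Hh; assumption. }
  assert (Hgh' : forall z, unit_disk z -> z <> 0%C -> holo_at g z) by (intros; apply Hgh; assumption).
  clear Hgh. set (P := Re p').
  assert (Hcmp : forall t : R, Rabs t < d -> Rabs t < 1 ->
     (1 - t ^ 2 * Cmod (g t) ^ 2) * (1 - 2 * t * P + t ^ 2 * Cmod q ^ 2) <=
     (1 - t ^ 2) * (1 - 2 * t * Re (Cconj q * g t)%C + t ^ 2 * Cmod (g t) ^ 2 * Cmod q ^ 2)).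
  { intros t Ht Ht1. pose proof (abs_lt1_disk t Ht1) as Dt.
    assert (Hk : k_disk t p' <= k_disk (F t) q).
    { eapply Rle_trans; [apply (k_triangle t p' p)|]; try assumption. rewrite Ek. apply H; assumption. }
    apply k_le_cross in Hk; auto.
    rewrite (Hg0 _ Dt), Re_scal_l, !Cmod_mult, Cmod_R in Hk.
    assert (Ha : Rabs t ^ 2 = t ^ 2) by (rewrite RPow_abs, Rabs_pos_eq; nra).
    assert (HP : Re (Cconj p' * t)%C = t * P) by (unfold P; destruct p'; unfold Re; simpl; ring).
    rewrite HP, !Rpow_mult_distr, Ha in Hk. lra. }
  assert (HP1 : Rabs P <= 1).
  { eapply Rle_trans; [apply re_le_Cmod|]. apply Rlt_le, Dp'. }
  pose proof (second_difference_rigid g q P d Dq Hdp HP1 Hg1 Hgc Hgh' Hcmp) as Ha.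
  pose proof (rotation_of_unimodular g Hg1 Hgc Hgh' Ha) as Hrot.
  set (a := g 0) in *.
  assert (HF : forall z, unit_disk z -> F z = (a * z)%C).
  { intros z Hz. rewrite (Hg0 z Hz), (Hrot z Hz). ring. }
  set (t := Rmin d 1 / 2).
  assert (Ht : 0 < t /\ t < d /\ t < 1).
  { assert (0 < Rmin d 1) by (apply Rmin_glb_lt; lra).
    pose proof (Rmin_l d 1). pose proof (Rmin_r d 1). unfold t. lra. }
  clearbody t.
  assert (Rp : Rabs t < d /\ Rabs t < 1) by (split; apply Rabs_def1; lra).
  assert (Rm : Rabs (- t) < d /\ Rabs (- t) < 1) by (split; apply Rabs_def1; lra).
  pose proof (Hcmp t (proj1 Rp) (proj2 Rp)) as Hp.
  pose proof (Hcmp (- t) (proj1 Rm) (proj2 Rm)) as Hm'.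
  pose proof (abs_lt1_disk t (proj2 Rp)) as Dt.
  pose proof (abs_lt1_disk (- t) (proj2 Rm)) as Dmt.
  rewrite (Hrot _ Dt), Ha in Hp. rewrite (Hrot _ Dmt), Ha in Hm'.
  assert (Eb : Re (Cconj q * a)%C = P).
  { assert (0 < (1 - t ^ 2) * t) by (apply Rmult_lt_0_compat; nra). nra. }
  assert (Da : unit_disk (Cconj a * q)%C).
  { unfold unit_disk. rewrite Cmod_mult, Cmod_conj, Ha, Rmult_1_l. exact Dq. }
  assert (Eaa : (a * Cconj a)%C = RtoC 1) by (apply unimodular_mult_conj, Ha).
  assert (EF : forall z, unit_disk z -> k_disk (F z) q = k_disk z (Cconj a * q)).
  { intros z Hz. rewrite (HF z Hz). rewrite <- (k_rotation a z (Cconj a * q) Ha). f_equal.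
    rewrite Cmult_assoc, Eaa. ring. }
  assert (Eq' : Re (Cconj a * q)%C = P).
  { rewrite <- Eb. destruct a, q; unfold Re; simpl; ring. }
  assert (Em' : Cmod (Cconj a * q) = Cmod p') by (rewrite Cmod_mult, Cmod_conj, Ha, Ep'; ring).
  assert (Ekt : k_disk t p' = k_disk t (Cconj a * q)).
  { rewrite !k_disk_eq. f_equal. unfold rho.
    rewrite !Cmod_div by (apply den_neq0; assumption).
    assert (S1 : Cmod (1 - Cconj p' * t) ^ 2 = Cmod (1 - Cconj (Cconj a * q) * t) ^ 2).
    { rewrite !den_sq, Em'. do 2 f_equal. f_equal.
      unfold P in Eq'. revert Eq'. generalize (Cconj a * q)%C. intros [u1 u2]. destruct p'.
      unfold Re; simpl. intros ->. ring. }
    assert (S2 : Cmod (t - p') ^ 2 = Cmod (t - Cconj a * q) ^ 2).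
    { pose proof (Cmod_sqr p') as M1. pose proof (Cmod_sqr (Cconj a * q)) as M2.
      rewrite Em', M1 in M2. rewrite !Cmod_sqr. unfold P in Eq'.
      revert Eq' M2. generalize (Cconj a * q)%C. intros [u1 u2]. destruct p' as [v1 v2].
      unfold Re, Im; simpl. intros -> M2. nra. }
    assert (Q : forall x y : C, Cmod x ^ 2 = Cmod y ^ 2 -> Cmod x = Cmod y).
    { intros x y Hxy. pose proof (Cmod_ge_0 x). pose proof (Cmod_ge_0 y). nra. }
    rewrite (Q _ _ S1), (Q _ _ S2). reflexivity. }
  assert (Im0 : Im p' = 0).
  { apply (collinear_of_triangle_eq p' s t); try assumption; [lra|].
    rewrite <- Ep. apply Rle_antisym; [apply k_triangle; assumption|].
    rewrite Ek, Ekt, <- EF by exact Dt. apply H; apply Rp. }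
  assert (Epq : p' = (Cconj a * q)%C).
  { pose proof (Cmod_sqr p') as M1. pose proof (Cmod_sqr (Cconj a * q)) as M2.
    rewrite Em', M1, Im0 in M2. unfold P in Eq'.
    revert Eq' M2 Im0. generalize (Cconj a * q)%C. intros [u1 u2]. destruct p' as [v1 v2].
    unfold Re, Im; simpl. intros -> M2 ->. f_equal. nra. }
  rewrite (EF p Dp), <- Epq, k_sym, Ek in HFp. lra.
Qed.

(** * Geodesic segments *)

(** The geodesic segment from [z1] to [z2], as the image of a Euclidean segment
    that issues from 0. The parameter is not proportional to arc length. *)
Definition seg (z1 z2 : C) (t : R) : C := mob z1 (t * mob (- z1) z2).

Lemma seg_disk (z1 z2 : C) (t : R) :
  unit_disk z1 -> unit_disk z2 -> 0 <= t <= 1 -> unit_disk (seg z1 z2 t).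
Proof.
  intros H1 H2 Ht. apply mob_disk; [exact H1|]. apply scaled_disk; [exact Ht|].
  apply mob_opp_disk; assumption.
Qed.

Lemma seg_0 (z1 z2 : C) : seg z1 z2 0 = z1.
Proof. unfold seg. replace (0 * mob (- z1) z2)%C with (RtoC 0) by ring. apply mob_0. Qed.

Lemma seg_1 (z1 z2 : C) : unit_disk z1 -> unit_disk z2 -> seg z1 z2 1 = z2.
Proof. intros H1 H2. unfold seg. rewrite Cmult_1_l. apply mob_cancel'; assumption. Qed.

Lemma seg_self (z : C) (t : R) : seg z z t = z.
Proof. unfold seg. rewrite mob_opp_self. replace (t * 0)%C with (RtoC 0) by ring. apply mob_0. Qed.

Lemma k_seg (z1 z2 : C) (t : R) : unit_disk z1 -> unit_disk z2 -> 0 <= t <= 1 ->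
  k_disk z2 (seg z1 z2 t) = k_disk z2 z1 - k_disk (seg z1 z2 t) z1.
Proof.
  intros H1 H2 Ht.
  assert (Hw : unit_disk (mob (- z1) z2)) by (apply mob_opp_disk; assumption).
  pose proof (scaled_disk t _ Ht Hw) as Htw.
  pose proof (k_radial t _ Ht Hw) as E.
  rewrite <- (k_mob z1 _ _ H1 Hw Htw), <- (k_mob z1 _ _ H1 Hw disk_0), <- (k_mob z1 _ _ H1 Htw disk_0) in E.
  rewrite mob_0, mob_cancel' in E by assumption. exact E.
Qed.

Lemma continuous_mob {U : UniformSpace} (f g : U -> C) (u : U) :
  ctsC f u -> ctsC g u -> unit_disk (f u) -> unit_disk (g u) ->
  ctsC (fun v => mob (f v) (g v)) u.
Proof.
  intros Hf Hg Df Dg. pose proof (mob_den _ _ Df (Rlt_le _ _ Dg)) as Hn. unfold mob. cts.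
Qed.

Lemma continuous_seg {U : UniformSpace} (f g : U -> C) (h : U -> R) (u : U) :
  ctsC f u -> ctsC g u -> continuous h u -> unit_disk (f u) -> unit_disk (g u) -> 0 <= h u <= 1 ->
  ctsC (fun v => seg (f v) (g v) (h v)) u.
Proof.
  intros Hf Hg Hh Df Dg Ht.
  assert (Dw : unit_disk (mob (- f u) (g u))) by (apply mob_opp_disk; assumption).
  assert (Hm : ctsC (fun v => mob (- f v) (g v)) u).
  { apply (continuous_mob (fun v => - f v)%C g); try assumption; [cts|apply disk_opp; exact Df]. }
  apply (continuous_mob f (fun v => h v * mob (- f v) (g v))%C); try assumption.
  - cts.
  - apply scaled_disk; assumption.
Qed.

(** * Hyperbolic geodesics *)

(** This is the theorem of Pythagoras for the two centres and a common point. *)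
Lemma orthogonal_to_unit_circle (c : C) (r : R) :
  0 < r -> Cmod c ^ 2 = 1 + r ^ 2 -> orthogonal_circles 0 1 c r.
Proof.
  intros Hr Hc. pose proof Hc as Hc'. rewrite Cmod_sqr in Hc'.
  assert (Hcr : Cmod c ^ 2 <> 0) by nra.
  assert (Hs : forall x y : C, Cmod x ^ 2 = Cmod y ^ 2 -> Cmod x = Cmod y).
  { intros x y H. pose proof (Cmod_ge_0 x). pose proof (Cmod_ge_0 y). nra. }
  split.
  - (* The point of contact [c (1 + i r) / |c|^2] of a tangent from [c]. *)
    exists ((Re c - r * Im c) / (1 + r ^ 2), (Im c + r * Re c) / (1 + r ^ 2)).
    assert (Hn : 1 + r ^ 2 <> 0) by nra.
    unfold circle. split.
    + transitivity (Cmod 1); [apply Hs|apply Cmod_1]. rewrite !Cmod_sqr. unfold Re, Im in *; simpl in *.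
      transitivity ((fst c * fst c + snd c * snd c) / (1 + r ^ 2)); [field; nra|].
      rewrite Hc'. field. exact Hn.
    + transitivity (Cmod r); [apply Hs|rewrite Cmod_R; apply Rabs_pos_eq; lra]. rewrite !Cmod_sqr.
      unfold Re, Im in *; simpl in *.
      transitivity (r ^ 2 * (fst c * fst c + snd c * snd c) / (1 + r ^ 2)); [field; nra|].
      rewrite Hc'. field. exact Hn.
  - unfold circle. intros p H1 H2.
    assert (Q1 : Cmod (p - 0) ^ 2 = 1) by (rewrite H1; ring).
    assert (Q2 : Cmod (p - c) ^ 2 = r ^ 2) by (rewrite H2; ring).
    rewrite Cmod_sqr in Q1, Q2. destruct p, c. unfold Re, Im in *; simpl in *. nra.
Qed.

(** The centre [c] of a circle orthogonal to the unit circle satisfies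
    [2 Re (conj(c) z) = 1 + |z|^2] for [z] on the circle. Along the curve
    [z = mob a s] this amounts to two linear equations for [c], which are
    independent if [Im a <> 0]. *)
Lemma mob_real_axis_circle (a : C) : unit_disk a -> Im a <> 0 ->
  exists c r, 0 < r /\ Cmod c ^ 2 = 1 + r ^ 2 /\
    forall s : R, Rabs s < 1 -> circle c r (mob a s).
Proof.
  intros Ha Hy. pose proof (Cmod_sqr a) as Ha2. unfold unit_disk in Ha. pose proof (Cmod_ge_0 a) as Ha0.
  assert (HA : Re a * Re a + Im a * Im a < 1) by (rewrite <- Ha2; nra).
  set (x := Re a) in *. set (y := Im a) in *.
  exists (x, (1 - x ^ 2 + y ^ 2) / (2 * y)), ((1 - x ^ 2 - y ^ 2) / (2 * Rabs y)).
  pose proof (Rabs_pos_lt y Hy) as Hay.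
  assert (Hr2 : ((1 - x ^ 2 - y ^ 2) / (2 * Rabs y)) ^ 2 = (1 - x ^ 2 - y ^ 2) ^ 2 / (4 * y ^ 2)).
  { assert (E : Rabs y ^ 2 = y ^ 2) by (rewrite RPow_abs, Rabs_pos_eq; nra).
    rewrite <- E. field. lra. }
  assert (Hr : 0 < (1 - x ^ 2 - y ^ 2) / (2 * Rabs y)) by (apply Rdiv_lt_0_compat; lra).
  split; [exact Hr|]. split.
  - rewrite Hr2, Cmod_sqr. unfold Re, Im; simpl. field. exact Hy.
  - intros s Hs.
    pose proof (mob_den a s Ha) as Hn. rewrite Cmod_R in Hn. specialize (Hn (Rlt_le _ _ Hs)).
    unfold circle.
    set (c := (x, (1 - x ^ 2 + y ^ 2) / (2 * y)) : C) in *.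
    set (r := (1 - x ^ 2 - y ^ 2) / (2 * Rabs y)) in *.
    assert (E : (mob a s - c)%C = ((s + a - c * (1 + Cconj a * s)) / (1 + Cconj a * s))%C).
    { unfold mob. field. exact Hn. }
    rewrite E, Cmod_div by exact Hn. apply Cmod_gt_0 in Hn.
    assert (Hsq : Cmod (s + a - c * (1 + Cconj a * s)) ^ 2 = (r * Cmod (1 + Cconj a * s)) ^ 2).
    { rewrite Rpow_mult_distr, Hr2, !Cmod_sqr. unfold c.
      replace a with ((x, y) : C) by (symmetry; apply surjective_pairing).
      unfold Re, Im; simpl. field. exact Hy. }
    assert (Heq : Cmod (s + a - c * (1 + Cconj a * s)) = r * Cmod (1 + Cconj a * s)).
    { apply Rsqr_inj; [apply Cmod_ge_0|apply Rmult_le_pos; lra|]. rewrite !Rsqr_pow2. exact Hsq. }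
    rewrite Heq. field. lra.
Qed.

(** A rotation turns [u] into 1. The curve is a piece of a diameter if [a] is on
    the line through 0 and [u], and of an orthogonal circle otherwise. *)
Lemma mob_line_in_geodesic (a u : C) : unit_disk a -> Cmod u = 1 ->
  exists G, hgeodesic G /\ forall s : R, Rabs s < 1 -> G (mob a (s * u)).
Proof.
  intros Ha Hu.
  assert (Euu : (u * Cconj u)%C = RtoC 1) by (apply unimodular_mult_conj, Hu).
  set (b := (a * Cconj u)%C).
  assert (Eb : a = (b * u)%C).
  { unfold b. replace (a * Cconj u * u)%C with (a * (u * Cconj u))%C by ring. rewrite Euu. ring. }
  assert (Hb : unit_disk b).
  { unfold b, unit_disk. rewrite Cmod_mult, Cmod_conj, Hu, Rmult_1_r. exact Ha. }
  assert (Em : forall s : R, mob a (s * u) = (mob b s * u)%C).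
  { intros s. unfold mob. rewrite Eb at 2. rewrite Cmult_conj.
    replace (Cconj b * Cconj u * (s * u))%C with (Cconj b * s * (u * Cconj u))%C by ring.
    rewrite Euu, Eb. replace (Cconj b * s * 1)%C with (Cconj b * s)%C by ring. unfold Cdiv. ring. }
  destruct (Req_dec (Im b) 0) as [Hi|Hi].
  - exists (fun z => exists t : R, -1 < t < 1 /\ z = (t * u)%C). split.
    + left. exists u. split; [exact Hu|]. intros z; reflexivity.
    + assert (Ebr : exists x : R, b = RtoC x).
      { exists (Re b). apply injective_projections; [reflexivity|exact Hi]. }
      destruct Ebr as [x Ebr]. rewrite Ebr in Hb. unfold unit_disk in Hb. rewrite Cmod_R in Hb.
      intros s Hs.
      assert (Hsd : unit_disk (mob b s)).
      { rewrite Ebr. apply mob_disk; apply abs_lt1_disk; assumption. }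
      exists ((s + x) / (1 + x * s)).
      assert (Hd : 0 < 1 + x * s) by (apply Rabs_def2 in Hb; apply Rabs_def2 in Hs; nra).
      assert (E : mob b s = RtoC ((s + x) / (1 + x * s))).
      { unfold mob. rewrite Ebr, RtoC_div by lra. rewrite !RtoC_plus, RtoC_mult. do 3 f_equal.
        apply injective_projections; simpl; ring. }
      rewrite E in Hsd. unfold unit_disk in Hsd. rewrite Cmod_R in Hsd. apply Rabs_def2 in Hsd.
      split; [lra|]. rewrite Em, E. reflexivity.
  - destruct (mob_real_axis_circle b Hb Hi) as [c [r [Hr [Hc H]]]].
    exists (fun z => unit_disk z /\ circle (c * u) r z). split.
    + right. exists (c * u)%C, r. split; [exact Hr|]. split; [|intros z; reflexivity].
      apply orthogonal_to_unit_circle; [exact Hr|]. rewrite Cmod_mult, Hu, Rmult_1_r. exact Hc.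
    + intros s Hs. split.
      * apply mob_disk; [exact Ha|]. unfold unit_disk. rewrite Cmod_mult, Cmod_R, Hu. lra.
      * rewrite Em. unfold circle. replace (mob b s * u - c * u)%C with ((mob b s - c) * u)%C by ring.
        rewrite Cmod_mult, Hu, Rmult_1_r. apply H. exact Hs.
Qed.

Lemma seg_in_geodesic (z1 z2 : C) : unit_disk z1 -> unit_disk z2 ->
  exists G, hgeodesic G /\ forall t, 0 <= t <= 1 -> G (seg z1 z2 t).
Proof.
  intros H1 H2. unfold seg.
  assert (Hw : unit_disk (mob (- z1) z2)) by (apply mob_opp_disk; assumption).
  set (w := mob (- z1) z2) in *. clearbody w.
  destruct (classic (w = 0%C)) as [->|Hw0].
  - destruct (mob_line_in_geodesic z1 1 H1 Cmod_1) as [G [HG H]].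
    exists G; split; [exact HG|]. intros t _.
    replace (t * 0)%C with (RtoC 0 * 1)%C by ring. apply H. rewrite Rabs_R0. lra.
  - pose proof (proj1 (Cmod_gt_0 w) Hw0) as Hr.
    destruct (mob_line_in_geodesic z1 (w / RtoC (Cmod w))%C H1) as [G [HG H]].
    { rewrite Cmod_div by (intros E; apply RtoC_inj in E; lra).
      rewrite Cmod_R, Rabs_pos_eq by lra. field. lra. }
    exists G; split; [exact HG|]. intros t Ht.
    replace (t * w)%C with (RtoC (t * Cmod w) * (w / RtoC (Cmod w)))%C.
    + apply H. unfold unit_disk in Hw. rewrite Rabs_pos_eq; nra.
    + rewrite RtoC_mult. field. intros E; apply RtoC_inj in E; lra.
Qed.

(** The points [seg z1 z2 t] form one of the connected subsets of geodesics among
    which an hsegment is the smallest. *)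
Lemma hsegment_seg (z1 z2 z : C) : unit_disk z1 -> unit_disk z2 ->
  hsegment z1 z2 z -> exists t, 0 <= t <= 1 /\ z = seg z1 z2 t.
Proof.
  intros H1 H2 H. apply (H (fun z => exists t, 0 <= t <= 1 /\ z = seg z1 z2 t)).
  - apply (path_connected _ z1). intros w [t [Ht ->]].
    exists (fun s => seg z1 z2 (s * t)). split; [|split].
    + rewrite Rmult_0_l. apply seg_0.
    + rewrite Rmult_1_l. reflexivity.
    + intros s Hs. assert (Hst : 0 <= s * t <= 1) by nra. split; [exists (s * t); split; auto|].
      apply (continuous_seg (fun _ => z1) (fun _ => z2) (fun s => s * t)); try assumption; cts.
  - destruct (seg_in_geodesic z1 z2 H1 H2) as [G [HG H']]. exists G; split; [exact HG|].
    intros w [t [Ht ->]]. apply H'; exact Ht.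
  - exists 0. split; [lra|]. symmetry; apply seg_0.
  - exists 1. split; [lra|]. symmetry; apply seg_1; assumption.
Qed.

(** The equations of a line through 0 and of a circle orthogonal to the unit
    circle are of one kind, which Moebius automorphisms preserve. *)
Lemma geodesic_equation (G : C -> Prop) : hgeodesic G ->
  exists (A : R) (c : C), ~ (A = 0 /\ c = 0%C) /\
    forall z, G z -> unit_disk z /\ A * (1 + Cmod z ^ 2) + 2 * Re (Cconj c * z)%C = 0.
Proof.
  intros [[u [Hu HG]]|[c [r [Hr [[[p [Hp1 Hp2]] Ho] HG]]]]].
  - exists 0, (Ci * u)%C. split.
    + intros [_ E]. apply (f_equal Cmod) in E. rewrite Cmod_mult, Cmod_Ci, Hu, Cmod_0 in E. lra.
    + intros z Hz. apply HG in Hz. destruct Hz as [t [Ht ->]]. split.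
      * unfold unit_disk. rewrite Cmod_mult, Cmod_R, Hu, Rmult_1_r. apply Rabs_def1; lra.
      * destruct u; unfold Re; simpl; ring.
  - exists 1, (- c)%C. split; [intros [E _]; lra|].
    pose proof (Ho p Hp1 Hp2) as Hop. unfold circle in *.
    assert (Q1 : Cmod (p - 0) ^ 2 = 1) by (rewrite Hp1; ring).
    assert (Q2 : Cmod (p - c) ^ 2 = r ^ 2) by (rewrite Hp2; ring).
    intros z Hz. apply HG in Hz. destruct Hz as [Hzd Hzc]. split; [exact Hzd|].
    assert (Q3 : Cmod (z - c) ^ 2 = r ^ 2) by (rewrite Hzc; ring).
    rewrite Cmod_sqr in *. destruct z, c, p. unfold Re, Im in *; simpl in *. nra.
Qed.

(** In the coordinate [w] centred at [z1] the equation of the geodesic has no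
    constant term, so it becomes [Re (conj(c') w) = 0], a line through 0. It is
    not trivial, since [c' = 0] would make the original equation trivial. *)
Lemma geodesic_collinear (G : C -> Prop) (z1 z2 z3 : C) :
  hgeodesic G -> G z1 -> G z2 -> G z3 ->
  Im (Cconj (mob (- z1) z2) * mob (- z1) z3)%C = 0.
Proof.
  intros HG G1 G2 G3. destruct (geodesic_equation G HG) as [A [c [Hne H]]].
  destruct (H z1 G1) as [D1 E1].
  set (c' := (2 * A * z1 + c + Cconj c * (z1 * z1))%C).
  assert (Hline : forall z, G z -> Re (Cconj c' * mob (- z1) z)%C = 0).
  { intros z Gz. destruct (H z Gz) as [Dz Ez].
    assert (Dw : unit_disk (mob (- z1) z)) by (apply mob_opp_disk; assumption).
    pose proof (mob_cancel' z1 z D1 Dz) as Ew.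
    set (w := mob (- z1) z) in *. clearbody w. rewrite <- Ew in Ez.
    pose proof (mob_den z1 w D1 (Rlt_le _ _ Dw)) as Hn.
    assert (Hm : Cmod (mob z1 w) ^ 2 * Cmod (1 + Cconj z1 * w) ^ 2 = Cmod (w + z1) ^ 2).
    { unfold mob. rewrite Cmod_div by exact Hn. pose proof (proj1 (Cmod_gt_0 _) Hn). field. lra. }
    assert (Hr : Re (Cconj c * mob z1 w)%C * Cmod (1 + Cconj z1 * w) ^ 2
      = Re (Cconj c * ((w + z1) * Cconj (1 + Cconj z1 * w)))%C).
    { transitivity (Re (Cconj c * mob z1 w * RtoC (Cmod (1 + Cconj z1 * w) ^ 2)))%C.
      - generalize (Cconj c * mob z1 w)%C as x, (Cmod (1 + Cconj z1 * w) ^ 2) as y.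
        intros [x1 x2] y. unfold Re; simpl. ring.
      - f_equal. rewrite Cmod2_conj. unfold mob. field. exact Hn. }
    apply (f_equal (fun x => x * Cmod (1 + Cconj z1 * w) ^ 2)) in Ez.
    assert (Ez' : A * (Cmod (1 + Cconj z1 * w) ^ 2 + Cmod (w + z1) ^ 2)
      + 2 * Re (Cconj c * ((w + z1) * Cconj (1 + Cconj z1 * w)))%C = 0) by (rewrite <- Hm, <- Hr; lra).
    assert (K : A * (Cmod (1 + Cconj z1 * w) ^ 2 + Cmod (w + z1) ^ 2)
      + 2 * Re (Cconj c * ((w + z1) * Cconj (1 + Cconj z1 * w)))%C
      = (A * (1 + Cmod z1 ^ 2) + 2 * Re (Cconj c * z1)%C) * (1 + Cmod w ^ 2) + 2 * Re (Cconj c' * w)%C).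
    { unfold c'. rewrite !Cmod_sqr. destruct z1, w, c. unfold Re, Im; simpl. ring. }
    rewrite Ez', E1 in K. lra. }
  assert (Hc' : c' <> 0%C).
  { intros E. apply Hne.
    assert (E2 : (c' * RtoC (1 + Cmod z1 ^ 2))%C = (RtoC (1 - Cmod z1 ^ 2) * (c - Cconj c * (z1 * z1))
      + 2 * RtoC (A * (1 + Cmod z1 ^ 2) + 2 * Re (Cconj c * z1)%C) * z1)%C).
    { unfold c'. rewrite Cmod_sqr. destruct z1, c. apply injective_projections; unfold Re, Im; simpl; ring. }
    rewrite E, E1 in E2. unfold unit_disk in D1. pose proof (Cmod_ge_0 z1) as Z0.
    assert (Zp : 0 < 1 - Cmod z1 ^ 2) by (clear - D1 Z0; nra).
    assert (E3 : (c - Cconj c * (z1 * z1))%C = 0%C).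
    { assert (Hnz : RtoC (1 - Cmod z1 ^ 2) <> 0%C) by (intros E'; apply RtoC_inj in E'; lra).
      replace (c - Cconj c * (z1 * z1))%C with ((RtoC (1 - Cmod z1 ^ 2) * (c - Cconj c * (z1 * z1))
        + 2 * 0 * z1) / RtoC (1 - Cmod z1 ^ 2))%C by (field; exact Hnz).
      rewrite <- E2. unfold Cdiv. ring. }
    assert (Ec : c = 0%C).
    { apply Cmod_eq_0. assert (Ecm : Cmod c = Cmod c * (Cmod z1 * Cmod z1)).
      { rewrite <- (Cmod_conj c) at 2. rewrite <- !Cmod_mult. f_equal.
        replace c with (c - Cconj c * (z1 * z1) + Cconj c * (z1 * z1))%C at 1 by ring. rewrite E3. ring. }
      pose proof (Cmod_ge_0 c). nra. }
    split; [|exact Ec]. rewrite Ec in E1. replace (Cconj 0 * z1)%C with (RtoC 0) in E1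
      by (apply injective_projections; simpl; ring).
    unfold Re in E1; simpl in E1. nra. }
  pose proof (Hline z2 G2) as L2. pose proof (Hline z3 G3) as L3.
  revert L2 L3. generalize (mob (- z1) z2) as w2, (mob (- z1) z3) as w3.
  pose proof (Re_Im_sqr_pos c' Hc') as Hp. clear -Hp. destruct c' as [a b].
  intros [x2 y2] [x3 y3]. unfold Re, Im in *; simpl in *. intros L2 L3.
  assert (L2' : a * x2 + b * y2 = 0) by lra. assert (L3' : a * x3 + b * y3 = 0) by lra.
  assert (Ha : a * (x2 * y3 - y2 * x3) = 0).
  { replace (a * (x2 * y3 - y2 * x3)) with ((a * x2 + b * y2) * y3 - (a * x3 + b * y3) * y2) by ring.
    rewrite L2', L3'. ring. }
  assert (Hb : b * (x2 * y3 - y2 * x3) = 0).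
  { replace (b * (x2 * y3 - y2 * x3)) with ((a * x3 + b * y3) * x2 - (a * x2 + b * y2) * x3) by ring.
    rewrite L2', L3'. ring. }
  assert (Hz : x2 * y3 - y2 * x3 = 0).
  { apply Rmult_integral in Ha. destruct Ha as [Ha|Ha]; [|exact Ha].
    apply Rmult_integral in Hb. destruct Hb as [Hb|Hb]; [|exact Hb]. subst. lra. }
  lra.
Qed.

Lemma mob_opp_neq0 (z1 z2 : C) : unit_disk z1 -> unit_disk z2 -> z1 <> z2 -> mob (- z1) z2 <> 0%C.
Proof.
  intros H1 H2 Hne E. apply Hne. rewrite <- (mob_cancel' z1 z2 H1 H2), E. symmetry. apply mob_0.
Qed.

Definition between (x b y : C) : Prop := exists t, 0 < t < 1 /\ b = seg x y t.

Lemma mob_opp_scaled (s : R) (w : C) : unit_disk w -> s < 1 ->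
  mob (- w) (s * w) = (RtoC ((s - 1) / (1 - s * Cmod w ^ 2)) * w)%C.
Proof.
  intros Hw Hs. unfold unit_disk in Hw. pose proof (Cmod_ge_0 w).
  assert (Hd : 0 < 1 - s * Cmod w ^ 2) by nra.
  unfold mob.
  assert (E1 : (1 + Cconj (- w) * (s * w))%C = RtoC (1 - s * Cmod w ^ 2)).
  { rewrite Cmod_sqr. destruct w; apply injective_projections; unfold Re, Im; simpl; ring. }
  rewrite E1, RtoC_div by lra. rewrite (RtoC_minus s 1).
  assert (Hn : RtoC (1 - s * Cmod w ^ 2) <> 0%C) by (intros E; apply RtoC_inj in E; lra).
  field. exact Hn.
Qed.

(** In the coordinate centred at [z1] the other two points are [w2] and [s w2],
    with [s] real by [geodesic_collinear]. The position of [s] relative to 0 and 1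
    tells which of the three points is in the middle. *)
Lemma geodesic_between (G : C -> Prop) (z1 z2 z3 : C) :
  hgeodesic G -> G z1 -> G z2 -> G z3 -> z1 <> z2 -> z1 <> z3 -> z2 <> z3 ->
  between z1 z3 z2 \/ between z1 z2 z3 \/ between z2 z1 z3.
Proof.
  intros HG G1 G2 G3 N12 N13 N23.
  destruct (geodesic_equation G HG) as [A [c [_ Hd]]].
  pose proof (proj1 (Hd _ G1)) as D1. pose proof (proj1 (Hd _ G2)) as D2.
  pose proof (proj1 (Hd _ G3)) as D3.
  pose proof (geodesic_collinear G z1 z2 z3 HG G1 G2 G3) as HI.
  pose proof (mob_opp_neq0 z1 z2 D1 D2 N12) as W2. pose proof (mob_opp_neq0 z1 z3 D1 D3 N13) as W3.
  pose proof (mob_cancel' z1 z2 D1 D2) as C2. pose proof (mob_cancel' z1 z3 D1 D3) as C3.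
  assert (Dw2 : unit_disk (mob (- z1) z2)) by (apply mob_opp_disk; assumption).
  assert (Dw3 : unit_disk (mob (- z1) z3)) by (apply mob_opp_disk; assumption).
  unfold between, seg at 1 2.
  set (w2 := mob (- z1) z2) in *. set (w3 := mob (- z1) z3) in *.
  assert (Hs : exists s : R, w3 = (s * w2)%C).
  { exists (Re (Cconj w2 * w3)%C / Cmod w2 ^ 2). apply Re_Im_sqr_pos in W2. rewrite <- Cmod2_alt in W2.
    assert (E : (Cconj w2 * w3)%C = RtoC (Re (Cconj w2 * w3)%C)).
    { apply injective_projections; [reflexivity|exact HI]. }
    assert (Hn : RtoC (Cmod w2 ^ 2) <> 0%C) by (intros E'; apply RtoC_inj in E'; lra).
    rewrite RtoC_div, <- E by lra.
    replace w3 with (RtoC (Cmod w2 ^ 2) * w3 / RtoC (Cmod w2 ^ 2))%C at 1 by (field; exact Hn).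
    rewrite Cmod2_conj at 1. field. exact Hn. }
  destruct Hs as [s Es].
  assert (S0 : s <> 0) by (intros ->; apply W3; rewrite Es; ring).
  assert (S1 : s <> 1).
  { intros ->. apply N23. rewrite <- C2, <- C3, Es. f_equal. ring. }
  clearbody w2 w3.
  destruct (Rlt_dec s 0) as [Hneg|Hneg]; [|destruct (Rlt_dec s 1) as [Hlt|Hlt]].
  - right; right. unfold seg.
    destruct (mob_transition z1 w2 D1 Dw2) as [e [He He']]. rewrite C2 in He'.
    pose proof (He' w3 Dw3) as E3. rewrite C3, Es in E3. rewrite mob_opp_scaled in E3 by (try assumption; lra).
    pose proof (He' 0%C disk_0) as E1. rewrite !mob_0 in E1.
    unfold unit_disk in Dw2. pose proof (proj1 (Cmod_gt_0 w2) W2) as Hw2.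
    assert (Hc : 0 < Cmod w2 ^ 2 < 1) by (clear - Dw2 Hw2; nra).
    assert (Hp : 0 < 1 - s * Cmod w2 ^ 2) by (clear - Hneg Hc; nra).
    (* Seen from [z2], the points [z1] and [z3] are [- w2] and
       [(s - 1) / (1 - s |w2|^2) w2], up to a common rotation. *)
    exists ((1 - s * Cmod w2 ^ 2) / (1 - s)). split.
    + split; [apply Rdiv_lt_0_compat; lra|]. apply (Rmult_lt_reg_r (1 - s)); [lra|].
      unfold Rdiv. rewrite Rmult_assoc, Rinv_l by lra. clear - Hneg Hc. nra.
    + rewrite E3. transitivity (mob z2 (mob (- z2) z1)); [symmetry; apply mob_cancel'; assumption|].
      rewrite E1. f_equal.
      replace (RtoC ((1 - s * Cmod w2 ^ 2) / (1 - s)) * (e * (RtoC ((s - 1) / (1 - s * Cmod w2 ^ 2)) * w2)))%C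
        with (RtoC ((1 - s * Cmod w2 ^ 2) / (1 - s) * ((s - 1) / (1 - s * Cmod w2 ^ 2))) * (e * w2))%C
        by (rewrite RtoC_mult; ring).
      replace ((1 - s * Cmod w2 ^ 2) / (1 - s) * ((s - 1) / (1 - s * Cmod w2 ^ 2))) with (-1) by (field; lra).
      replace (RtoC (-1)) with (- (1))%C by (apply injective_projections; simpl; ring). ring.
  - left. exists s. split; [lra|]. rewrite <- Es. symmetry; exact C3.
  - right; left. exists (/ s). split.
    + split; [apply Rinv_0_lt_compat; lra|]. rewrite <- Rinv_1. apply Rinv_lt_contravar; lra.
    + rewrite Es, RtoC_inv by exact S0. rewrite <- C2 at 1. f_equal. field.
      intros E; apply RtoC_inj in E; lra.
Qed.

(** * Sublevel sets of the distance defect *)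

Definition holo_self_map (f : C -> C) : Prop :=
  (forall z, unit_disk z -> unit_disk (f z)) /\ (forall z, unit_disk z -> holo_at f z).

Definition defect (f : C -> C) (z0 w0 z : C) : R := k_disk z z0 - k_disk (f z) w0.

Lemma continuous_defect (f : C -> C) (z0 w0 : C) {U : UniformSpace} (h : U -> C) (u : U) :
  holo_self_map f -> unit_disk z0 -> unit_disk w0 -> ctsC h u -> unit_disk (h u) ->
  continuous (fun v => defect f z0 w0 (h v)) u.
Proof.
  intros [Hd Hh] D0 E0 Hc Du. unfold defect.
  apply continuous_Rminus; apply continuous_k; try assumption; try cts.
  - apply (continuous_comp h f); [exact Hc|]. apply holo_at_continuous, Hh, Du.
  - apply Hd, Du.
Qed.

(** The distance from [z0] to [z] splits at the point [seg z0 z t], and by the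
    Schwarz-Pick lemma [f] does not increase the remaining distance. *)
Lemma defect_seg_le (f : C -> C) (z0 w0 z : C) (t : R) :
  holo_self_map f -> unit_disk z0 -> unit_disk w0 -> unit_disk z -> 0 <= t <= 1 ->
  defect f z0 w0 (seg z0 z t) <= defect f z0 w0 z.
Proof.
  intros [Hd Hh] D0 E0 Dz Ht. unfold defect.
  pose proof (k_seg z0 z t D0 Dz Ht) as E. pose proof (seg_disk z0 z t D0 Dz Ht) as Ds.
  pose proof (k_schwarz_pick f Hd Hh z (seg z0 z t) Dz Ds) as SP.
  pose proof (k_triangle (f z) w0 (f (seg z0 z t)) (Hd _ Dz) E0 (Hd _ Ds)) as T.
  rewrite (k_sym w0) in T. lra.
Qed.

(** Centring at [b = seg z1 z2 t0] and at [f b], and rotating by [eta] so that the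
    segment becomes real, reduces this to [no_local_max_at_0]. *)
Lemma no_interior_max (f : C -> C) (z0 w0 z1 z2 : C) (mu t0 : R) :
  holo_self_map f -> unit_disk z0 -> unit_disk w0 -> mu < 0 -> defect f z0 w0 z0 < mu ->
  unit_disk z1 -> unit_disk z2 -> z1 <> z2 -> 0 < t0 < 1 ->
  defect f z0 w0 (seg z1 z2 t0) = mu ->
  (forall t, 0 <= t <= 1 -> defect f z0 w0 (seg z1 z2 t) <= mu) -> False.
Proof.
  intros [Hd Hh] D0 E0 Hmu Hz0 D1 D2 Hne Ht0 Hb Hle.
  assert (Db : unit_disk (seg z1 z2 t0)) by (apply seg_disk; try assumption; lra).
  assert (Dw : unit_disk (mob (- z1) z2)) by (apply mob_opp_disk; assumption).
  pose proof (mob_opp_neq0 z1 z2 D1 D2 Hne) as Hw.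
  unfold seg in *. set (w := mob (- z1) z2) in *. clearbody w.
  assert (Dt : forall t : R, 0 <= t <= 1 -> unit_disk (t * w)%C) by (intros; apply scaled_disk; assumption).
  destruct (mob_transition z1 (t0 * w) D1 (Dt t0 ltac:(lra))) as [e [He Htr]].
  set (b := mob z1 (t0 * w)) in *.
  pose proof (proj1 (Cmod_gt_0 w) Hw) as Hr. unfold unit_disk in Dw.
  set (r := Cmod w) in *.
  assert (Hrn : RtoC r <> 0%C) by (intros E; apply RtoC_inj in E; lra).
  set (eta := (e * w / r)%C).
  assert (Heta : Cmod eta = 1).
  { unfold eta. rewrite Cmod_div by exact Hrn. rewrite Cmod_mult, He, Cmod_R, Rabs_pos_eq by lra.
    fold r. field. lra. }
  assert (Ee : (eta * Cconj eta)%C = RtoC 1) by (apply unimodular_mult_conj, Heta).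
  assert (Deta : forall z, unit_disk z -> unit_disk (eta * z)%C).
  { intros z Hz. unfold unit_disk. rewrite Cmod_mult, Heta, Rmult_1_l. exact Hz. }
  set (F := fun z => mob (- f b) (f (mob b (eta * z)))).
  set (p := (Cconj eta * mob (- b) z0)%C).
  set (q := mob (- f b) w0).
  assert (Dp : unit_disk p).
  { unfold p, unit_disk. rewrite Cmod_mult, Cmod_conj, Heta, Rmult_1_l.
    apply mob_opp_disk; assumption. }
  assert (Dq : unit_disk q) by (apply mob_disk; [apply disk_opp, Hd|]; assumption).
  assert (Ep : mob b (eta * p) = z0).
  { unfold p. rewrite Cmult_assoc, Ee, Cmult_1_l. apply mob_cancel'; assumption. }
  assert (Kp : forall z, unit_disk z -> k_disk z p = k_disk (mob b (eta * z)) z0).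
  { intros z Hz. rewrite <- Ep, k_mob by auto. rewrite k_rotation by exact Heta. reflexivity. }
  assert (Kq : forall z, unit_disk z -> k_disk (F z) q = k_disk (f (mob b (eta * z))) w0).
  { intros z Hz. unfold F, q. apply k_mob; [apply disk_opp, Hd|apply Hd, mob_disk|]; auto. }
  assert (Eb0 : mob b (eta * 0) = b).
  { replace (eta * 0)%C with (RtoC 0) by ring. apply mob_0. }
  assert (Hdef : forall z, unit_disk z -> defect f z0 w0 (mob b (eta * z)) = k_disk z p - k_disk (F z) q).
  { intros z Hz. unfold defect. rewrite Kp, Kq by exact Hz. reflexivity. }
  assert (F0 : F 0 = 0%C).
  { unfold F. rewrite Eb0. apply mob_opp_self. }
  apply (no_local_max_at_0 F p q (- mu) (r * Rmin t0 (1 - t0))); try assumption.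
  - intros z Hz. unfold F.
    apply (holo_at_comp (mob (- f b)) (fun z => f (mob b (eta * z)))).
    + apply holo_at_mob; [apply disk_opp, Hd; exact Db|]. apply Rlt_le, Hd, mob_disk; auto.
    + apply (holo_at_comp f (fun z => mob b (eta * z))); [apply Hh, mob_disk; auto|].
      apply (holo_at_comp (mob b) (fun z => eta * z)%C).
      * apply holo_at_mob; [exact Db|apply Rlt_le, Deta, Hz].
      * apply holo_at_mult; [apply holo_at_const|apply holo_at_id].
  - intros z Hz. apply mob_disk; [apply disk_opp, Hd; exact Db|]. apply Hd, mob_disk; auto.
  - lra.
  - apply Rmult_lt_0_compat; [exact Hr|]. apply Rmin_glb_lt; lra.
  - pose proof (Hdef 0%C disk_0) as E. rewrite Eb0, F0, Hb in E. lra.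
  - intros t Ht Ht1.
    assert (Dtt : unit_disk t) by (apply abs_lt1_disk; exact Ht1).
    pose proof (Hdef t Dtt) as E.
    (* The parameter for which [seg z1 z2 s] has the coordinate [eta t]. *)
    set (s := (t / r + t0) / (1 + t * t0 * r)).
    pose proof (Rmin_l t0 (1 - t0)) as M1. pose proof (Rmin_r t0 (1 - t0)) as M2.
    apply Rabs_def2 in Ht. apply Rabs_def2 in Ht1.
    assert (Q0 : 0 < t0 * r < 1) by nra.
    assert (Hden : 0 < 1 + t * t0 * r) by nra.
    assert (Hdiv : t / r = t * / r) by reflexivity.
    assert (Hs : 0 <= s <= 1).
    { assert (B1 : - t0 <= t / r <= 1 - t0).
      { split; apply (Rmult_le_reg_r r); try exact Hr; unfold Rdiv;
          rewrite ?(Rmult_assoc t), ?Rinv_l by lra; nra. }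
      unfold s. split.
      - apply Rmult_le_pos; [lra|]. left; apply Rinv_0_lt_compat; exact Hden.
      - apply (Rmult_le_reg_r (1 + t * t0 * r)); [exact Hden|].
        unfold Rdiv at 1. rewrite Rmult_assoc, Rinv_l by lra.
        assert (Ert : t = (t / r) * r) by (field; lra).
        assert (0 <= 1 - t0 - (t / r) * (1 - r * r * t0)).
        { destruct (Rle_dec 0 (t / r)); nra. }
        rewrite Ert at 2. lra. }
    assert (Es : mob z1 (s * w) = mob b (eta * t)).
    { rewrite <- (mob_cancel' b (mob z1 (s * w)) Db) by (apply mob_disk; auto).
      rewrite (Htr _ (Dt s Hs)). f_equal.
      assert (Hds : 0 < 1 - t0 * s * r ^ 2).
      { assert (0 <= s * r <= 1) by nra. assert (t0 * s * r ^ 2 = (t0 * r) * (s * r)) by ring. nra. }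
      unfold mob.
      assert (E1 : (1 + Cconj (- (t0 * w)) * (s * w))%C = RtoC (1 - t0 * s * r ^ 2)).
      { unfold r. rewrite Cmod_sqr. destruct w; apply injective_projections; unfold Re, Im; simpl; ring. }
      rewrite E1. unfold eta.
      replace (s * w + - (t0 * w))%C with (RtoC (s - t0) * w)%C by (rewrite RtoC_minus; ring).
      assert (Ets : (s - t0) / (1 - t0 * s * r ^ 2) = t / r).
      { unfold s. assert (0 < 1 - t0 * t0 * r * r) by nra. field.
        repeat split; lra. }
      replace (e * (RtoC (s - t0) * w / RtoC (1 - t0 * s * r ^ 2)))%C
        with (e * w * RtoC ((s - t0) / (1 - t0 * s * r ^ 2)))%C.
      - rewrite Ets, RtoC_div by lra. field. exact Hrn.
      - rewrite RtoC_div by lra. field. intros E'; apply RtoC_inj in E'; lra. }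
    rewrite <- Es in E. specialize (Hle s Hs). lra.
  - rewrite Kq, Ep by exact Dp. unfold defect in Hz0. rewrite k_self in Hz0. lra.
Qed.

(** Let the end points run from [z0] along the segments to [z1] and [z2]; the
    defect stays below [mu] there. If the segment between them ever met the
    complement, then at the first such parameter it would touch the level [mu]
    from below, contrary to [no_interior_max]. *)
Lemma sublevel_seg (f : C -> C) (z0 w0 z1 z2 : C) (mu : R) :
  holo_self_map f -> unit_disk z0 -> unit_disk w0 -> mu < 0 ->
  unit_disk z1 -> unit_disk z2 -> defect f z0 w0 z1 < mu -> defect f z0 w0 z2 < mu ->
  forall t, 0 <= t <= 1 -> defect f z0 w0 (seg z1 z2 t) < mu.
Proof.
  intros Hf D0 E0 Hmu D1 D2 H1 H2 t1 Ht1. apply Rnot_le_lt. intros Hge.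
  set (a := seg z0 z1). set (b := seg z0 z2).
  set (Phi := fun st : R * R => defect f z0 w0 (seg (a (fst st)) (b (fst st)) (snd st))).
  assert (Da : forall s, 0 <= s <= 1 -> unit_disk (a s)) by (intros; apply seg_disk; assumption).
  assert (Dbb : forall s, 0 <= s <= 1 -> unit_disk (b s)) by (intros; apply seg_disk; assumption).
  assert (Ha : forall s, 0 <= s <= 1 -> defect f z0 w0 (a s) < mu).
  { intros s Hs. eapply Rle_lt_trans; [apply defect_seg_le; assumption|exact H1]. }
  assert (Hb : forall s, 0 <= s <= 1 -> defect f z0 w0 (b s) < mu).
  { intros s Hs. eapply Rle_lt_trans; [apply defect_seg_le; assumption|exact H2]. }
  assert (Hc : forall s t, 0 <= s <= 1 -> 0 <= t <= 1 -> continuous Phi (s, t)).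
  { intros s t Hs Ht. apply continuous_defect; try assumption; [|apply seg_disk; simpl; auto].
    apply continuous_seg; simpl; auto; [| |apply continuous_snd].
    - apply (continuous_seg (fun _ => z0) (fun _ => z1) (fun st : R * R => fst st)); try assumption; cts.
    - apply (continuous_seg (fun _ => z0) (fun _ => z2) (fun st : R * R => fst st)); try assumption; cts. }
  (* A maximum of [g] is a point with [mu <= Phi] and least [s]: the value -2 is
     below all the values [- s] for [s] in the unit interval. *)
  set (g := fun s t : R => if Rle_dec mu (Phi (s, t)) then - s else -2).
  destruct (rect_max g 0 0 1 1) as [s [t [Hst Hmax]]]; try lra.
  - intros s t [Hs Ht] c Hgc.
    assert (Hs' : 0 <= s <= 1) by lra. assert (Ht' : 0 <= t <= 1) by lra. unfold g in *.
    destruct (Rle_dec mu (Phi (s, t))) as [Hp|Hp].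
    + exists (c + s). split; [lra|]. intros s' t' _ Hs'' _. apply Rabs_def2 in Hs''.
      destruct (Rle_dec mu (Phi (s', t'))); lra.
    + destruct (continuous_R2_eps Phi (s, t) (Hc s t Hs' Ht') (mu - Phi (s, t)) ltac:(lra)) as [d [Hd Hnear]].
      exists d. split; [exact Hd|]. intros s' t' _ Hs'' Ht''.
      specialize (Hnear s' t' Hs'' Ht''). apply Rabs_def2 in Hnear.
      destruct (Rle_dec mu (Phi (s', t'))); lra.
  - assert (Hs : 0 <= s <= 1) by (unfold in_rect in Hst; lra).
    assert (Ht : 0 <= t <= 1) by (unfold in_rect in Hst; lra).
    assert (Hfirst : mu <= Phi (s, t) /\ forall s' t', 0 <= s' <= 1 -> 0 <= t' <= 1 ->
      mu <= Phi (s', t') -> s <= s').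
    { assert (Hge' : mu <= Phi (1, t1)).
      { unfold Phi, a, b; simpl. rewrite !seg_1 by assumption. exact Hge. }
      assert (Hp : mu <= Phi (s, t)).
      { pose proof (Hmax 1 t1 ltac:(unfold in_rect; lra)) as Hm. unfold g in Hm.
        destruct (Rle_dec mu (Phi (1, t1))); [|contradiction].
        destruct (Rle_dec mu (Phi (s, t))); [assumption|lra]. }
      split; [exact Hp|]. intros s' t' Hs' Ht' Hp'.
      pose proof (Hmax s' t' ltac:(unfold in_rect; lra)) as Hm. unfold g in Hm.
      destruct (Rle_dec mu (Phi (s', t'))); [|contradiction].
      destruct (Rle_dec mu (Phi (s, t))); [lra|contradiction]. }
    destruct Hfirst as [Hp Hfirst].
    assert (Hz0 : defect f z0 w0 z0 < mu) by (rewrite <- (seg_0 z0 z1) at 2; apply (Ha 0); lra).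
    assert (Hs0 : 0 < s).
    { destruct (proj1 Hs) as [L|E]; [exact L|exfalso]. subst s.
      unfold Phi, a, b in Hp; simpl in Hp. rewrite !seg_0, seg_self in Hp. lra. }
    assert (Hle : forall t', 0 <= t' <= 1 -> Phi (s, t') <= mu).
    { intros t' Ht'. apply Rnot_lt_le. intros Hlt.
      destruct (continuous_R2_eps Phi (s, t') (Hc s t' Hs Ht') (Phi (s, t') - mu) ltac:(lra)) as [d [Hd Hnear]].
      pose proof (Rmin_l d s) as M1. pose proof (Rmin_r d s) as M2.
      assert (M3 : 0 < Rmin d s) by (apply Rmin_glb_lt; assumption).
      specialize (Hnear (s - Rmin d s / 2) t'). simpl in Hnear.
      specialize (Hnear ltac:(apply Rabs_def1; lra) ltac:(apply Rabs_def1; lra)).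
      apply Rabs_def2 in Hnear.
      specialize (Hfirst (s - Rmin d s / 2) t' ltac:(lra) Ht' ltac:(lra)). lra. }
    assert (Hta : t <> 0).
    { intros ->. unfold Phi in Hp; simpl in Hp. rewrite seg_0 in Hp. specialize (Ha s Hs). lra. }
    assert (Htb : t <> 1).
    { intros ->. unfold Phi in Hp; simpl in Hp. rewrite seg_1 in Hp by auto. specialize (Hb s Hs). lra. }
    apply (no_interior_max f z0 w0 (a s) (b s) mu t); auto; try lra.
    + intros E. unfold Phi in Hp; simpl in Hp. rewrite E, seg_self in Hp. specialize (Hb s Hs). lra.
    + apply Rle_antisym; [apply (Hle t Ht)|exact Hp].
Qed.

Lemma boundary_defect (f : C -> C) (z0 w0 z : C) (mu : R) :
  holo_self_map f -> unit_disk z0 -> unit_disk w0 -> unit_disk z ->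
  boundary (D_mu mu f z0 w0) z -> defect f z0 w0 z = mu.
Proof.
  intros Hf D0 E0 Dz Hbd.
  assert (Hc : continuous (T := C_UniformSpace) (fun z => defect f z0 w0 z) z)
    by (apply (continuous_defect f z0 w0 (fun z => z)); try assumption; cts).
  destruct (Rtotal_order (defect f z0 w0 z) mu) as [L|[E|G]]; [exfalso|exact E|exfalso].
  - destruct (continuous_R_eps _ z Hc (mu - defect f z0 w0 z)) as [d [Hd H]]; [lra|].
    unfold unit_disk in Dz.
    destruct (Hbd (Rmin d (1 - Cmod z))) as [_ [w [Hw Hnw]]]; [apply Rmin_glb_lt; lra|].
    pose proof (Rmin_l d (1 - Cmod z)). pose proof (Rmin_r d (1 - Cmod z)).
    apply Hnw. split.
    + pose proof (Cmod_triangle z (w - z)) as T. replace (z + (w - z))%C with w in T by ring.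
      unfold unit_disk. lra.
    + specialize (H w ltac:(lra)). apply Rabs_def2 in H. fold (defect f z0 w0 w). lra.
  - destruct (continuous_R_eps _ z Hc (defect f z0 w0 z - mu)) as [d [Hd H]]; [lra|].
    destruct (Hbd d Hd) as [[w [Hw [_ Hm]]] _]. fold (defect f z0 w0 w) in Hm.
    specialize (H w Hw). apply Rabs_def2 in H. lra.
Qed.

(** As [x] and [y] are limits of points of the sublevel set, which is convex, the
    defect is at most [mu] on the segment between them; so [b] would be an
    interior maximum. *)
Lemma no_boundary_between (f : C -> C) (z0 w0 x b y : C) (mu : R) :
  holo_self_map f -> unit_disk z0 -> unit_disk w0 -> mu < 0 -> defect f z0 w0 z0 < mu ->
  unit_disk x -> unit_disk b -> unit_disk y -> x <> y ->
  boundary (D_mu mu f z0 w0) x -> boundary (D_mu mu f z0 w0) b -> boundary (D_mu mu f z0 w0) y ->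
  between x b y -> False.
Proof.
  intros Hf D0 E0 Hmu Hz0 Dx Db Dy Hne Bx Bb By [t0 [Ht0 Eb]].
  apply (no_interior_max f z0 w0 x y mu t0); try assumption.
  - rewrite <- Eb. apply boundary_defect; assumption.
  - intros t Ht. apply Rnot_lt_le. intros Hlt.
    assert (Hc : continuous (T := prod_UniformSpace C_UniformSpace C_UniformSpace)
      (fun p => defect f z0 w0 (seg (fst p) (snd p) t)) (x, y)).
    { apply continuous_defect; try assumption; [|apply seg_disk; assumption].
      apply (continuous_seg (fun p : C * C => fst p) (fun p : C * C => snd p) (fun _ => t));
        try assumption; [apply continuous_fst|apply continuous_snd|apply continuous_const]. }
    pose proof (Hc (fun r => mu < r)) as Hl.
    assert (Hopen : locally (defect f z0 w0 (seg x y t)) (fun r => mu < r)) by (apply (open_gt mu); exact Hlt).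
    destruct (Hl Hopen) as [d Hd].
    pose proof (proj1 (locally_Cmod x (ball (x : C_UniformSpace) d))) as Lx.
    pose proof (proj1 (locally_Cmod y (ball (y : C_UniformSpace) d))) as Ly.
    destruct (Lx (locally_ball (x : C_UniformSpace) d)) as [dx [Hdx Hx]].
    destruct (Ly (locally_ball (y : C_UniformSpace) d)) as [dy [Hdy Hy]].
    destruct (Bx dx Hdx) as [[x' [Hx' [Dx' Mx]]] _]. destruct (By dy Hdy) as [[y' [Hy' [Dy' My]]] _].
    specialize (Hd (x', y') (conj (Hx _ Hx') (Hy _ Hy'))). simpl in Hd.
    pose proof (sublevel_seg f z0 w0 x' y' mu Hf D0 E0 Hmu Dx' Dy' Mx My t Ht). lra.
Qed.

Theorem theorem4p1 (mu : R) (Hmu : mu < 0) (z0 w0 : C)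
    (Hz0 : unit_disk z0) (Hw0 : unit_disk w0) (f : C -> C)
    (Hf_disk : forall z, unit_disk z -> unit_disk (f z))
    (Hf_hol : holomorphic_on unit_disk f) :
  (forall z, ~ D_mu mu f z0 w0 z) \/
  (strictly_hconvex (D_mu mu f z0 w0) /\ is_domain (D_mu mu f z0 w0)).
Proof.
  assert (Hf : holo_self_map f).
  { split; [exact Hf_disk|]. intros z Hz. apply ex_derive_holo_at, Hf_hol, Hz. }
  destruct (classic (exists z, D_mu mu f z0 w0 z)) as [[zz [Dzz Mzz]]|Hno];
    [right|left; intros z Hz; apply Hno; exists z; exact Hz].
  assert (Hstar : forall z t, D_mu mu f z0 w0 z -> 0 <= t <= 1 -> D_mu mu f z0 w0 (seg z0 z t)).
  { intros z t [Dz Mz] Ht. split; [apply seg_disk; assumption|].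
    eapply Rle_lt_trans; [apply (defect_seg_le f z0 w0 z t); assumption|exact Mz]. }
  assert (M0 : defect f z0 w0 z0 < mu).
  { rewrite <- (seg_0 z0 zz) at 2. apply (Hstar zz 0); [split; assumption|lra]. }
  split; [split; [split|]|split; [|split]].
  - intros z [Dz _]; exact Dz.
  - intros z1 z2 [D1 M1] [D2 M2] z Hz.
    destruct (hsegment_seg z1 z2 z D1 D2 Hz) as [t [Ht ->]].
    split; [apply seg_disk; assumption|]. apply (sublevel_seg f z0 w0 z1 z2 mu); assumption.
  - intros G HG. apply NNPP. intros Hcon.
    assert (Hpick : forall a b : C, exists z, G z /\ boundary (D_mu mu f z0 w0) z /\ z <> a /\ z <> b).
    { intros a b. apply NNPP. intros Hn. apply Hcon. exists a, b. intros z Gz Bz.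
      apply NNPP. intros Hz. apply Hn. exists z. tauto. }
    destruct (Hpick z0 z0) as [z1 [G1 [B1 _]]].
    destruct (Hpick z1 z1) as [z2 [G2 [B2 [N21 _]]]].
    destruct (Hpick z1 z2) as [z3 [G3 [B3 [N31 N32]]]].
    destruct (geodesic_equation G HG) as [A [c [_ HD]]].
    pose proof (proj1 (HD _ G1)) as D1. pose proof (proj1 (HD _ G2)) as D2. pose proof (proj1 (HD _ G3)) as D3.
    destruct (geodesic_between G z1 z2 z3 HG G1 G2 G3) as [K|[K|K]]; auto; revert K;
      apply (no_boundary_between f z0 w0 _ _ _ mu); auto.
  - exists zz; split; assumption.
  - apply (path_connected _ z0). intros z Hz. exists (seg z0 z). split; [apply seg_0|].
    split; [apply seg_1; [exact Hz0|apply Hz]|]. intros t Ht. split; [apply Hstar; assumption|].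
    destruct Hz as [Dz _].
    apply (continuous_seg (fun _ => z0) (fun _ => z) (fun t => t)); try assumption; cts.
  - intros z [Dz Mz].
    assert (Hc : continuous (T := C_UniformSpace) (fun z => defect f z0 w0 z) z)
      by (apply (continuous_defect f z0 w0 (fun z => z)); try assumption; cts).
    destruct (continuous_R_eps _ z Hc (mu - defect f z0 w0 z)) as [d [Hd H]].
    { unfold defect. lra. }
    unfold unit_disk in Dz. pose proof (Rmin_l d (1 - Cmod z)). pose proof (Rmin_r d (1 - Cmod z)).
    apply locally_Cmod. exists (Rmin d (1 - Cmod z)). split; [apply Rmin_glb_lt; lra|].
    intros w Hw. split.
    + pose proof (Cmod_triangle z (w - z)) as T. replace (z + (w - z))%C with w in T by ring.
      unfold unit_disk. lra.
    + specialize (H w ltac:(lra)). apply Rabs_def2 in H. fold (defect f z0 w0 w). lra.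
Qed.
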